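(* Let $N>1$ and let $\mathcal H$ denote either $H^2(B_N)$ or $A^2_\alpha(B_N)$ with $\alpha>-1$. Suppose $\varphi$ and $\psi$ are linear-fractional self-maps of $B_N$, and suppose $\varphi(\zeta)=\zeta$ for some $\zeta\in\partial B_N$. If either $\psi(\zeta)\neq\zeta$, or $\psi(\zeta)=\zeta$ and $D_\zeta\varphi_\zeta(\zeta)\neq D_\zeta\psi_\zeta(\zeta)$, then $C_\varphi-C_\psi$ is not compact on $\mathcal H$.
   Context: $B_N$ is the open unit ball of $\mathbb C^N$ with inner product $\langle z,w\rangle=\sum z_j\overline{w_j}$. $H^2(B_N)$ is the space of analytic $f$ on $B_N$ with $\sup_{0<r<1}\int_{\partial B_N}|f(r\zeta)|^2d\sigma(\zeta)<\infty$ ($\sigma$ normalized surface measure); $A^2_\alpha(B_N)$ is the space of analytic $f$ with $\int_{B_N}|f|^2\frac{\Gamma(N+\alpha+1)}{\Gamma(N+1)\Gamma(\alpha+1)}(1-|z|^2)^\alpha d\nu<\infty$ ($\nu$ normalized volume measure). A linear-fractional self-map of $B_N$ is a map $\varphi(z)=\frac{Az+B}{\langle z,C\rangle+d}$ ($A$ an $N\times N$ matrix, $B,C\in\mathbb C^N$, $d\in\mathbb C$) analytic on $B_N$ with $\varphi(B_N)\subseteq B_N$; it is analytic on a neighborhood of $\overline{B_N}$, so its values and derivatives at boundary points are defined. $C_\varphi f=f\circ\varphi$. For $\zeta\in\partial B_N$, $\psi_\zeta(z)=\langle\psi(z),\zeta\rangle$, and for $\eta\in\mathbb C^N$, $D_\eta\psi_\zeta(z)=\langle\psi'(z)\eta,\zeta\rangle$,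 where $\psi'(z)$ is the complex Jacobian matrix. *)

(* Defs.v *)
From HB Require Import structures.
From mathcomp Require Import all_boot all_order all_algebra.
From mathcomp Require Import all_classical all_reals all_analysis.
From mathcomp Require Import complex.
Set Implicit Arguments. Unset Strict Implicit. Unset Printing Implicit Defensive.
Import Order.TTheory GRing.Theory Num.Theory.
Import numFieldNormedType.Exports.
Local Open Scope classical_set_scope.
Local Open Scope ring_scope.

Section BallDefs.
Variable R : realType.
Local Notation C := (R[i]).
Variable n : nat.
Local Notation N := n.+1.
Local Notation V := 'rV[C]_N.

Definition cinner (z w : V) : C := \sum_(j < N) z 0 j * conjc (w 0 j).

Definition cabs2 (c : C) : R := complex.Re c ^+ 2 + complex.Im c ^+ 2.

Definition vnorm2 (z : V) : R := \sum_(j < N) cabs2 (z 0 j).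

Definition Bball : set V := [set z | vnorm2 z < 1].
Definition Bsphere : set V := [set z | vnorm2 z = 1].

(* Lebesgue integral over C^k = R^(2k) (coordinates Re, Im of each
   complex coordinate), as an iterated Lebesgue integral; for the
   nonnegative measurable integrands used below this is the integral
   against 2k-dimensional Lebesgue measure (Tonelli). *)
Fixpoint cint (k : nat) (g : seq C -> \bar R) : \bar R :=
  if k is k'.+1 then
    (\int[@lebesgue_measure R]_(x in setT)
       \int[@lebesgue_measure R]_(y in setT) cint k' (fun s => g ((x +i* y)%C :: s)))%E
  else g [::].

Definition lebint (f : V -> \bar R) : \bar R :=
  cint N (fun s => f (\row_(j < N) nth 0 s j)).

Definition ball_volume : R := fine (lebint (fun z => if (vnorm2 z < 1)%R then 1%E else 0%E)).

Definition nu_int (f : V -> \bar R) : \bar R :=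
  (lebint (fun z => if (vnorm2 z < 1)%R then f z else 0%E) * (ball_volume^-1)%:E)%E.

(* integral against the normalized surface measure sigma on dB_N,
   via sigma(E) = nu({ r zeta : 0 < r < 1, zeta in E }), i.e.
   int_S g dsigma = int_B g(z/|z|) dnu(z). *)
Definition sigma_int (g : V -> \bar R) : \bar R :=
  nu_int (fun z => g (((Num.sqrt (vnorm2 z))^-1)%:C%C *: z)).

Definition analytic_on_ball (f : V -> C^o) : Prop :=
  forall z, Bball z -> differentiable f (z : (V : normedModType C)).

Definition Gamma (x : R) : R :=
  fine (\int[@lebesgue_measure R]_(t in `]0%R, +oo[%classic) ((t `^ (x - 1)) * expR (- t))%:E)%E.

End BallDefs.

Inductive fspace (R : Type) := Hardy | Bergman of R.
Arguments Hardy {R}.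

Section Spaces.
Variable R : realType.
Local Notation C := (R[i]).
Variable n : nat.
Local Notation N := n.+1.
Local Notation V := 'rV[C]_N.

Definition Hnorm2 (sp : fspace R) (f : V -> C^o) : \bar R :=
  match sp with
  | Hardy =>
      ereal_sup [set sigma_int (fun zeta => (cabs2 (f (r%:C%C *: zeta)))%:E)
                | r in `]0, 1[]
  | Bergman alpha =>
      nu_int (fun z =>
        ((Gamma (N%:R + alpha + 1) / (Gamma (N%:R + 1) * Gamma (alpha + 1)))
          * cabs2 (f z) * (1 - vnorm2 z) `^ alpha)%:E)
  end.

Definition inH (sp : fspace R) (f : V -> C^o) : Prop :=
  analytic_on_ball f /\ (Hnorm2 sp f < +oo)%E.

Definition compact_on (sp : fspace R) (T : (V -> C^o) -> (V -> C^o)) : Prop :=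
  (forall f, inH sp f -> inH sp (T f)) /\
  (forall u : nat -> (V -> C^o),
      (forall k, inH sp (u k) /\ (Hnorm2 sp (u k) <= 1)%E) ->
      exists (sub : nat -> nat) (g : V -> C^o),
        {homo sub : m n / (m < n)%N >-> (m < n)%N} /\ inH sp g /\
        ((fun k => Hnorm2 sp (T (u (sub k)) - g)) @ \oo --> 0%E)).

(* linear-fractional map z |-> (A z + B) / (<z,C> + d); with z a row vector,
   A z is written z *m A^T *)
Definition linfrac (A : 'M[C]_N) (B Cv : V) (d : C) (z : V) : V :=
  (cinner z Cv + d)^-1 *: (z *m A^T + B).

(* linear-fractional self-map of B_N: analytic on B_N (denominator does not
   vanish there) and mapping B_N into B_N *)
Definition lf_selfmap (A : 'M[C]_N) (B Cv : V) (d : C) : Prop :=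
  (forall z, Bball z -> cinner z Cv + d != 0) /\
  (forall z, Bball z -> Bball (linfrac A B Cv d z)).

Definition Cdiff (phi psi : V -> V) (f : V -> C^o) : V -> C^o :=
  fun z => f (phi z) - f (psi z).

Definition Dcomp (phi : V -> V) (eta zeta z : V) : C :=
  cinner ('d phi (z : (V : normedModType C)) eta) zeta.

End Spaces.

(* Main.v *)
Require Import Defs.
From HB Require Import structures.
From mathcomp Require Import all_boot all_order all_algebra.
From mathcomp Require Import all_classical all_reals all_analysis.
From mathcomp Require Import measurable_realfun complex ring lra zify.
Set Implicit Arguments. Unset Strict Implicit. Unset Printing Implicit Defensive.
Import Order.TTheory GRing.Theory Num.Theory.
Import numFieldNormedType.Exports.
Local Open Scope classical_set_scope.
Local Open Scope ring_scope.

(** Let [beta = N] (Hardy) or [beta = N + 1 + alpha] (Bergman).  Put [w_k = (1 - d_k) zeta]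
    with [d_k -> 0] and test the operator on [u_k z = kappa_k / (1 - <z, w_k>)^p], where [p] is large and
    [kappa_k^2] is a multiple of [d_k^(2p - beta)], so that the norms stay at most [1].  Then
    [d_k^(beta/2) * (C_phi u_k - C_psi u_k)(w_k)] is a constant times
    [(d_k / (1 - <phi w_k, w_k>))^p - (d_k / (1 - <psi w_k, w_k>))^p].  The first ratio tends to
    [(1 + D_zeta phi_zeta)^-1 <> 0]; the second tends to [(1 + D_zeta psi_zeta)^-1] or to [0].  The limits
    differ, so for one of any two consecutive exponents [p] the difference of the powers stays away from [0].
    For fixed [w], [(C_phi u_l - C_psi u_l)(w)] tends to [0] as [l] grows.  Since
    [|h(w_k)|^2 <= K d_k^(-beta) |h|^2], no subsequence of [C_phi u_k - C_psi u_k] converges in norm.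

    The point evaluation bound is the sub-mean value property over an ellipsoid centred at [w_k], with
    semi-axes [d_k / 4] (radial) and [sqrt d_k / 4] (tangential), which lies in the shell
    [d_k / 2 <= 1 - |z|^2 <= 4 d_k]. *)

(** * Iterated Lebesgue integrals *)

(** Along [w_k = zeta - d_k zeta], the expression [1 - <phi w_k, w_k>] picks up [d_k] from its
    second slot and [d_k D_zeta phi_zeta] from its first, whence the limit [1 + D_zeta phi_zeta] of
    the quotients. It is nonzero because [|1 - <phi w, w>| >= 1 - |w|]. A large [p] serves twice:
    the weighted radial integral asks for [alpha + 2 <= 2p - N], and [beta + 1 <= 2p] bounds
    [kappa_l^2] by a multiple of [d_l], which yields the decay at a fixed point. The limit [g] of a
    norm convergent subsequence is only known to be differentiable, whereas the mean value argument
    asks for second-order expansions that are uniform over discs. So [g] is removed by the triangle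
    inequality, and point evaluation is applied to the difference of two images, which is given by
    explicit rational expressions. The norms are built from iterated integrals. Invariance under
    rotations and a one-sided form of polar coordinates are derived from translations, dilations and
    Tonelli. *)

Section IteratedIntegral.
Variable R : realType.
Local Notation C := (R[i]).
Local Notation leb := (@lebesgue_measure R).
Local Open Scope ereal_scope.

(** No measurability is asked: the integral of a nonnegative function is a supremum over the simple
    functions below it. *)
Lemma le_integral_ge0 d (T : measurableType d)
    (mu : {measure set T -> \bar R}) (f g : T -> \bar R) :
  (forall x, 0 <= f x) -> (forall x, f x <= g x) ->
  \int[mu]_x f x <= \int[mu]_x g x.
Proof.
move=> f0 fg; rewrite !ge0_integralTE//; last first.
  by move=> x; apply: le_trans (fg x).
apply: ereal_sup_le => _ /= [h hf <-].
by exists h => // x; apply: le_trans (fg x).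
Qed.

Lemma measurable_fun_EFin d (T : measurableType d) (f : T -> R) :
  measurable_fun setT f -> measurable_fun setT (fun x => (f x)%:E).
Proof. by move=> mf; apply/measurable_EFinP. Qed.

(** [a] times the push-forward of Lebesgue measure under [x -> a x + c] gives every interval its
    length, so uniqueness identifies it with Lebesgue measure. *)
Lemma integral_affine (a c : R) (f : R -> \bar R) : (0 < a)%R ->
  measurable_fun setT f -> (forall x, 0 <= f x) ->
  \int[leb]_x f (a * x + c)%R = a^-1%:E * \int[leb]_x f x.
Proof.
move=> a0 mf f0.
pose phi := (fun x : measurableTypeR R => (a * x + c)%R : measurableTypeR R).
have mphi : measurable_fun setT phi.
  by apply: measurable_funD => //; apply: measurable_funM.
have an0 : (0 <= a)%R by exact: ltW.
pose nu0 : {measure set (measurableTypeR R) -> \bar R} :=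
  mscale (NngNum an0) (pushforward leb phi).
pose nu := nu0 mphi.
have nuE A : measurable A -> leb A = nu A.
  apply: lebesgue_measure_unique => _ [[u v]] _ <-.
  rewrite /nu /nu0 /= /mscale /= /pushforward.
  have -> : phi @^-1` `]u, v]%classic = `](a^-1 * (u - c))%R, (a^-1 * (v - c))%R]%classic.
    apply/seteqP; split => x /=; rewrite !in_itv/= /phi => /andP[h1 h2].
      apply/andP; split; first by rewrite ltr_pdivrMl// ltrBlDr.
      by rewrite ler_pdivlMl// lerBrDr.
    apply/andP; split; first by rewrite -ltrBlDr -ltr_pdivrMl.
    by rewrite -lerBrDr -ler_pdivlMl.
  rewrite !lebesgue_measure_itv /= !lte_fin ltr_pM2l ?invr_gt0// ltrD2r.
  case: ifPn => uv; last by rewrite mule0.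
  rewrite -!EFinB -EFinM; congr (_%:E).
  by field; exact: lt0r_neq0.
have H : \int[leb]_x f x = \int[nu]_x f x.
  by apply: eq_measure_integral => A mA _; exact: nuE.
rewrite H ge0_integral_mscale//= ge0_integral_pushforward//=.
rewrite muleA -EFinM mulVf ?mul1e//; exact: lt0r_neq0.
Qed.

Lemma integralZl_leb (c : \bar R) (f : R -> \bar R) : 0 <= c ->
  measurable_fun setT f -> (forall x, 0 <= f x) ->
  \int[leb]_x (c * f x) = c * \int[leb]_x f x.
Proof. by move=> c0 mf f0; rewrite ge0_integralZl. Qed.

(* No sigma-algebra is put on [seq C] or on [C^N]: measurability of a function on them is
   tested against all measurably parametrised families of points. *)
Definition mseq d (T : measurableType d) (Z : T -> seq C) : Prop :=
  forall i, measurable_fun setT (fun t => complex.Re (nth 0%R (Z t) i)) /\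
            measurable_fun setT (fun t => complex.Im (nth 0%R (Z t) i)).

Lemma mseq_comp d (T : measurableType d) d' (T' : measurableType d')
    (Z : T -> seq C) (p : T' -> T) : measurable_fun setT p -> mseq Z ->
  mseq (Z \o p).
Proof.
by move=> mp mZ i; split; [exact: (measurableT_comp (mZ i).1 mp)|
  exact: (measurableT_comp (mZ i).2 mp)].
Qed.

Lemma mseq_cons d (T : measurableType d) (X Y : T -> R) (Z : T -> seq C) :
  measurable_fun setT X -> measurable_fun setT Y -> mseq Z ->
  mseq (fun t => (X t +i* Y t)%C :: Z t).
Proof. by move=> mX mY mZ [|i]; [split|exact: mZ]. Qed.

Lemma mseq_nil d (T : measurableType d) : mseq (fun _ : T => [::]).
Proof. by move=> i; rewrite nth_nil; split; exact: measurable_cst. Qed.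

(** The parameter in [T0] will hold the coordinates split off by an induction on the number of
    variables; [smeas] is the version without parameter. *)
Definition jmeas d0 (T0 : measurableType d0) (F : T0 -> seq C -> \bar R) : Prop :=
  (forall t s, 0 <= F t s) /\
  forall d (T : measurableType d) (p : T -> T0) (Z : T -> seq C),
    measurable_fun setT p -> mseq Z -> measurable_fun setT (fun t => F (p t) (Z t)).

Definition smeas (F : seq C -> \bar R) : Prop :=
  (forall s, 0 <= F s) /\
  forall d (T : measurableType d) (Z : T -> seq C),
    mseq Z -> measurable_fun setT (fun t => F (Z t)).

Lemma jmeas_cons d0 (T0 : measurableType d0) (F : T0 -> seq C -> \bar R) :
  jmeas F -> jmeas (fun (w : T0 * R * R) s => F w.1.1 ((w.1.2 +i* w.2)%C :: s)).
Proof.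
move=> [F0 mF]; split => // d T p Z mp mZ.
have m1 : measurable_fun setT (fun t => (p t).1.1).
  by apply: (measurableT_comp (f := fst)) => //; exact: (measurableT_comp (f := fst)).
apply: (mF _ _ (fun t => (p t).1.1)) => //.
apply: mseq_cons => //; last exact: (measurableT_comp (f := snd)).
by apply: (measurableT_comp (f := snd)) => //; exact: (measurableT_comp (f := fst)).
Qed.

Lemma cint_ge0 k (F : seq C -> \bar R) : (forall s, 0 <= F s) -> 0 <= cint k F.
Proof.
elim: k F => [|k IH] F F0 //=.
by apply: integral_ge0 => x _; apply: integral_ge0 => y _; exact: IH.
Qed.

Lemma measurable_cint k d0 (T0 : measurableType d0) (F : T0 -> seq C -> \bar R) :
  jmeas F -> measurable_fun setT (fun t => cint k (F t)).
Proof.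
elim: k d0 T0 F => [|k IH] d0 T0 F mF.
  by apply: (mF.2 _ _ id) => //; exact: mseq_nil.
(* Both real coordinates of the first point join the parameter, and Tonelli integrates them out
   again one at a time. *)
have m2 := IH _ _ _ (jmeas_cons mF).
have m2' := measurable_fun_fubini_tonelli_F (m2 := leb) _ m2.
have m1 := measurable_fun_fubini_tonelli_F (m2 := leb) _ (m2' _).
apply: m1 => [w|w]; first by apply: cint_ge0 => s; exact: mF.1.
by apply: integral_ge0 => y _; apply: cint_ge0 => s; exact: mF.1.
Qed.

(** Here the integrand also depends on a second point, which stays free; the interchange of two
    iterated integrals needs this. *)
Lemma cint_jmeas k d0 (T0 : measurableType d0) (F : T0 -> seq C -> seq C -> \bar R) :
  (forall t s s', 0 <= F t s s') ->
  (forall d (T : measurableType d) (p : T -> T0) (Z Z' : T -> seq C),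
    measurable_fun setT p -> mseq Z -> mseq Z' ->
    measurable_fun setT (fun t => F (p t) (Z t) (Z' t))) ->
  jmeas (fun t s => cint k (F t s)).
Proof.
move=> F0 mF; split => [t s|d T p Z mp mZ]; first exact: cint_ge0.
apply: (@measurable_cint k _ _ (fun t s' => F (p t) (Z t) s')); split => // d1 T1 q Z' mq mZ'.
apply: (mF _ _ (p \o q) (Z \o q)) => //; first exact: measurableT_comp.
exact: mseq_comp.
Qed.

Lemma le_cint k (F G : seq C -> \bar R) : (forall s, 0 <= F s) ->
  (forall s, size s = k -> F s <= G s) -> cint k F <= cint k G.
Proof.
elim: k F G => [|k IH] F G F0 FG /=; first exact: FG.
apply: le_integral_ge0 => x.
  by apply: integral_ge0 => y _; exact: cint_ge0.
apply: le_integral_ge0 => y; first exact: cint_ge0.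
by apply: IH => // s sk; apply: FG; rewrite /= sk.
Qed.

Lemma eq_cint k (F G : seq C -> \bar R) :
  (forall s, size s = k -> F s = G s) -> cint k F = cint k G.
Proof.
elim: k F G => [|k IH] F G FG /=; first exact: FG.
apply: eq_integral => x _; apply: eq_integral => y _.
by apply: IH => // s sk; apply: FG; rewrite /= sk.
Qed.

Lemma cint_xy_measurable k (F : seq C -> \bar R) : smeas F ->
  measurable_fun setT (fun w : R * R => cint k (fun s => F ((w.1 +i* w.2)%C :: s))).
Proof.
move=> mF; apply: measurable_cint; split => [t s|d T p Z mp mZ]; first exact: mF.1.
apply: mF.2; apply: mseq_cons => //; first exact: (measurableT_comp (f := fst)).
exact: (measurableT_comp (f := snd)).
Qed.

Lemma smeas_cons (F : seq C -> \bar R) (x y : R) : smeas F ->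
  smeas (fun s => F ((x +i* y)%C :: s)).
Proof.
move=> mF; split => [s|d T Z mZ]; first exact: mF.1.
by apply: mF.2; apply: mseq_cons.
Qed.

Lemma cintD k (F G : seq C -> \bar R) : smeas F -> smeas G ->
  cint k (fun s => F s + G s) = cint k F + cint k G.
Proof.
elim: k F G => [//|k IH] F G mF mG /=.
have F0 := mF.1; have G0 := mG.1.
have mF2 := cint_xy_measurable k mF; have mG2 := cint_xy_measurable k mG.
rewrite -ge0_integralD//=.
- apply: eq_integral => x _; rewrite -ge0_integralD//=.
  + by apply: eq_integral => y _; apply: IH; exact: smeas_cons.
  + by move=> y _; exact: cint_ge0.
  + exact: (measurableT_comp mF2 (measurable_pair1 x)).
  + by move=> y _; exact: cint_ge0.
  + exact: (measurableT_comp mG2 (measurable_pair1 x)).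
- by move=> x _; apply: integral_ge0 => y _; exact: cint_ge0.
- by apply: (measurable_fun_fubini_tonelli_F (m2 := leb) _ mF2) => w; exact: cint_ge0.
- by move=> x _; apply: integral_ge0 => y _; exact: cint_ge0.
- by apply: (measurable_fun_fubini_tonelli_F (m2 := leb) _ mG2) => w; exact: cint_ge0.
Qed.

Lemma cintZ k (c : \bar R) (F : seq C -> \bar R) : 0 <= c -> smeas F ->
  cint k (fun s => c * F s) = c * cint k F.
Proof.
move=> c0; elim: k F => [//|k IH] F mF /=.
have F0 := mF.1; have mF2 := cint_xy_measurable k mF.
rewrite -ge0_integralZl//=.
- apply: eq_integral => x _; rewrite -ge0_integralZl//=.
  + by apply: eq_integral => y _; apply: IH; exact: smeas_cons.
  + exact: (measurableT_comp mF2 (measurable_pair1 x)).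
  + by move=> y _; exact: cint_ge0.
- by apply: (measurable_fun_fubini_tonelli_F (m2 := leb) _ mF2) => w; exact: cint_ge0.
- by move=> x _; apply: integral_ge0 => y _; exact: cint_ge0.
Qed.

(** Tonelli twice per complex coordinate: [t] is carried past the real part, then past the imaginary
    part. *)
Lemma integral_cint k (F : R -> seq C -> \bar R) : jmeas F ->
  \int[leb]_t cint k (F t) = cint k (fun s => \int[leb]_t F t s).
Proof.
elim: k F => [//|k IH] F mF /=.
have m3 := measurable_cint k (jmeas_cons mF).
have F0 := mF.1.
have m2 := measurable_fun_fubini_tonelli_F (m2 := leb) _ m3.
rewrite (fubini_tonelli (m1 := leb) (m2 := leb) (fun w : R * R => \int[leb]_y cint k (fun s => F w.1 ((w.2 +i* y)%C :: s))))//=; first last.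
- by move=> w; apply: integral_ge0 => y _; exact: cint_ge0.
- by apply: m2 => w; exact: cint_ge0.
apply: eq_integral => x _.
rewrite (fubini_tonelli (m1 := leb) (m2 := leb) (fun w : R * R => cint k (fun s => F w.1 ((x +i* w.2)%C :: s))))//=; first last.
- by move=> w; exact: cint_ge0.
- have mq : measurable_fun setT (fun w : R * R => (w.1, x : R, w.2)).
    by apply: measurable_fun_pair => //; apply: measurable_fun_pair.
  exact: (measurableT_comp m3 mq).
apply: eq_integral => y _; apply: IH; split => [t s|d T p Z mp mZ]; first exact: F0.
by apply: mF.2 => //; apply: mseq_cons.
Qed.

(** Induction on [k]: the real and imaginary parts of the first outer point are carried through the
    [l]-fold integral by [integral_cint]. *)
Lemma cint_swap k l (F : seq C -> seq C -> \bar R) :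
  (forall s s', 0 <= F s s') ->
  (forall d (T : measurableType d) (Z Z' : T -> seq C), mseq Z -> mseq Z' ->
    measurable_fun setT (fun t => F (Z t) (Z' t))) ->
  cint k (fun s => cint l (F s)) = cint l (fun s' => cint k (F^~ s')).
Proof.
elim: k F => [//|k IH] F F0 mF /=.
rewrite -(@integral_cint l (fun x s' => \int[leb]_y cint k (fun s => F ((x +i* y)%C :: s) s'))).
  apply: eq_integral => x _.
  rewrite -(@integral_cint l (fun y s' => cint k (fun s => F ((x +i* y)%C :: s) s'))).
    apply: eq_integral => y _; apply: IH => // d T Z Z' mZ mZ'.
    by apply: mF => //; apply: mseq_cons.
  apply: (@cint_jmeas k _ _ (fun y s' s => F ((x +i* y)%C :: s) s')) => // d T p Z Z' mp mZ mZ'.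
  by apply: mF => //; apply: mseq_cons.
split=> [x s'|d T p Z mp mZ]; first by apply: integral_ge0 => y _; exact: cint_ge0.
apply: (measurable_fun_fubini_tonelli_F (m2 := leb) (fun w : T * R => cint k (fun s => F ((p w.1 +i* w.2)%C :: s) (Z w.1)))) => [|w]; last exact: cint_ge0.
apply: (@measurable_cint k _ _ (fun (w : T * R) s => F ((p w.1 +i* w.2)%C :: s) (Z w.1))).
split=> // d1 T1 q Z1 mq mZ1.
have mq1 : measurable_fun setT (fst \o q) by exact: measurableT_comp.
apply: mF; last exact: (mseq_comp mq1 mZ).
apply: mseq_cons => //; last exact: (measurableT_comp (f := snd)).
exact: (measurableT_comp mp mq1).
Qed.

Fixpoint affs (a : nat -> R) (c : nat -> C) (s : seq C) : seq C :=
  if s is z :: s' then ((a 0%N)%:C%C * z + c 0%N)%R :: affs (a \o S) (c \o S) s' else [::].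

Lemma nth_affs a c s i : (i < size s)%N ->
  nth 0%R (affs a c s) i = ((a i)%:C%C * nth 0%R s i + c i)%R.
Proof. by elim: s a c i => [//|z s IH] a c [|i] //= si; rewrite IH. Qed.

Lemma affine_complexE (a x y : R) (c : C) : (a%:C%C * (x +i* y)%C + c)%R =
  ((a * x + complex.Re c)%R +i* (a * y + complex.Im c)%R)%C.
Proof.
by case: c => u v; apply/eqP; rewrite eq_complex /= !mul0r subr0 addr0 !eqxx.
Qed.

(** A real factor [a i] dilates both the real and the imaginary axis, hence the exponent 2. *)
Lemma cint_affs k (a : nat -> R) (c : nat -> C) (F : seq C -> \bar R) :
  (forall i, (0 < a i)%R) -> smeas F ->
  cint k (fun s => F (affs a c s)) = (\prod_(i < k) (a i ^- 2))%R%:E * cint k F.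
Proof.
move=> + ; elim: k a c F => [|k IH] a c F a0 mF; first by rewrite /= big_ord0 mul1e.
have F0 := mF.1; have mF2 := cint_xy_measurable k mF.
rewrite /= big_ord_recl /=.
pose P := (\prod_(i < k) ((a \o S) i ^- 2))%R.
rewrite (_ : (\prod_(i < k) _)%R = P)//.
have P0 : (0 <= P)%R by apply: prodr_ge0 => i _; rewrite invr_ge0; apply: exprn_ge0; exact/ltW/a0.
set H := fun x y => cint k (fun s => F ((x +i* y)%C :: s)).
have H0 x y : 0 <= H x y by exact: cint_ge0.
have mHx x : measurable_fun setT (H x) by exact: (measurableT_comp mF2 (measurable_pair1 x)).
have mH : measurable_fun setT (fun x => \int[leb]_y H x y).
  by apply: (measurable_fun_fubini_tonelli_F (m2 := leb) _ mF2) => w; exact: cint_ge0.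
transitivity (\int[leb]_x \int[leb]_y (P%:E * H (a 0%N * x + complex.Re (c 0%N))%R (a 0%N * y + complex.Im (c 0%N))%R)).
  apply: eq_integral => x _; apply: eq_integral => y _.
  rewrite affine_complexE.
  exact: (IH _ _ _ (fun i => a0 i.+1) (smeas_cons _ _ mF)).
transitivity (\int[leb]_x (P%:E * ((a 0%N)^-1%:E * \int[leb]_y H (a 0%N * x + complex.Re (c 0%N))%R y))).
  apply: eq_integral => x _.
  have ma : measurable_fun setT (fun x => (a 0%N * x + complex.Im (c 0%N))%R).
    by apply: measurable_funD => //; exact: measurable_funM.
  rewrite (@integralZl_leb P%:E (fun y => H (a 0%N * x + complex.Re (c 0%N))%R (a 0%N * y + complex.Im (c 0%N))%R))//.
    by rewrite (@integral_affine (a 0%N) (complex.Im (c 0%N)) (H _)).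
  exact: (measurableT_comp (mHx _) ma).
have ma : measurable_fun setT (fun x => (a 0%N * x + complex.Re (c 0%N))%R).
  by apply: measurable_funD => //; exact: measurable_funM.
have I0 x : 0 <= \int[leb]_y H x y by apply: integral_ge0.
have ia0 : 0 <= ((a 0%N)^-1)%:E by rewrite lee_fin invr_ge0 ltW.
have mHa : measurable_fun setT (fun x => \int[leb]_y H (a 0%N * x + complex.Re (c 0%N))%R y).
  exact: (measurableT_comp mH ma).
rewrite (@integralZl_leb P%:E (fun x => (a 0%N)^-1%:E * \int[leb]_y H (a 0%N * x + complex.Re (c 0%N))%R y))//; last 2 first.
- exact: measurable_funeM.
- by move=> x; rewrite mule_ge0.
rewrite (@integralZl_leb _ (fun x => \int[leb]_y H (a 0%N * x + complex.Re (c 0%N))%R y))//.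
rewrite (@integral_affine (a 0%N) (complex.Re (c 0%N)) (fun x => \int[leb]_y H x y))//.
rewrite !muleA -!EFinM; congr (_%:E * _).
by field; exact: lt0r_neq0.
Qed.

(** Supplies the explicit multiple integrals: cubes inside and around the ball, and the product
    majorant of the kernel. *)
Lemma cint_prod k (a b : nat -> R -> R) (A B : nat -> R) :
  (forall i x, (0 <= a i x)%R) -> (forall i x, (0 <= b i x)%R) ->
  (forall i, measurable_fun setT (a i)) -> (forall i, measurable_fun setT (b i)) ->
  (forall i, \int[leb]_x (a i x)%:E = (A i)%:E) ->
  (forall i, \int[leb]_x (b i x)%:E = (B i)%:E) ->
  cint k (fun s => (\prod_(i < k) (a i (complex.Re (nth 0%R s i)) * b i (complex.Im (nth 0%R s i))))%R%:E)
  = (\prod_(i < k) (A i * B i))%R%:E.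
Proof.
elim: k a b A B => [|k IH] a b A B a0 b0 ma mb IA IB.
  by rewrite /= !big_ord0.
rewrite [in RHS]big_ord_recl /=.
pose P := (\prod_(i < k) ((A \o S) i * (B \o S) i))%R.
rewrite [in RHS](_ : (\prod_(i < k) _)%R = P)//.
have A0 i : (0 <= A i)%R by rewrite -lee_fin -IA; apply: integral_ge0 => x _; rewrite lee_fin.
have B0 i : (0 <= B i)%R by rewrite -lee_fin -IB; apply: integral_ge0 => x _; rewrite lee_fin.
have P0 : (0 <= P)%R by apply: prodr_ge0 => i _; apply: mulr_ge0; [exact: A0|exact: B0].
transitivity (\int[leb]_x ((a 0%N x * (B 0%N * P))%R%:E)).
  apply: eq_integral => x _.
  transitivity (\int[leb]_y ((a 0%N x * P)%R%:E * (b 0%N y)%:E)).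
    apply: eq_integral => y _.
    rewrite -EFinM -mulrA (mulrC P) mulrA EFinM.
    rewrite /P -(IH (a \o S) (b \o S) (A \o S) (B \o S) (fun i => a0 i.+1) (fun i => b0 i.+1)
      (fun i => ma i.+1) (fun i => mb i.+1) (fun i => IA i.+1) (fun i => IB i.+1)).
    rewrite -cintZ; last first.
    - split=> [s|d T Z mZ]; first by rewrite lee_fin; apply: prodr_ge0 => i _; apply: mulr_ge0; [exact: a0|exact: b0].
      apply/measurable_EFinP; apply: measurable_prod => i _.
      apply: measurable_funM.
        exact: (measurableT_comp (ma i.+1) (mZ i).1).
      exact: (measurableT_comp (mb i.+1) (mZ i).2).
    - by rewrite lee_fin mulr_ge0.
    apply: eq_cint => s _; rewrite -EFinM big_ord_recl /=; congr (_%:E).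
  rewrite (@integralZl_leb _ (fun y => (b 0%N y)%:E)).
  - by rewrite IB -EFinM; congr (_%:E); ring.
  - by rewrite lee_fin mulr_ge0.
  - exact: (measurable_fun_EFin (mb 0%N)).
  - by move=> y; rewrite lee_fin.
under eq_integral do rewrite mulrC EFinM.
rewrite (@integralZl_leb _ (fun y => (a 0%N y)%:E)).
- by rewrite IA -EFinM; congr (_%:E); ring.
- by rewrite lee_fin mulr_ge0.
- exact: (measurable_fun_EFin (ma 0%N)).
- by move=> y; rewrite lee_fin.
Qed.

End IteratedIntegral.

(** * Integration over the ball: affine changes of variables and isometries *)

Section BallIntegral.
Variable R : realType.
Variable n : nat.
Local Notation C := (R[i]).
Local Notation N := n.+1.
Local Notation V := 'rV[C]_N.
Local Notation leb := (@lebesgue_measure R).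
Local Open Scope ereal_scope.

Definition vmeas d (T : measurableType d) (Z : T -> V) : Prop :=
  forall j, measurable_fun setT (fun t => complex.Re (Z t ord0 j)) /\
            measurable_fun setT (fun t => complex.Im (Z t ord0 j)).

Definition jvmeas d0 (T0 : measurableType d0) (F : T0 -> V -> \bar R) : Prop :=
  (forall t z, 0 <= F t z) /\
  forall d (T : measurableType d) (p : T -> T0) (Z : T -> V),
    measurable_fun setT p -> vmeas Z -> measurable_fun setT (fun t => F (p t) (Z t)).

Definition vfmeas (f : V -> \bar R) : Prop :=
  (forall z, 0 <= f z) /\
  forall d (T : measurableType d) (Z : T -> V),
    vmeas Z -> measurable_fun setT (fun t => f (Z t)).

Lemma vmeas_comp d (T : measurableType d) d' (T' : measurableType d')
    (Z : T -> V) (p : T' -> T) : measurable_fun setT p -> vmeas Z ->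
  vmeas (fun t => Z (p t)).
Proof.
by move=> mp mZ i; split; [exact: (measurableT_comp (mZ i).1 mp)|
  exact: (measurableT_comp (mZ i).2 mp)].
Qed.

Lemma vmeas_cst d (T : measurableType d) (c : V) : vmeas (fun _ : T => c).
Proof. by move=> i; split; exact: measurable_cst. Qed.

Lemma vmeasD d (T : measurableType d) (Z W : T -> V) : vmeas Z -> vmeas W ->
  vmeas (fun t => (Z t + W t)%R).
Proof.
move=> mZ mW i; split.
- rewrite (_ : (fun _ => _) = (fun t => complex.Re (Z t ord0 i) + complex.Re (W t ord0 i))%R).
    by apply: measurable_funD; [exact: (mZ i).1|exact: (mW i).1].
  by apply/funext => t; rewrite mxE; case: (Z t ord0 i) => ? ?; case: (W t ord0 i).
- rewrite (_ : (fun _ => _) = (fun t => complex.Im (Z t ord0 i) + complex.Im (W t ord0 i))%R).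
    by apply: measurable_funD; [exact: (mZ i).2|exact: (mW i).2].
  by apply/funext => t; rewrite mxE; case: (Z t ord0 i) => ? ?; case: (W t ord0 i).
Qed.

Lemma vmeasN d (T : measurableType d) (Z : T -> V) : vmeas Z -> vmeas (fun t => (- Z t)%R).
Proof.
move=> mZ i; split.
- rewrite (_ : (fun _ => _) = (fun t => - complex.Re (Z t ord0 i))%R).
    by apply: measurableT_comp => //; exact: (mZ i).1.
  by apply/funext => t; rewrite mxE; case: (Z t ord0 i).
- rewrite (_ : (fun _ => _) = (fun t => - complex.Im (Z t ord0 i))%R).
    by apply: measurableT_comp => //; exact: (mZ i).2.
  by apply/funext => t; rewrite mxE; case: (Z t ord0 i).
Qed.

Lemma vmeas_row d (T : measurableType d) (Z : T -> seq C) : mseq Z ->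
  vmeas (fun t => \row_(j < N) nth 0%R (Z t) j)%R.
Proof.
by move=> mZ j; split; [have := (mZ j).1|have := (mZ j).2];
  apply: eq_measurable_fun => t _; rewrite mxE.
Qed.

Lemma vfmeas_smeas (f : V -> \bar R) : vfmeas f ->
  smeas (fun s => f (\row_(j < N) nth 0%R s j)%R).
Proof.
move=> [f0 mf]; split=> // d T Z mZ.
by apply: (mf _ _ (fun t => \row_(j < N) nth 0%R (Z t) j)%R); exact: vmeas_row.
Qed.

Lemma jvmeas_jmeas d0 (T0 : measurableType d0) (F : T0 -> V -> \bar R) : jvmeas F ->
  jmeas (fun t s => F t (\row_(j < N) nth 0%R s j)%R).
Proof.
move=> [f0 mf]; split=> // d T p Z mp mZ.
by apply: (mf _ _ p (fun t => \row_(j < N) nth 0%R (Z t) j)%R) => //; exact: vmeas_row.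
Qed.

Lemma vfmeas_comp (f : V -> \bar R) (M : V -> V) : vfmeas f ->
  (forall d (T : measurableType d) (Z : T -> V), vmeas Z -> vmeas (fun t => M (Z t))) ->
  vfmeas (fun z => f (M z)).
Proof. by move=> [f0 mf] mM; split => // d T Z mZ; apply: (mf _ _ (fun t => M (Z t))); exact: mM. Qed.

Lemma vfmeasD (f g : V -> \bar R) : vfmeas f -> vfmeas g -> vfmeas (fun z => f z + g z).
Proof.
move=> [f0 mf] [g0 mg]; split => [z|d T Z mZ]; first by rewrite adde_ge0.
by apply: emeasurable_funD; [exact: mf|exact: mg].
Qed.

Lemma vfmeasM (f g : V -> \bar R) : vfmeas f -> vfmeas g -> vfmeas (fun z => f z * g z).
Proof.
move=> [f0 mf] [g0 mg]; split => [z|d T Z mZ]; first by rewrite mule_ge0.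
by apply: emeasurable_funM; [exact: mf|exact: mg].
Qed.

Lemma vfmeas_cst (c : \bar R) : 0 <= c -> vfmeas (fun=> c).
Proof. by move=> c0; split. Qed.

Lemma measurable_cabs2 d (T : measurableType d) (z : T -> C) :
  measurable_fun setT (fun t => complex.Re (z t)) ->
  measurable_fun setT (fun t => complex.Im (z t)) ->
  measurable_fun setT (fun t => cabs2 (z t)).
Proof. by move=> m1 m2; apply: measurable_funD; exact: measurable_funX. Qed.

Lemma measurable_vnorm2 d (T : measurableType d) (Z : T -> V) : vmeas Z ->
  measurable_fun setT (fun t => vnorm2 (Z t)).
Proof.
move=> mZ; apply: measurable_sum => j.
by apply: measurable_cabs2; [exact: (mZ j).1|exact: (mZ j).2].
Qed.

Lemma vfmeas_ball (f : V -> \bar R) : vfmeas f ->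
  vfmeas (fun z => if (vnorm2 z < 1)%R then f z else 0).
Proof.
move=> [f0 mf]; split => [z|d T Z mZ]; first by case: ifP.
apply: measurable_fun_ifT => //; last exact: mf.
by apply: measurable_fun_ltr => //; exact: measurable_vnorm2.
Qed.

Lemma lebint_ge0 (f : V -> \bar R) : (forall z, 0 <= f z) -> 0 <= lebint f.
Proof. by move=> f0; apply: cint_ge0. Qed.

Lemma le_lebint (f g : V -> \bar R) : (forall z, 0 <= f z) -> (forall z, f z <= g z) ->
  lebint f <= lebint g.
Proof. by move=> f0 fg; apply: le_cint. Qed.

Lemma eq_lebint (f g : V -> \bar R) : (forall z, f z = g z) -> lebint f = lebint g.
Proof. by move=> fg; apply: eq_cint. Qed.

Lemma lebintD (f g : V -> \bar R) : vfmeas f -> vfmeas g ->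
  lebint (fun z => f z + g z) = lebint f + lebint g.
Proof. by move=> mf mg; apply: cintD; exact: vfmeas_smeas. Qed.

Lemma lebintZ (c : \bar R) (f : V -> \bar R) : 0 <= c -> vfmeas f ->
  lebint (fun z => c * f z) = c * lebint f.
Proof. by move=> c0 mf; rewrite /lebint -cintZ//; exact: vfmeas_smeas. Qed.

Lemma integral_lebint (F : R -> V -> \bar R) : jvmeas F ->
  \int[leb]_t lebint (F t) = lebint (fun z => \int[leb]_t F t z).
Proof. by move=> mF; apply: integral_cint; exact: jvmeas_jmeas. Qed.

Lemma lebint_swap (F : V -> V -> \bar R) :
  (forall z w, 0 <= F z w) ->
  (forall d (T : measurableType d) (Z W : T -> V), vmeas Z -> vmeas W ->
    measurable_fun setT (fun t => F (Z t) (W t))) ->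
  lebint (fun z => lebint (F z)) = lebint (fun w => lebint (F^~ w)).
Proof.
move=> F0 mF; apply: (@cint_swap _ N N (fun s s' => F (\row_(j < N) nth 0%R s j)%R (\row_(j < N) nth 0%R s' j)%R)) => // d T Z W mZ mW.
by apply: mF; exact: vmeas_row.
Qed.

Lemma lebint_affine (a : 'I_N -> R) (c : V) (f : V -> \bar R) : (forall i, (0 < a i)%R) -> vfmeas f ->
  lebint (fun z => f (\row_j ((a j)%:C%C * z ord0 j + c ord0 j))%R) =
  (\prod_(i < N) (a i ^- 2))%R%:E * lebint f.
Proof.
move=> a0 mf; rewrite /lebint.
(* [affs] takes coefficients indexed by all naturals; values past [n] are never read. *)
pose a' i := a (inord i).
have -> : (\prod_(i < N) (a i ^- 2) = \prod_(i < N) (a' i ^- 2))%R.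
  by apply: eq_bigr => i _; rewrite /a' inord_val.
rewrite -(@cint_affs _ N a' (fun i => c ord0 (inord i))); [|by move=> i; exact: a0|exact: vfmeas_smeas].
apply: eq_cint => s sN; congr (f _); apply/rowP => j; rewrite !mxE.
by rewrite nth_affs ?sN// /a' inord_val.
Qed.

Lemma lebint_translate (c : V) (f : V -> \bar R) : vfmeas f ->
  lebint (fun z => f (z + c)%R) = lebint f.
Proof.
move=> mf; have := @lebint_affine (fun=> 1%R) c f (fun=> ltr01) mf.
rewrite big1 ?mul1e; last by move=> i _; rewrite expr1n invr1.
move=> <-; apply: eq_lebint => z; congr (f _); apply/rowP => j.
by rewrite !mxE mul1r.
Qed.

Definition bball_ind (z : V) : \bar R := if (vnorm2 z < 1)%R then 1 else 0.

Lemma vfmeas_bball : vfmeas bball_ind.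
Proof. exact: (@vfmeas_ball (cst 1) (vfmeas_cst lee01)). Qed.

Lemma vnorm2N (z : V) : vnorm2 (- z)%R = vnorm2 z.
Proof.
by apply: eq_bigr => j _; rewrite mxE /cabs2; case: (z ord0 j) => u v /=; rewrite !sqrrN.
Qed.

Lemma integral_indic_sym (e : R) : (0 <= e)%R ->
  \int[leb]_x (\1_(`[(- e)%R, e]%classic : set R) x)%:E = (2 * e)%R%:E.
Proof.
move=> e0; transitivity (leb `[(- e)%R, e]%classic); first by rewrite integral_indic// setIT.
rewrite lebesgue_measure_itv /= lte_fin.
case: ltP => h; first by rewrite -EFinB; congr (_%:E); ring.
have -> : e = 0%R by apply/eqP; rewrite eq_le e0 andbT; lra.
by rewrite mulr0.
Qed.

Lemma bball_vol_gt0 : 0 < lebint bball_ind.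
Proof.
(* The cube of half-side [1 / (2N)] lies in the ball: its [2N] squares sum to at most
   [1 / (2N) < 1]. *)
pose e : R := ((N.*2)%:R^-1)%R.
have e0 : (0 < e)%R by rewrite invr_gt0 ltr0n double_gt0.
pose a (i : nat) := \1_(`[(- e)%R, e]%classic : set R) : R -> R.
have a0 i x : (0 <= a i x)%R by rewrite /a indicE.
have ma i : measurable_fun setT (a i) by exact: measurable_indic.
have Ia i : \int[leb]_x (a i x)%:E = (2 * e)%R%:E by apply: integral_indic_sym; exact: ltW.
have := @cint_prod R N a a (fun=> 2 * e)%R (fun=> 2 * e)%R a0 a0 ma ma Ia Ia.
rewrite prodr_const card_ord => H.
apply: (@lt_le_trans _ _ (((2 * e * (2 * e)) ^+ N)%R)%:E).
  by rewrite lte_fin exprn_gt0// !mulr_gt0.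
rewrite -H; apply: le_cint => s.
  by rewrite lee_fin; apply: prodr_ge0 => i _; apply: mulr_ge0.
rewrite /bball_ind; case: ifPn.
  move=> _ _; rewrite lee_fin; apply: prodr_ile1 => i _; apply/andP; split; first exact: mulr_ge0.
  by rewrite /a !indicE mulr_ile1//= ?ler0n// lern1 leq_b1.
rewrite -leNgt => h sN; rewrite lee_fin.
have [//|/negP hn] := boolP ((\prod_(i < N) (a i (complex.Re s`_i) * a i (complex.Im s`_i)))%R <= 0)%R.
exfalso.
have hi (i : 'I_N) : (- e <= complex.Re s`_i <= e /\ - e <= complex.Im s`_i <= e)%R.
  apply: contrapT => hh; apply: hn.
  rewrite (bigD1 i)//= /a !indicE.
  have [/set_mem h1|h1] := boolP (complex.Re s`_i \in _); last by rewrite !mul0r.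
  have [/set_mem h2|h2] := boolP (complex.Im s`_i \in _); last by rewrite mulr0 mul0r.
  by exfalso; apply: hh; move: h1 h2; rewrite /= !in_itv/=.
have : (vnorm2 (\row_(j < N) s`_j)%R < 1)%R.
  apply: (@le_lt_trans _ _ (\sum_(j < N) (e ^+ 2 + e ^+ 2))%R).
    apply: ler_sum => j _; rewrite mxE /cabs2; have [/andP[h1 h2] /andP[h3 h4]] := hi j.
    by apply: lerD; rewrite -[leLHS]real_normK ?num_real// ler_sqr ?nnegrE ?(ltW e0)// ler_norml; apply/andP.
  rewrite sumr_const card_ord -mulr2n -mulrnA mul2n /e.
  rewrite -[X in (X < 1)%R]mulr_natr expr2 -mulrA mulVf ?mulr1; last by rewrite pnatr_eq0 -lt0n double_gt0.
  by rewrite invf_lt1 ?ltr0n ?double_gt0// ltr1n doubleS.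
by rewrite ltNge h.
Qed.

Lemma bball_vol_lty : lebint bball_ind < +oo.
Proof.
(* Comparison with the cube [[-1, 1]^(2N)], which contains the ball. *)
pose a (i : nat) := \1_(`[(- 1)%R, 1%R]%classic : set R) : R -> R.
have a0 i x : (0 <= a i x)%R by rewrite /a indicE.
have ma i : measurable_fun setT (a i) by exact: measurable_indic.
have Ia i : \int[leb]_x (a i x)%:E = (2 * 1)%R%:E by apply: integral_indic_sym.
have := @cint_prod R N a a (fun=> 2 * 1)%R (fun=> 2 * 1)%R a0 a0 ma ma Ia Ia.
move=> H; apply: (@le_lt_trans _ _ (\prod_(i < N) (2 * 1 * (2 * 1)))%R%:E); last by rewrite ltry.
rewrite -H; apply: le_cint => s; first by exact: vfmeas_bball.1.
move=> sN; rewrite /bball_ind; case: ifPn => [h|_]; last first.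
  by rewrite lee_fin; apply: prodr_ge0 => i _; apply: mulr_ge0.
rewrite lee_fin big1// => i _.
have h1 : (cabs2 s`_i < 1)%R.
  apply: le_lt_trans h; rewrite /vnorm2 (bigD1 i)//= mxE lerDl.
  by apply: sumr_ge0 => j _; rewrite addr_ge0// sqr_ge0.
have h2 (x y : R) : (x ^+ 2 + y ^+ 2 < 1)%R -> a i x = 1%R.
  move=> xy; rewrite /a indicE mem_set//= in_itv/=; rewrite -ler_norml.
  rewrite -(@ler_sqr _ `|x|%R)// ?nnegrE// real_normK ?num_real// expr1n.
  by apply: ltW; apply: le_lt_trans xy; rewrite lerDl sqr_ge0.
rewrite /cabs2 in h1; rewrite (h2 _ _ h1) (h2 _ (complex.Re s`_i)) ?mulr1//.
by rewrite addrC.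
Qed.

Global Opaque lebint cint.

(* Averaging [g (M y + x)] over [x] in the unit ball and all [y], in both orders, only uses
   translation invariance and the invariance of the ball. *)
Lemma lebint_isometry (M M' : V -> V) (g : V -> \bar R) :
  (forall z w, M (z + w) = M z + M w)%R -> cancel M' M ->
  (forall z, vnorm2 (M z) = vnorm2 z) ->
  (forall d (T : measurableType d) (Z : T -> V), vmeas Z -> vmeas (fun t => M (Z t))) ->
  vfmeas g -> lebint (fun z => g (M z)) = lebint g.
Proof.
move=> MD MK Mn mM mg.
have mb := vfmeas_bball.
have b0 := mb.1; have g0 := mg.1.
have MN z : (M (- z) = - M z)%R.
  have M0 : M 0%R = 0%R by have := MD 0%R 0%R; rewrite addr0 => /esym/(congr1 (fun x => x - M 0)%R); rewrite addrK subrr.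
  by apply/eqP; rewrite -addr_eq0 -MD addNr M0.
have v0 := bball_vol_gt0; have vy := bball_vol_lty.
have vfin : lebint bball_ind \is a fin_num by rewrite ge0_fin_numE// ltW.
(* The ball has positive finite volume, which can therefore be cancelled. *)
suff H : lebint bball_ind * lebint (fun z => g (M z)) = lebint bball_ind * lebint g.
  case E : (lebint bball_ind) H v0 vfin => [r| |]//= H; rewrite lte_fin => r0 _.
  have := congr1 (fun x => (r^-1)%:E * x) H.
  by rewrite !muleA -EFinM mulVf ?mul1e// gt_eqF.
transitivity (lebint (fun x => lebint (fun y => bball_ind x * g (M y + x)%R))).
  rewrite muleC -lebintZ//; last by apply: lebint_ge0.
  apply: eq_lebint => x.
  have -> : lebint (fun y => bball_ind x * g (M y + x)%R) = bball_ind x * lebint (fun y => g (M y + x)%R).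
    apply: lebintZ; first exact: b0.
    apply: (vfmeas_comp (M := fun y => (M y + x)%R) mg) => d T Z mZ.
    by apply: vmeasD; [exact: mM|exact: vmeas_cst].
  rewrite muleC; congr (_ * _).
  (* [M y + x = M (y + M' x)], so the inner integral is a translate of that of [g] composed with
     [M]. *)
  have <- := @lebint_translate (M' x) (fun y => g (M y)) (vfmeas_comp mg mM).
  by apply: eq_lebint => y; rewrite MD MK.
rewrite (@lebint_swap (fun x y => bball_ind x * g (M y + x)%R)); last 2 first.
- by move=> z w; rewrite mule_ge0.
- move=> d T Z W mZ mW; apply: emeasurable_funM; first exact: mb.2.
  apply: (mg.2 _ _ (fun t => (M (W t) + Z t)%R)).
  by apply: vmeasD => //; exact: mM.
transitivity (lebint (fun y => lebint (fun x => bball_ind (x - M y)%R * g x))).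
  apply: eq_lebint => y.
  have mk : vfmeas (fun x => bball_ind (x - M y)%R * g x).
    apply: vfmeasM => //; apply: (vfmeas_comp (M := fun x => (x - M y)%R) mb) => d T Z mZ.
    by apply: vmeasD => //; exact: vmeas_cst.
  have <- := @lebint_translate (M y) _ mk.
  by apply: eq_lebint => x; rewrite addrK addrC.
rewrite (@lebint_swap (fun y x => bball_ind (x - M y)%R * g x)); last 2 first.
- by move=> z w; rewrite mule_ge0.
- move=> d T Z W mZ mW; apply: emeasurable_funM; last exact: mg.2.
  apply: (mb.2 _ _ (fun t => (W t - M (Z t))%R)).
  by apply: vmeasD => //; apply: vmeasN; exact: mM.
have v0' : 0 <= lebint bball_ind by exact: ltW.
rewrite -(lebintZ v0' mg).
apply: eq_lebint => x.
have mk : vfmeas (fun y => bball_ind (x - M y)%R).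
  apply: (vfmeas_comp (M := fun y => (x - M y)%R) mb) => d T Z mZ.
  by apply: vmeasD; [exact: vmeas_cst|apply: vmeasN; exact: mM].
transitivity (lebint (fun y => g x * bball_ind (x - M y)%R)).
  by apply: eq_lebint => y; rewrite muleC.
transitivity (g x * lebint (fun y => bball_ind (x - M y)%R)); first exact: lebintZ.
(* [x - M y] is [M] applied to [- (y - M' x)], so its norm is that of [y - M' x]: what remains is a
   translated ball. *)
suff -> : lebint (fun y => bball_ind (x - M y)%R) = lebint bball_ind by exact: muleC.
have <- := @lebint_translate (- M' x)%R _ mb.
apply: eq_lebint => y; rewrite /bball_ind -(vnorm2N (y - M' x)) -(Mn (- (y - M' x))%R).
by rewrite MN MD MN MK opprB.
Qed.

End BallIntegral.

(** * One-dimensional integrals *)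

Section RealIntegrals.
Variable R : realType.
Local Notation leb := (@lebesgue_measure R).
Local Open Scope ereal_scope.

Lemma measurable_inv_sqr (c : R) : (0 < c)%R ->
  measurable_fun setT (fun x : R => (c + x ^+ 2)^-1)%R.
Proof.
move=> c0; apply: continuous_measurable_fun => x.
apply: cvgV; first by rewrite gt_eqF// ltr_wpDr// sqr_ge0.
by apply: cvgD; [exact: cvg_cst|exact: exprn_continuous].
Qed.

(** The half-line value [pi / 2] at [c = 1] is doubled by evenness and rescaled by [sqrt c]. *)
Lemma integral_cauchy (c : R) : (0 < c)%R ->
  \int[leb]_x ((c + x ^+ 2)^-1)%R%:E = (pi / Num.sqrt c)%R%:E.
Proof.
move=> c0.
have I1 : \int[leb]_x ((oneDsqr x)^-1)%R%:E = (pi : R)%:E.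
  rewrite (@ge0_symfun_integralT _ (fun x => (oneDsqr x)^-1)%R).
  - by rewrite -set_itvcy integral0y_oneDsqr -EFinM; congr (_%:E); field.
  - by move=> x; rewrite invr_ge0; apply: le_trans (oneDsqr_ge1 x).
  - by move=> x; apply: continuous_oneDsqrV.
  - by move=> x /=; rewrite /oneDsqr sqrrN.
have s0 : (0 < Num.sqrt c)%R by rewrite sqrtr_gt0.
have m1 : measurable_fun setT (fun x : R => ((oneDsqr x)^-1)%R%:E).
  by apply: measurable_fun_EFin; exact: measurable_inv_sqr.
have o0 (x : R) : 0 <= ((oneDsqr x)^-1)%R%:E.
  by rewrite lee_fin invr_ge0; apply: le_trans (oneDsqr_ge1 x).
transitivity (\int[leb]_x ((c^-1)%:E * ((oneDsqr ((Num.sqrt c)^-1 * x + 0))^-1)%R%:E)).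
  apply: eq_integral => x _; rewrite -EFinM -invfM addr0; congr ((_^-1)%:E).
  rewrite /oneDsqr exprMn exprVn sqr_sqrtr ?(ltW c0)//.
  by field; exact: lt0r_neq0.
rewrite (@integralZl_leb _ _ (fun x => ((oneDsqr ((Num.sqrt c)^-1 * x + 0))^-1)%R%:E)); last 3 first.
- by rewrite lee_fin invr_ge0 ltW.
- have ma : measurable_fun setT (fun x : R => ((Num.sqrt c)^-1 * x + 0)%R).
    by apply: measurable_funD => //; exact: measurable_funM.
  exact: (measurableT_comp m1 ma).
- by move=> x; exact: o0.
rewrite (@integral_affine _ (Num.sqrt c)^-1 0 (fun x => ((oneDsqr x)^-1)%R%:E))//; last by rewrite invr_gt0.
rewrite I1 -!EFinM invrK; congr (_%:E).
rewrite -{1}(sqr_sqrtr (ltW c0)); field; exact: lt0r_neq0.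
Qed.

Definition powc (a d x : R) : \bar R := if (0 < x)%R && (x <= d)%R then (x `^ a)%R%:E else 0.

Lemma powc_ge0 (a d x : R) : 0 <= powc a d x.
Proof. by rewrite /powc; case: ifP => // _; rewrite lee_fin powR_ge0. Qed.

Lemma measurable_powc (a d : R) : measurable_fun setT (powc a d).
Proof.
apply: measurable_fun_ifT => //; last first.
  by apply: measurable_fun_EFin; exact: measurable_powR.
by apply: measurable_and; [exact: measurable_fun_ltr|exact: measurable_fun_ler].
Qed.

(** The possible singularity at 0 is reached by monotone convergence along [[1 / (i + 2), 1]], with
    the fundamental theorem of calculus on each interval; the shift by 2 keeps the endpoints
    distinct. *)
Lemma integral_powc1 (a : R) : (-1 < a)%R -> \int[leb]_x powc a 1 x <= ((a + 1)^-1)%R%:E.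
Proof.
move=> a1; have a10 : (0 < a + 1)%R by lra.
pose F (i : nat) : set R := `[(i.+2%:R^-1)%R, 1%R]%classic.
have FE : (\bigcup_i F i) = `]0%R, 1%R]%classic.
  apply/seteqP; split => x /=.
    move=> [i _]; rewrite /F /= !in_itv/= => /andP[h1 ->]; rewrite andbT.
    by apply: lt_le_trans h1; rewrite invr_gt0.
  rewrite in_itv/= => /andP[x0 x1].
  exists (Num.trunc (x^-1)) => //; rewrite /F /= in_itv/= x1 andbT.
  rewrite -[leRHS]invrK lef_pV2 ?posrE ?invr_gt0//.
  apply: le_trans (ltW (truncnS_gt _)) _; by rewrite ler_nat.
have -> : \int[leb]_x powc a 1 x = \int[leb]_(x in \bigcup_i F i) (x `^ a)%R%:E.
  rewrite FE [RHS]integral_mkcond; apply: eq_integral => x _.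
  rewrite /powc patchE; case: ifPn => h; case: ifPn => //.
    by move/negP; case; apply/mem_set; rewrite /= in_itv.
  by move/set_mem; rewrite /= in_itv/= (negbTE h).
have nd : nondecreasing_seq F.
  move=> i j ij; rewrite subsetEset => x; rewrite /F /= !in_itv/= => /andP[h1 ->]; rewrite andbT.
  by apply: le_trans h1; rewrite lef_pV2 ?posrE// ler_nat !ltnS.
have mF i : measurable (F i) by exact: measurable_itv.
have mf i : measurable_fun (F i) (fun x : R => (x `^ a)%R%:E).
  by apply: measurable_funTS; apply: measurable_fun_EFin; exact: measurable_powR.
have f0 i (x : R) : F i x -> 0 <= (x `^ a)%R%:E by rewrite lee_fin powR_ge0.
have H : \int[leb]_(x in F i) (x `^ a)%R%:E @[i --> \oo] --> \int[leb]_(x in \bigcup_i F i) (x `^ a)%R%:E.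
  exact: ge0_nondecreasing_set_cvg_integral.
move/cvg_lim : H => <- //.
apply: lime_le.
  apply: ereal_nondecreasing_is_cvgn.
  exact: ge0_nondecreasing_set_nondecreasing_integral.
apply: nearW => i.
pose G (x : R) := (x `^ (a + 1) / (a + 1))%R.
have i0 : (0 < (i.+2%:R^-1 : R))%R by rewrite invr_gt0.
have dG (x : R) : (0 < x)%R -> derivable G x 1.
  by move=> x0; apply: derivableM => //; apply: derivable_powR; rewrite in_itv/= x0.
have i1 : (i.+2%:R^-1 < 1 :> R)%R by rewrite invf_lt1// ltr1n.
rewrite (@continuous_FTC2 _ (fun x => x `^ a)%R G)//.
- rewrite /G powR1 mul1r -EFinB lee_fin gerBl.
  by rewrite mulr_ge0 ?powR_ge0// invr_ge0 ltW.
- apply: continuous_in_subspaceT => x; rewrite inE /= in_itv/= => /andP[x0 _].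
  apply: differentiable_continuous; apply/derivable1_diffP; apply: derivable_powR.
  by rewrite in_itv/= andbT (lt_le_trans i0).
- split.
  + by move=> x; rewrite in_itv/= => /andP[x0 _]; apply: dG; exact: lt_trans x0.
  + apply: cvg_at_right_filter; apply: differentiable_continuous; apply/derivable1_diffP; exact: dG.
  + apply: cvg_at_left_filter; apply: differentiable_continuous; apply/derivable1_diffP; exact: dG.
- move=> x; rewrite in_itv/= => /andP[x0 _].
  have x0' : (0 < x)%R by exact: lt_trans x0.
  have xi : x \in `]0%R, +oo[ by rewrite in_itv/= x0'.
  have := powR_derive1 (a + 1) xi; rewrite addrK => E.
  rewrite /G derive1E deriveM//; last by apply: derivable_powR.
  rewrite derive_cst scaler0 add0r -derive1E E /=.
  rewrite /GRing.scale/= mulrA mulVf ?mul1r// gt_eqF//.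
Qed.

Lemma integral_powc (a d : R) : (-1 < a)%R -> (0 < d)%R ->
  \int[leb]_x powc a d x <= (d `^ (a + 1) / (a + 1))%R%:E.
Proof.
move=> a1 d0.
have E x : powc a d x = (d `^ a)%R%:E * powc a 1 (d^-1 * x + 0)%R.
  rewrite addr0 /powc pmulr_rgt0 ?invr_gt0// -ler_pdivlMl ?invr_gt0// invrK mulr1.
  case: ifPn => [/andP[x0 xd]|_]; last by rewrite mule0.
  rewrite -EFinM powRM ?invr_ge0 ?ltW//.
  rewrite mulrA -powR_inv1 ?ltW// -powRrM mulN1r powRN mulfV ?mul1r//.
  by rewrite gt_eqF// powR_gt0.
under eq_integral do rewrite E.
have da0 : 0 <= (d `^ a)%R%:E by rewrite lee_fin powR_ge0.
rewrite (@integralZl_leb _ _ (fun x => powc a 1 (d^-1 * x + 0)%R))//; last 2 first.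
- have ma : measurable_fun setT (fun x : R => (d^-1 * x + 0)%R).
    by apply: measurable_funD => //; exact: measurable_funM.
  exact: (measurableT_comp (measurable_powc a 1) ma).
- by move=> x; exact: powc_ge0.
rewrite (@integral_affine _ d^-1 0 (powc a 1)) ?invr_gt0//; last 2 first.
- exact: measurable_powc.
- by move=> x; exact: powc_ge0.
rewrite invrK muleA -EFinM (powRD (r := a) (s := 1%R)) ?powRr1 ?(ltW d0)//; last first.
  by rewrite (gt_eqF d0) implybT.
rewrite [leRHS]EFinM; apply: lee_wpmul2l; last exact: integral_powc1.
by rewrite lee_fin mulr_ge0 ?powR_ge0// ltW.
Qed.

(** The slope is negative, which [integral_affine] does not cover; invariance of Lebesgue measure
    under negation is used instead. *)
Lemma integral_reflect (c : R) (f : R -> \bar R) :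
  measurable_fun setT f -> (forall x, 0 <= f x) ->
  \int[leb]_x f (c - x)%R = \int[leb]_x f x.
Proof.
move=> mf f0.
have mN : measurable_fun setT (-%R : measurableTypeR R -> measurableTypeR R) by exact: oppr_measurable.
have E : \int[leb]_x f (- x)%R = \int[leb]_x f x.
  rewrite -[LHS](@ge0_integral_pushforward _ _ (measurableTypeR R) (measurableTypeR R) R -%R mN leb setT f)//.
  by apply: eq_measure_integral => //= A mA _; exact: lebesgue_measureN.
have mfN : measurable_fun setT (fun x : R => f (- x)%R) by exact: (measurableT_comp mf mN).
have := @integral_affine R 1 (- c)%R (fun x => f (- x)%R) ltr01 mfN (fun x => f0 _).
rewrite invr1 mul1e E => <-; apply: eq_integral => x _; congr f; ring.
Qed.

(** Put [y = 1 - x]. The part [y <= d] is the integral of a power. For [y > d], [y^(a-q) = y^(a+2-q)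
    y^-2 <= d^(a+2-q) y^-2] because [a + 2 - q <= 0], and [y^-2 <= 2 / (d^2 + y^2)], whose integral
    over the whole line is known. *)
Lemma radial_weight_integral (a : R) (q : nat) (d : R) : (-1 < a)%R -> (a + 2 <= q%:R)%R -> (0 < d)%R ->
  \int[leb]_x (if (0 < x)%R && (x < 1)%R then
      ((1 - x ^+ 2) `^ a * (Num.max d (1 - x)) ^- q)%R%:E else 0) <=
  ((1 + 2 `^ a) * ((a + 1)^-1 + 2 * pi) * d `^ (a + 1 - q%:R))%R%:E.
Proof.
move=> a1 aq d0.
have d0' := ltW d0.
pose f x : \bar R := (d ^- q)%R%:E * powc a d x + (2 * d `^ (a + 2 - q%:R))%R%:E * ((d ^+ 2 + x ^+ 2)^-1)%R%:E.
have c1 : (0 <= 2 * d `^ (a + 2 - q%:R))%R by rewrite mulr_ge0// powR_ge0.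
have c2 : (0 <= d ^- q)%R by rewrite invr_ge0 exprn_ge0.
have iq (x : R) : 0 <= ((d ^+ 2 + x ^+ 2)^-1)%R%:E by rewrite lee_fin invr_ge0 addr_ge0// sqr_ge0.
have mi : measurable_fun setT (fun x : R => ((d ^+ 2 + x ^+ 2)^-1)%R%:E).
  by apply: measurable_fun_EFin; apply: measurable_inv_sqr; rewrite exprn_gt0.
have f0 x : 0 <= f x.
  apply: adde_ge0; apply: mule_ge0; rewrite ?lee_fin//; first exact: powc_ge0.
  by rewrite -lee_fin.
have mf : measurable_fun setT f.
  apply: emeasurable_funD; apply: measurable_funeM => //; exact: measurable_powc.
have p0 : (0 <= 1 + 2 `^ a :> R)%R by rewrite addr_ge0 ?powR_ge0.
apply: (@le_trans _ _ (\int[leb]_x ((1 + 2 `^ a)%R%:E * f (1 - x)%R))).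
  apply: le_integral_ge0 => x.
    by case: ifP => // _; rewrite lee_fin mulr_ge0 ?powR_ge0// invr_ge0 exprn_ge0// le_max d0'.
  case: ifPn => [/andP[x0 x1]|_]; last by rewrite mule_ge0.
  have x10 : (0 < 1 - x)%R by lra.
  have x10' := ltW x10.
  have -> : (1 - x ^+ 2 = (1 - x) * (1 + x))%R by ring.
  rewrite powRM//; last lra.
  (* [1 + x] lies between 1 and 2, so its power is at most [2^a] or 1 according to the sign of [a];
     the sum covers both. *)
  have xa : ((1 + x) `^ a <= 1 + 2 `^ a)%R.
    have [a0|a0] := leP 0%R a.
      apply: (@le_trans _ _ (2 `^ a)%R); last by rewrite lerDr.
      by apply: ge0_ler_powR; rewrite ?nnegrE//; lra.
    apply: (@le_trans _ _ 1%R); last by rewrite lerDl powR_ge0.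
    rewrite -[leRHS](powRr0 (1 + x)); apply: ler_powR; lra.
  apply: (@le_trans _ _ ((1 + 2 `^ a)%R%:E * ((1 - x) `^ a * Num.max d (1 - x) ^- q)%R%:E)).
    rewrite -EFinM lee_fin mulrAC [leRHS]mulrC; apply: ler_wpM2l => //.
    by rewrite mulr_ge0 ?powR_ge0// invr_ge0 exprn_ge0// le_max d0'.
  apply: lee_wpmul2l; first by rewrite lee_fin.
  rewrite /f /powc x10 /=; have [xd|xd] := leP (1 - x)%R d.
    rewrite -!EFinM -EFinD lee_fin mulrC lerDl.
    by rewrite mulr_ge0// -lee_fin.
  rewrite mule0 add0e -EFinM lee_fin.
  set y := (1 - x)%R in x10 x10' xd *.
  have -> : (y `^ a * y ^- q = y `^ (a + 2 - q%:R) * y ^- 2)%R.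
    rewrite -(powR_mulrn q)// -powRN -(powR_mulrn 2)// -powRN -!powRD ?(gt_eqF x10) ?implybT//.
    congr (_ `^ _)%R; ring.
  apply: (@le_trans _ _ (d `^ (a + 2 - q%:R) * y ^- 2)%R).
    apply: ler_wpM2r; first by rewrite invr_ge0 exprn_ge0.
    rewrite -[X in (_ `^ X <= _)%R]opprK -[X in (_ <= _ `^ X)%R]opprK !(powRN _ (- _)).
    rewrite lef_pV2 ?posrE ?powR_gt0//; apply: ge0_ler_powR; rewrite ?nnegrE//; first lra.
    exact: ltW.
  have -> (P S : R) : (2 * P / S = P * (2 / S))%R by ring.
  apply: ler_wpM2l; first exact: powR_ge0.
  rewrite ler_pdivlMr ?addr_gt0 ?exprn_gt0// mulrDr mulVf ?gt_eqF ?exprn_gt0//.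
  rewrite -[leRHS](_ : 1 + 1 = 2)%R// lerD2r -ler_pdivlMl ?invr_gt0 ?exprn_gt0// invrK mulr1.
  by rewrite ler_sqr ?nnegrE// ltW.
rewrite (@integralZl_leb _ _ (fun x => f (1 - x)%R)); last 3 first.
- by rewrite lee_fin.
- have ma : measurable_fun setT (fun x : R => (1 - x)%R) by exact: measurable_funB.
  exact: (measurableT_comp mf ma).
- by move=> x; exact: f0.
rewrite (@integral_reflect 1 f)// -mulrA EFinM; apply: lee_wpmul2l; first by rewrite lee_fin.
rewrite /f ge0_integralD//=; last 4 first.
- by move=> x _; rewrite mule_ge0 ?lee_fin//; exact: powc_ge0.
- by apply: measurable_funeM; exact: measurable_powc.
- by move=> x _; rewrite mule_ge0 ?lee_fin// -lee_fin.
- exact: measurable_funeM.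
rewrite (@integralZl_leb _ _ (powc a d)) ?lee_fin//; last 2 first.
- exact: measurable_powc.
- exact: powc_ge0.
rewrite (@integralZl_leb _ _ (fun x => ((d ^+ 2 + x ^+ 2)^-1)%R%:E)) ?lee_fin//.
rewrite integral_cauchy ?exprn_gt0// sqrtr_sqr gtr0_norm//.
apply: (@le_trans _ _ ((d ^- q)%R%:E * (d `^ (a + 1) / (a + 1))%:E + (2 * d `^ (a + 2 - q%:R))%:E * (pi / d)%:E)).
  by apply: leeD2r; apply: lee_wpmul2l; rewrite ?lee_fin//; exact: integral_powc.
rewrite -!EFinM -EFinD lee_fin le_eqVlt; apply/orP; left; apply/eqP.
have -> : (d `^ (a + 2 - q%:R) = d `^ (a + 1 - q%:R) * d)%R.
  have -> : (a + 2 - q%:R = a + 1 - q%:R + 1)%R by ring.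
  by rewrite powRD ?(gt_eqF d0) ?implybT// powRr1.
have -> : (d `^ (a + 1 - q%:R) = d `^ (a + 1) * d ^- q)%R.
  by rewrite powRD ?(gt_eqF d0) ?implybT// powRN powR_mulrn.
have a10 : (a + 1)%R != 0%R by rewrite gt_eqF//; lra.
have D0 : (d ^+ q)%R != 0%R by rewrite expf_neq0// gt_eqF.
have dn0 : d != 0%R by rewrite gt_eqF.
by move: (d ^+ q)%R (d `^ (a + 1))%R D0 => D P D0; field; rewrite ?a10 ?D0 ?dn0.
Qed.

(** Up to 1 the exponential is dropped. Beyond 1, [e^t >= t^(k+1) / (k+1)!] with [k + 1 > x + 1],
    and [1 + t^2 <= 2 t^2], which gives the constant [2 (k+1)!]. *)
Lemma Gamma_integrand_bound (x : R) : (0 < x)%R -> exists K : R, (0 <= K)%R /\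
  forall t : R, (0 < t)%R -> (t `^ (x - 1) * expR (- t))%R%:E <= powc (x - 1) 1 t + (K * (1 + t ^+ 2)^-1)%R%:E.
Proof.
move=> x0; pose k := Num.trunc (x + 1)%R.
exists (2 * (k.+1)`!%:R)%R; split; first by rewrite mulr_ge0.
move=> t t0; have t0' := ltW t0.
have h2 : (0 < 1 + t ^+ 2)%R by rewrite ltr_wpDr// sqr_ge0.
have h1 : (0 <= 2 * (k.+1)`!%:R * (1 + t ^+ 2)^-1)%R by rewrite !mulr_ge0// invr_ge0 ltW.
rewrite /powc t0 /=; have [t1|t1] := leP t 1%R.
  rewrite -EFinD lee_fin; apply: (@le_trans _ _ (t `^ (x - 1))%R); last by rewrite lerDl.
  rewrite -[leRHS]mulr1; apply: ler_wpM2l; first exact: powR_ge0.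
  by rewrite -expR0 ler_expR lerNl oppr0.
rewrite add0e lee_fin ler_pdivlMr// expRN.
rewrite -mulrA [X in (_ * X <= _)%R]mulrC mulrA ler_pdivrMr ?expR_gt0//.
have e1 : (t ^+ k.+1 <= (k.+1)`!%:R * expR t)%R.
  rewrite -ler_pdivrMl ?ltr0n ?fact_gt0// mulrC.
  by apply: le_trans (expR_ge1Dxn k t0'); rewrite lerDr.
have e2 : (t `^ (x - 1) * t ^+ 2 <= t ^+ k.+1)%R.
  rewrite -!(powR_mulrn _ t0') -powRD ?(gt_eqF t0) ?implybT//.
  apply: ler_powR; first exact: ltW.
  have := truncnS_gt (x + 1)%R; rewrite -/k; lra.
have e3 : (1 <= t ^+ 2)%R by rewrite exprn_ege1// ltW.
have e4 := powR_ge0 t (x - 1).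
nra.
Qed.

(** [Gamma] is defined through [fine], which sends an infinite integral to 0, so finiteness has to
    be shown as well as positivity. *)
Lemma Gamma_gt0 (x : R) : (0 < x)%R -> (0 < Gamma x)%R.
Proof.
move=> x0; rewrite /Gamma.
have E : \int[leb]_(t in `]0%R, +oo[%classic) ((t `^ (x - 1)) * expR (- t))%R%:E =
   \int[leb]_t (if (0 < t)%R then ((t `^ (x - 1)) * expR (- t))%R%:E else 0).
  rewrite integral_mkcond; apply: eq_integral => t _; rewrite patchE.
  case: ifPn => [/set_mem|/negP h]; rewrite /= ?in_itv/= ?andbT; first by move=> ->.
  by case: ifPn => // t0; case: h; apply/mem_set; rewrite /= in_itv/= t0.
rewrite E {E}.
set I := integral _ _ _.
have g0 (t : R) : 0 <= (if (0 < t)%R then ((t `^ (x - 1)) * expR (- t))%R%:E else 0).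
  by case: ifP => // _; rewrite lee_fin mulr_ge0 ?powR_ge0 ?expR_ge0.
have [K [K0 HK]] := Gamma_integrand_bound x0.
have mi : measurable_fun setT (fun t : R => ((1 + t ^+ 2)^-1)%R%:E).
  by apply: measurable_fun_EFin; exact: measurable_inv_sqr.
have i0 (t : R) : 0 <= ((1 + t ^+ 2)^-1)%R%:E.
  by rewrite lee_fin invr_ge0 addr_ge0// sqr_ge0.
have Ify : I < +oo.
  apply: (@le_lt_trans _ _ (\int[leb]_t (powc (x - 1) 1 t + K%:E * ((1 + t ^+ 2)^-1)%R%:E))).
    apply: le_integral_ge0 => // t; case: ifPn => [t0|_]; first by rewrite -EFinM; exact: HK.
    by rewrite adde_ge0 ?powc_ge0// mule_ge0// lee_fin.
  rewrite ge0_integralD//=; last 4 first.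
  - by move=> t _; exact: powc_ge0.
  - exact: measurable_powc.
  - by move=> t _; rewrite mule_ge0 ?lee_fin// -lee_fin.
  - exact: measurable_funeM.
  rewrite (@integralZl_leb _ _ (fun t => ((1 + t ^+ 2)^-1)%R%:E)) ?lee_fin//.
  rewrite integral_cauchy// -EFinM lte_add_pinfty// ?ltry//.
  have x1 : (-1 < x - 1)%R by lra.
  by apply: (le_lt_trans (integral_powc1 x1)); rewrite ltry.
(* On [[1, 2]] the integrand is at least [t^-1 e^-t >= e^-2 / 2]. *)
have Ipos : 0 < I.
  apply: (@lt_le_trans _ _ (\int[leb]_(t in `[1%R, 2%R]%classic) ((expR (- 2) / 2)%R%:E))).
    rewrite integral_cst//= lebesgue_measure_itv/= lte_fin ltr1n /=.
    by rewrite -EFinB -EFinM lte_fin mulr_gt0 ?divr_gt0 ?expR_gt0//; lra.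
  rewrite integral_mkcond; apply: le_integral_ge0 => t; rewrite patchE.
    by case: ifP => // _; rewrite lee_fin divr_ge0 ?expR_ge0.
  case: ifPn => // /set_mem; rewrite /= in_itv/= => /andP[t1 t2].
  have t0 : (0 < t)%R by lra.
  rewrite t0 lee_fin mulrC; apply: ler_pM; rewrite ?expR_ge0 ?invr_ge0//; last first.
    by rewrite ler_expR lerN2.
  apply: (@le_trans _ _ (t `^ (-1))%R); last by apply: ler_powR => //; lra.
  by rewrite powR_inv1 ?(ltW t0)// lef_pV2 ?posrE.
by rewrite fine_gt0// Ipos Ify.
Qed.

End RealIntegrals.

(** * Measurability, polar coordinates and rotations *)

Section ContinuousMeasurable.
Variable R : realType.
Variable n : nat.
Local Notation C := (R[i]).
Local Notation N := n.+1.
Local Notation V := 'rV[C]_N.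
Local Notation VT := (V : normedModType C).

(** A preimage is a countable union of fibres of [code], so nothing is asked of [G]. *)
Lemma measurable_countable_factor d (T : measurableType d) (K : countType)
    (code : T -> K) (G : K -> R) :
  (forall k, measurable [set t | code t = k]) ->
  measurable_fun setT (fun t => G (code t)).
Proof.
move=> mk _ Y mY; rewrite setTI.
have -> : (fun t => G (code t)) @^-1` Y =
    \bigcup_(i in [set i | exists t, pickle (code t) = i /\ Y (G (code t))])
      [set t | pickle (code t) = i].
  apply/seteqP; split => t /=.
    by move=> Yt; exists (pickle (code t)) => //; exists t.
  by move=> [i [t' [<- Yt']]] /= /(pcan_inj (@pickleK K)) ->.
apply: bigcup_measurable => i _.
have [[k <-]|hn] := pselect (exists k : K, pickle k = i).
  rewrite (_ : mkset _ = [set t | code t = k])//.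
  by apply/seteqP; split => t /= => [/(pcan_inj (@pickleK K))|->].
rewrite (_ : mkset _ = set0); first exact: measurable0.
by apply/seteqP; split => t //= ht; apply: hn; exists (code t).
Qed.

(** The index of the cell of side [1 / a] that contains [z]; the indices form a countable type. *)
Definition grid_code (a : R) (z : V) : {ffun 'I_N -> int * int} :=
  [ffun j => (Num.floor (a * complex.Re (z ord0 j)), Num.floor (a * complex.Im (z ord0 j)))].

Definition grid_point (a : R) (k : {ffun 'I_N -> int * int}) : V :=
  \row_j ((k j).1%:~R / a +i* ((k j).2%:~R / a))%C.

Lemma measurable_floor_eq d (T : measurableType d) (X : T -> R) (k : int) :
  measurable_fun setT X -> measurable [set t | Num.floor (X t) = k].
Proof.
move=> mX.
have -> : [set t | Num.floor (X t) = k] = (fun t => (k%:~R <= X t) && (X t < (k + 1)%:~R)) @^-1` [set true].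
  apply/seteqP; split => t /= => [<-|/floor_def//].
  by rewrite floor_le floorD1_gt.
have m : measurable_fun setT (fun t => (k%:~R <= X t) && (X t < (k + 1)%:~R)).
  by apply: measurable_and; [exact: measurable_fun_ler|exact: measurable_fun_ltr].
by rewrite -[X in measurable X]setTI; exact: m.
Qed.

Lemma measurable_grid_code d (T : measurableType d) (Z : T -> V) (a : R) k :
  vmeas Z -> measurable [set t | grid_code a (Z t) = k].
Proof.
move=> mZ.
have -> : [set t | grid_code a (Z t) = k] = \big[setI/setT]_(j < N)
   ([set t | Num.floor (a * complex.Re (Z t ord0 j)) = (k j).1] `&`
    [set t | Num.floor (a * complex.Im (Z t ord0 j)) = (k j).2]).
  rewrite -bigcap_seq; apply/seteqP; split => t /=.
    by move=> <- j _ /=; rewrite ffunE.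
  move=> h; apply/ffunP => j; rewrite ffunE.
  have [|/= -> ->] := h j; first by rewrite /= mem_index_enum.
  by case: (k j).
apply: bigsetI_measurable => j _; apply: measurableI; apply: measurable_floor_eq.
  by apply: measurable_funM => //; exact: (mZ j).1.
by apply: measurable_funM => //; exact: (mZ j).2.
Qed.

Lemma normc_le_ReIm (x : C) : (`|x| <= (`|complex.Re x| + `|complex.Im x|)%:C%C)%R.
Proof.
rewrite normc_def lecR; case: x => a b /=.
rewrite -[leRHS]ger0_norm ?addr_ge0// -sqrtr_sqr; apply: ler_wsqrtr.
rewrite sqrrD !real_normK ?num_real// addrAC lerDl mulrn_wge0// mulr_ge0//.
Qed.

Lemma Re_le_normc (x : C) : ((`|complex.Re x|)%:C%C <= `|x|)%R.
Proof.
rewrite normc_def lecR; case: x => a b /=.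
by rewrite -sqrtr_sqr; apply: ler_wsqrtr; rewrite lerDl sqr_ge0.
Qed.

Lemma Im_le_normc (x : C) : ((`|complex.Im x|)%:C%C <= `|x|)%R.
Proof.
rewrite normc_def lecR; case: x => a b /=.
by rewrite -sqrtr_sqr; apply: ler_wsqrtr; rewrite lerDr sqr_ge0.
Qed.

Lemma gtc0_real (e : C) : 0 < e -> exists2 r : R, 0 < r & e = r%:C%C.
Proof. by case: e => a b; rewrite ltcE /= => /andP[/eqP -> a0]; exists a. Qed.

Lemma floor_grid_dist (a x : R) : 0 < a -> `|x - (Num.floor (a * x))%:~R / a| <= a^-1.
Proof.
move=> a0.
have h1 := floor_le (a * x); have h2 := floorD1_gt (a * x).
have -> : x - (Num.floor (a * x))%:~R / a = (a * x - (Num.floor (a * x))%:~R) / a.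
  by field; exact: lt0r_neq0.
rewrite normrM [X in _ * X]ger0_norm ?invr_ge0 ?(ltW a0)// ger0_norm ?subr_ge0//.
rewrite -[leRHS]mul1r; apply: ler_wpM2r; first by rewrite invr_ge0 ltW.
by move: h2; rewrite intrD => h2; lra.
Qed.

Lemma cvg_grid (z : V) : (fun k : nat => (grid_point k.+1%:R (grid_code k.+1%:R z) : VT)) @ \oo --> (z : VT).
Proof.
apply/cvg_ballP => e e0; have [r r0 er] := gtc0_real e0.
near=> k; split=> // i j; rewrite (ord1 i) /ball /= !mxE ffunE /= er.
apply: le_lt_trans (normc_le_ReIm _) _; rewrite ltcR.
set w := z ord0 j.
have k0 : 0 < k.+1%:R :> R by [].
have h1 := floor_grid_dist (complex.Re w) k0; have h2 := floor_grid_dist (complex.Im w) k0.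
apply: (@le_lt_trans _ _ (k.+1%:R^-1 + k.+1%:R^-1)).
  by case: (w) h1 h2 => u v /= h1 h2; exact: lerD.
have : k.+1%:R^-1 < r / 2.
  near: k; apply: (near_infty_natSinv_lt (PosNum (divr_gt0 r0 (ltr0Sn R 1)))).
by move=> /= h; rewrite [X in _ < X]splitr; exact: ltrD.
Unshelve. all: by end_near. Qed.

Lemma cvg_ReIm (u : nat -> C^o) (l : C^o) : u @ \oo --> l ->
  ((fun k => complex.Re (u k)) @ \oo --> complex.Re l) /\
  ((fun k => complex.Im (u k)) @ \oo --> complex.Im l).
Proof.
move=> /cvgrPdist_lt ul; split; apply/cvgrPdist_lt => e e0.
- have e0' : 0 < e%:C%C :> C by rewrite ltcR.
  near=> k.
  have H : `|l - u k| < e%:C%C by near: k; exact: ul.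
  rewrite -ltcR; apply: le_lt_trans H.
  by apply: le_trans (Re_le_normc _); rewrite lecR; case: (l) => ? ?; case: (u k).
- have e0' : 0 < e%:C%C :> C by rewrite ltcR.
  near=> k.
  have H : `|l - u k| < e%:C%C by near: k; exact: ul.
  rewrite -ltcR; apply: le_lt_trans H.
  by apply: le_trans (Im_le_normc _); rewrite lecR; case: (l) => ? ?; case: (u k).
Unshelve. all: by end_near. Qed.

Lemma cvg_cabs2 (u : nat -> C^o) (l : C^o) : u @ \oo --> l ->
  (fun k => cabs2 (u k)) @ \oo --> cabs2 l.
Proof.
move=> /cvg_ReIm[h1 h2]; rewrite /cabs2.
have E (w : C) : complex.Re w ^+ 2 + complex.Im w ^+ 2 =
  complex.Re w * complex.Re w + complex.Im w * complex.Im w by rewrite !expr2.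
by under eq_fun do rewrite E; rewrite E; apply: cvgD; exact: cvgM.
Qed.

Lemma cvg_continuous_at (U W : nbhsType) (f : U -> W) (u : nat -> U) (x : U) :
  {for x, continuous f} -> u @ \oo --> x -> (fun k => f (u k)) @ \oo --> f x.
Proof. by move=> cf cu; exact: (cvg_comp _ _ cu cf). Qed.

(* [f] is the pointwise limit of its values at the points of finer and finer grids. *)
Lemma vfmeas_cabs2_ball (f : V -> C^o) :
  (forall z, Bball z -> {for (z : VT), continuous (f : VT -> C^o)}) ->
  vfmeas (fun z => if vnorm2 z < 1 then (cabs2 (f z))%:E else 0%E).
Proof.
move=> cf; split => [z|d T Z mZ].
  by case: ifP => // _; rewrite lee_fin addr_ge0 ?sqr_ge0.
pose h (k : nat) t : R := if vnorm2 (Z t) < 1 then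
  cabs2 (f (grid_point k.+1%:R (grid_code k.+1%:R (Z t)))) else 0.
have mh k : measurable_fun setT (h k).
  apply: measurable_fun_ifT => //.
    by apply: measurable_fun_ltr => //; exact: measurable_vnorm2.
  apply: (measurable_countable_factor (code := fun t => grid_code k.+1%:R (Z t))
    (fun c => cabs2 (f (grid_point k.+1%:R c)))) => c.
  exact: measurable_grid_code.
pose h' t : R := if vnorm2 (Z t) < 1 then cabs2 (f (Z t)) else 0.
have mh' : measurable_fun setT h'.
  apply: (measurable_fun_cvg mh) => t _; rewrite /h /h'.
  case: ifPn => ht; last exact: cvg_cst.
  apply: (cvg_cabs2 (u := fun k => f (grid_point k.+1%:R (grid_code k.+1%:R (Z t)))) (l := f (Z t))).
  exact: (@cvg_continuous_at VT C^o f _ (Z t) (cf (Z t) ht) (@cvg_grid (Z t))).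
apply: (eq_measurable_fun (fun t => (h' t)%:E)) => [t _|]; first by rewrite /h'; case: ifP.
exact: measurable_fun_EFin.
Qed.

End ContinuousMeasurable.

(** * A substitute for integration in polar coordinates *)

Section Polar.
Variable R : realType.
Variable n : nat.
Local Notation C := (R[i]).
Local Notation N := n.+1.
Local Notation V := 'rV[C]_N.
Local Notation leb := (@lebesgue_measure R).
Local Open Scope ereal_scope.

Definition vnorm (z : V) : R := Num.sqrt (vnorm2 z).

Lemma vnorm2_ge0 (z : V) : (0 <= vnorm2 z)%R.
Proof. by apply: sumr_ge0 => j _; rewrite addr_ge0 ?sqr_ge0. Qed.

Lemma vnorm_ge0 (z : V) : (0 <= vnorm z)%R. Proof. exact: sqrtr_ge0. Qed.

Lemma vnorm_sqr (z : V) : (vnorm z ^+ 2 = vnorm2 z)%R.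
Proof. by rewrite sqr_sqrtr// vnorm2_ge0. Qed.

Lemma vnorm_lt1 (z : V) : (vnorm z < 1)%R = (vnorm2 z < 1)%R.
Proof. by rewrite -vnorm_sqr expr_lt1// vnorm_ge0. Qed.

Lemma cabs2Z (r : R) (c : C) : (cabs2 (r%:C%C * c) = r ^+ 2 * cabs2 c)%R.
Proof. by case: c => a b; rewrite /cabs2 /= !mul0r subr0 addr0 !exprMn mulrDr. Qed.

Lemma vnorm2Z (r : R) (z : V) : (vnorm2 (r%:C%C *: z) = r ^+ 2 * vnorm2 z)%R.
Proof. by rewrite /vnorm2 mulr_sumr; apply: eq_bigr => j _; rewrite mxE cabs2Z. Qed.

Lemma vnormZ (r : R) (z : V) : (0 <= r)%R -> (vnorm (r%:C%C *: z) = r * vnorm z)%R.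
Proof. by move=> r0; rewrite /vnorm vnorm2Z sqrtrM ?sqr_ge0// sqrtr_sqr ger0_norm. Qed.

Lemma measurable_vnorm d (T : measurableType d) (Z : T -> V) : vmeas Z ->
  measurable_fun setT (fun t => vnorm (Z t)).
Proof.
move=> mZ; have ms : measurable_fun setT (Num.sqrt : R -> R).
  by apply: continuous_measurable_fun; exact: sqrt_continuous.
exact: (measurableT_comp ms (measurable_vnorm2 mZ)).
Qed.

Lemma measurable_vnormV d (T : measurableType d) (Z : T -> V) : vmeas Z ->
  measurable_fun setT (fun t => (vnorm (Z t))^-1)%R.
Proof.
move=> mZ.
(* Inversion is not continuous at 0; the reciprocal norm is read as the power [-1/2] of the squared
   norm, and powers are measurable on the whole line. *)
rewrite (_ : (fun _ => _) = (fun t => vnorm2 (Z t) `^ (- 2^-1))%R).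
  by exact: (measurableT_comp (@measurable_powR R (- 2^-1)%R) (measurable_vnorm2 mZ)).
by apply/funext => t; rewrite powRN powR12_sqrt// vnorm2_ge0.
Qed.

Lemma vmeasZ d (T : measurableType d) (p : T -> R) (Z : T -> V) :
  measurable_fun setT p -> vmeas Z -> vmeas (fun t => (p t)%:C%C *: Z t)%R.
Proof.
move=> mp mZ j; split.
- rewrite (_ : (fun _ => _) = (fun t => p t * complex.Re (Z t ord0 j))%R).
    by apply: measurable_funM => //; exact: (mZ j).1.
  by apply/funext => t; rewrite mxE; case: (Z t ord0 j) => a b /=; rewrite mul0r subr0.
- rewrite (_ : (fun _ => _) = (fun t => p t * complex.Im (Z t ord0 j))%R).
    by apply: measurable_funM => //; exact: (mZ j).2.
  by apply/funext => t; rewrite mxE; case: (Z t ord0 j) => a b /=; rewrite mul0r addr0.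
Qed.

Lemma lebint_scale (t : R) (f : V -> \bar R) : (0 < t)%R -> vfmeas f ->
  lebint (fun z => f (t%:C%C *: z)%R) = (t ^- N.*2)%R%:E * lebint f.
Proof.
move=> t0 mf; have := @lebint_affine R n (fun=> t) 0%R f (fun=> t0) mf.
rewrite prodr_const card_ord -exprVn -exprM mul2n exprVn => <-.
by apply: eq_lebint => z; congr f; apply/rowP => j; rewrite !mxE addr0.
Qed.

(** [ball_volume] times the integral of [G] at [r] times the point against [sigma], in the encoding
    of [sigma_int]: the sphere is the radial image of the ball. The origin, where [(vnorm z)^-1] is
    0, projects to itself. *)
Definition sphere_avg (G : V -> \bar R) (r : R) : \bar R :=
  lebint (fun z => if (vnorm2 z < 1)%R then G (r%:C%C *: ((vnorm z)^-1%:C%C *: z))%R else 0).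

Lemma vfmeas_sphere (G : V -> \bar R) r : vfmeas G ->
  vfmeas (fun z => if (vnorm2 z < 1)%R then G (r%:C%C *: ((vnorm z)^-1%:C%C *: z))%R else 0).
Proof.
move=> mG; apply: vfmeas_ball; apply: (vfmeas_comp mG) => d T Z mZ.
by apply: vmeasZ => //; apply: vmeasZ => //; exact: measurable_vnormV.
Qed.

Lemma ltr_scale (t v : R) : (0 < t)%R ->
  ((t / 2 < t * v)%R = (2^-1 < v)%R) * ((t * v < t)%R = (v < 1)%R).
Proof.
by move=> t0; split; [rewrite ltr_pM2l|rewrite -[X in (_ < X)%R]mulr1 ltr_pM2l].
Qed.

Lemma mule_exp2K k (X : \bar R) : (2 ^+ k)%R%:E * ((2 ^- k)%R%:E * X) = X.
Proof. by rewrite muleA -EFinM mulfV ?mul1e// expf_neq0. Qed.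

Lemma mule_exp2S k (X : \bar R) : (2 ^+ k)%R%:E * (2%:E * X) = (2 ^+ k.+1)%R%:E * X.
Proof. by rewrite muleA -EFinM -exprSr. Qed.

(** The window is [v < t < 2 v]. It has length [v], and there [t^(-2N) >= (2 v)^(-2N)]; finally
    [v^(1 - 2N) >= 1] as [v < 1]. *)
Lemma polar_inner (v : R) (g : \bar R) : (0 < v)%R -> (v < 1)%R -> 0 <= g ->
  (2 ^- N.*2)%R%:E * g <= \int[leb]_t (if (0 < t)%R && ((t / 2 < v)%R && (v < t)%R) then
    (t `^ (- N.*2%:R))%R%:E * g else 0).
Proof.
move=> v0 v1 g0.
have v20 : (0 < 2 * v)%R by exact: mulr_gt0.
have [c cE c0] : exists2 c : R, c = ((2 * v) ^- N.*2)%R & (0 <= c)%R.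
  by eexists; [reflexivity|rewrite invr_ge0; apply: exprn_ge0; exact: ltW].
apply: (@le_trans _ _ (\int[leb]_(t in `]v, (2 * v)%R[%classic) (c%:E * g))).
  rewrite integral_cst//= lebesgue_measure_itv/= lte_fin.
  have -> : (v < 2 * v)%R by lra.
  rewrite -EFinB muleAC -EFinM; apply: lee_wpmul2r => //; rewrite lee_fin.
  have -> : (2 * v - v = v)%R by ring.
  have -> : (c * v = 2 ^- N.*2 * (v ^- N.*2 * v))%R by rewrite cE exprMn invfM mulrA.
  rewrite -[leLHS]mulr1; apply: ler_wpM2l; first by rewrite invr_ge0 exprn_ge0.
  rewrite mulrC ler_pdivlMr ?exprn_gt0// mul1r doubleS exprS.
  by apply: ler_piMr; [exact: ltW|apply: exprn_ile1; exact: ltW].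
have h0 (t : R) : 0 <= (if (0 < t)%R && ((t / 2 < v)%R && (v < t)%R) then
    (t `^ (- N.*2%:R))%R%:E * g else 0).
  by case: ifP => // _; rewrite mule_ge0// lee_fin powR_ge0.
rewrite integral_mkcond; apply: le_integral_ge0 => t; rewrite patchE.
  by case: ifP => // _; rewrite mule_ge0// lee_fin.
case: ifPn => [/set_mem|_]; last exact: h0.
rewrite /= in_itv/= => /andP[vt tv].
have t0 : (0 < t)%R by lra.
have t2 : (t / 2 < v)%R by lra.
rewrite t0 vt t2 /=.
apply: lee_wpmul2r => //; rewrite lee_fin powRN powR_mulrn ?(ltW t0)// cE.
rewrite lef_pV2 ?posrE ?exprn_gt0//.
by rewrite lerXn2r ?nnegrE; lra.
Qed.

(* Averaging over the dilations [z |-> t z] stands in for polar coordinates; only an inequality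
   is needed, which costs the constant. *)
Lemma polar_le (W : R -> \bar R) (G : V -> \bar R) :
  measurable_fun setT W -> (forall r, 0 <= W r) ->
  (forall r, ~~ ((0 < r)%R && (r < 1)%R) -> W r = 0) -> vfmeas G ->
  lebint (fun z => W (vnorm z) * G z) <=
  (2 ^+ N.*2.+1)%R%:E * \int[leb]_r (W r * sphere_avg G r).
Proof.
move=> mW W0 Wsupp mG; have G0 := mG.1.
(* The double integral of [F] over [t] and [z] is treated in both orders; restricting to
   [1/2 < |z| < 1] keeps [dt] and [dr] comparable in [r = t |z|]. *)
pose F (t : R) (z : V) : \bar R :=
  if (2^-1 < vnorm z)%R && (vnorm z < 1)%R then W (t * vnorm z)%R * G (t%:C%C *: z)%R else 0.
have mF : jvmeas F.
  split => [t z|d T p Z mp mZ]; first by rewrite /F; case: ifP => // _; rewrite mule_ge0.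
  have mv := measurable_vnorm mZ.
  apply: measurable_fun_ifT => //.
    by apply: measurable_and; exact: measurable_fun_ltr.
  apply: emeasurable_funM.
    by apply: (measurableT_comp mW); exact: measurable_funM.
  by apply: (mG.2 _ _ (fun t => (p t)%:C%C *: Z t)%R); exact: vmeasZ.
pose Fr (r : R) (z : V) : \bar R := if (vnorm2 z < 1)%R then
   W r * G (r%:C%C *: ((vnorm z)^-1%:C%C *: z))%R else 0.
have mFr : jvmeas Fr.
  split => [t z|d T p Z mp mZ]; first by rewrite /Fr; case: ifP => // _; rewrite mule_ge0.
  apply: measurable_fun_ifT => //.
    by apply: measurable_fun_ltr => //; exact: measurable_vnorm2.
  apply: emeasurable_funM; first exact: (measurableT_comp mW).
  apply: (mG.2 _ _ (fun t => (p t)%:C%C *: ((vnorm (Z t))^-1%:C%C *: Z t))%R).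
  by apply: vmeasZ => //; apply: vmeasZ => //; exact: measurable_vnormV.
(* For fixed [z], substitute [r = t |z|], whose Jacobian [1 / |z|] is at most 2. *)
have J1 : \int[leb]_t lebint (F t) <= 2%:E * \int[leb]_r (W r * sphere_avg G r).
  have -> : \int[leb]_r (W r * sphere_avg G r) = \int[leb]_r lebint (Fr r).
    apply: eq_integral => r _; rewrite /sphere_avg -(lebintZ (W0 r) (vfmeas_sphere r mG)).
    by apply: eq_lebint => z; rewrite /Fr; case: ifP => // _; rewrite mule0.
  rewrite !integral_lebint//.
  have mI : vfmeas (fun z => \int[leb]_r Fr r z).
    split => [z|d T Z mZ]; first by apply: integral_ge0 => r _; exact: mFr.1.
    apply: (measurable_fun_fubini_tonelli_F (m2 := leb) (fun w : T * R => Fr w.2 (Z w.1))).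
      apply: (mFr.2 _ _ snd (fun w => Z w.1)) => //.
      exact: (@vmeas_comp _ _ _ _ _ _ Z fst).
    by move=> w; exact: mFr.1.
  have e2 : 0 <= 2%:E :> \bar R by rewrite lee_fin.
  rewrite -(lebintZ e2 mI).
  apply: le_lebint => z; first by apply: integral_ge0 => t _; exact: mF.1.
  have [/andP[h1 h2]|hn] := boolP ((2^-1 < vnorm z)%R && (vnorm z < 1)%R); last first.
    rewrite integral0_eq; last by move=> t _; rewrite /F (negbTE hn).
    by rewrite mule_ge0// integral_ge0// => r _; exact: mFr.1.
  have v0 : (0 < vnorm z)%R by apply: lt_trans h1; rewrite invr_gt0.
  have mFz : measurable_fun setT (fun r => Fr r z).
    by apply: (mFr.2 _ _ id (fun=> z)) => //; exact: vmeas_cst.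
  have E t : F t z = Fr (vnorm z * t + 0)%R z.
    rewrite /F h1 h2 /= /Fr -vnorm_lt1 h2 addr0 (mulrC t); congr (_ * G _).
    rewrite scalerA -rmorphM /=; congr (_%:C%C *: _)%R.
    by field; exact: lt0r_neq0.
  under eq_integral do rewrite E.
  rewrite (@integral_affine _ (vnorm z) 0 (fun r => Fr r z))//; last by move=> r; exact: mFr.1.
  apply: lee_wpmul2r; first by apply: integral_ge0 => r _; exact: mFr.1.
  rewrite lee_fin -[leRHS]invrK lef_pV2 ?posrE ?invr_gt0//; exact: ltW.
pose E (t : R) (z : V) : \bar R :=
  if (0 < t)%R && ((t / 2 < vnorm z)%R && (vnorm z < t)%R) then
    (t `^ (- N.*2%:R))%R%:E * (W (vnorm z) * G z) else 0.
have mE : jvmeas E.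
  split => [t z|d T p Z mp mZ].
    by rewrite /E; case: ifP => // _; rewrite mule_ge0 ?mule_ge0// lee_fin powR_ge0.
  have mv := measurable_vnorm mZ.
  apply: measurable_fun_ifT => //.
    apply: measurable_and; first exact: measurable_fun_ltr.
    apply: measurable_and; last exact: measurable_fun_ltr.
    by apply: measurable_fun_ltr => //; exact: measurable_funM.
  apply: emeasurable_funM.
    by apply: measurable_fun_EFin; exact: (measurableT_comp (@measurable_powR R _) mp).
  apply: emeasurable_funM; last exact: mG.2.
  exact: (measurableT_comp mW).
(* For fixed [t > 0], substitute [t z] for [z], with Jacobian [t^(-2N)]. For [t <= 0] both sides
   vanish, the left one by the support of [W]. *)
have J2 : \int[leb]_t lebint (F t) = \int[leb]_t lebint (E t).
  apply: eq_integral => t _; have [t0|t0] := ltP 0%R t; last first.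
    transitivity (lebint (fun _ : V => 0 : \bar R)); apply: eq_lebint => z.
      rewrite /F Wsupp ?mul0e ?if_same// negb_and -leNgt; apply/orP; left.
      by rewrite mulr_le0_ge0// vnorm_ge0.
    by rewrite /E ltNge t0.
  pose Q (z : V) : \bar R := if (t / 2 < vnorm z)%R && (vnorm z < t)%R then W (vnorm z) * G z else 0.
  have mQ : vfmeas Q.
    split => [z|d T Z mZ]; first by rewrite /Q; case: ifP => // _; rewrite mule_ge0.
    have mv := measurable_vnorm mZ.
    apply: measurable_fun_ifT => //.
      by apply: measurable_and; exact: measurable_fun_ltr.
    apply: emeasurable_funM; last exact: mG.2.
    exact: (measurableT_comp mW).
  transitivity (lebint (fun z => Q (t%:C%C *: z)%R)).
    apply: eq_lebint => z; rewrite /F /Q vnormZ ?(ltW t0)//.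
    by rewrite !(ltr_scale _ t0).
  have tn : 0 <= (t ^- N.*2)%R%:E :> \bar R by rewrite lee_fin invr_ge0 exprn_ge0// ltW.
  rewrite (lebint_scale t0 mQ) -(lebintZ tn mQ).
  apply: eq_lebint => z; rewrite /Q /E t0 /=; case: ifP => _; last by rewrite mule0.
  by rewrite powRN powR_mulrn ?ltW.
have J4 := integral_lebint mE.
(* By [polar_inner], each [z] with [0 < |z| < 1] is seen by enough values of [t]; elsewhere [W]
   vanishes. *)
have J3 : (2 ^- N.*2)%R%:E * lebint (fun z => W (vnorm z) * G z) <= lebint (fun z => \int[leb]_t E t z).
  rewrite -lebintZ; last 2 first.
  - by rewrite lee_fin invr_ge0 exprn_ge0.
  - split => [z|d T Z mZ]; first by rewrite mule_ge0.
    apply: emeasurable_funM; last exact: mG.2.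
    by apply: (measurableT_comp mW); exact: measurable_vnorm.
  apply: le_lebint => z; first by rewrite mule_ge0 ?mule_ge0// lee_fin invr_ge0 exprn_ge0.
  have [/andP[v0 v1]|hn] := boolP ((0 < vnorm z)%R && (vnorm z < 1)%R); last first.
    by rewrite (Wsupp _ hn) mul0e mule0; apply: integral_ge0 => t _; exact: mE.1.
  exact: (polar_inner v0 v1 (mule_ge0 (W0 _) (G0 z))).
have : (2 ^- N.*2)%R%:E * lebint (fun z => W (vnorm z) * G z) <= 2%:E * \int[leb]_r (W r * sphere_avg G r).
  by apply: (le_trans J3); rewrite -J4 -J2.
move=> H; have p0 : 0 <= (2 ^+ N.*2)%R%:E :> \bar R by rewrite lee_fin exprn_ge0.
have := lee_wpmul2l p0 H.
by rewrite mule_exp2K mule_exp2S.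
Qed.

End Polar.

(** * Unitary maps carrying the first basis vector to a given unit vector *)

Section Unitary.
Variable R : realType.
Variable n : nat.
Local Notation C := (R[i]).
Local Notation N := n.+1.
Local Notation V := 'rV[C]_N.

Definition cmeas d (T : measurableType d) (f : T -> C) : Prop :=
  measurable_fun setT (fun t => complex.Re (f t)) /\
  measurable_fun setT (fun t => complex.Im (f t)).

Lemma cmeas_cst d (T : measurableType d) (c : C) : cmeas (fun _ : T => c).
Proof. by split; exact: measurable_cst. Qed.

Lemma ReD (a b : C) : complex.Re (a + b) = complex.Re a + complex.Re b.
Proof. by case: a => ? ?; case: b. Qed.
Lemma ImD (a b : C) : complex.Im (a + b) = complex.Im a + complex.Im b.
Proof. by case: a => ? ?; case: b. Qed.
Lemma ReM (a b : C) : complex.Re (a * b) = complex.Re a * complex.Re b - complex.Im a * complex.Im b.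
Proof. by case: a => ? ?; case: b. Qed.
Lemma ImM (a b : C) : complex.Im (a * b) = complex.Re a * complex.Im b + complex.Im a * complex.Re b.
Proof. by case: a => ? ?; case: b. Qed.

Lemma cmeasD d (T : measurableType d) (f g : T -> C) : cmeas f -> cmeas g -> cmeas (fun t => f t + g t).
Proof.
move=> [f1 f2] [g1 g2]; split.
  by under eq_fun do rewrite ReD; exact: measurable_funD.
by under eq_fun do rewrite ImD; exact: measurable_funD.
Qed.

Lemma cmeasM d (T : measurableType d) (f g : T -> C) : cmeas f -> cmeas g -> cmeas (fun t => f t * g t).
Proof.
move=> [f1 f2] [g1 g2]; split.
  by under eq_fun do rewrite ReM; apply: measurable_funB; exact: measurable_funM.
by under eq_fun do rewrite ImM; apply: measurable_funD; exact: measurable_funM.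
Qed.

Lemma cmeas_sum d (T : measurableType d) I (s : seq I) (f : I -> T -> C) :
  (forall i, cmeas (f i)) -> cmeas (fun t => \sum_(i <- s) f i t).
Proof.
move=> mf; elim: s => [|i s IH].
  by under eq_fun do rewrite big_nil; exact: cmeas_cst.
by under eq_fun do rewrite big_cons; exact: cmeasD.
Qed.

Lemma cinnerDl (z w v : V) : cinner (z + w) v = cinner z v + cinner w v.
Proof. by rewrite /cinner -big_split; apply: eq_bigr => j _; rewrite mxE mulrDl. Qed.

Lemma cinnerZl (c : C) (z v : V) : cinner (c *: z) v = c * cinner z v.
Proof. by rewrite /cinner mulr_sumr; apply: eq_bigr => j _; rewrite mxE mulrA. Qed.

Lemma cinnerC (z w : V) : cinner z w = conjc (cinner w z).
Proof.
rewrite /cinner rmorph_sum; apply: eq_bigr => j _.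
by rewrite rmorphM /= conjcK mulrC.
Qed.

Lemma cinnerDr (z w v : V) : cinner v (z + w) = cinner v z + cinner v w.
Proof. by rewrite cinnerC cinnerDl rmorphD /= -!cinnerC. Qed.

Lemma cinnerZr (c : C) (z v : V) : cinner v (c *: z) = conjc c * cinner v z.
Proof. by rewrite cinnerC cinnerZl rmorphM /= -cinnerC. Qed.

Lemma cinner_self (z : V) : cinner z z = (vnorm2 z)%:C%C.
Proof.
rewrite /cinner /vnorm2 rmorph_sum; apply: eq_bigr => j _.
case: (z ord0 j) => a b; apply/eqP; rewrite eq_complex /cabs2 /=.
by apply/andP; split; apply/eqP; ring.
Qed.

Lemma cinner_delta (z : V) j : cinner z (delta_mx ord0 j) = z ord0 j.
Proof.
rewrite /cinner (bigD1 j)//= mxE !eqxx conjc1 mulr1 big1 ?addr0// => i ij.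
by rewrite mxE (negbTE ij) andbF conjc0 mulr0.
Qed.

Lemma vnorm2_eq0 (z : V) : vnorm2 z = 0 -> z = 0.
Proof.
move=> /eqP; rewrite psumr_eq0 => [/allP h|j _]; last by rewrite addr_ge0 ?sqr_ge0.
apply/rowP => j; rewrite mxE; have := h j; rewrite mem_index_enum => /(_ isT) /=.
rewrite paddr_eq0 ?sqr_ge0// !sqrf_eq0; case: (z ord0 j) => a b /= /andP[/eqP -> /eqP ->].
by [].
Qed.

Lemma vmeas_cinner d (T : measurableType d) (Z : T -> V) (v : V) : vmeas Z ->
  cmeas (fun t => cinner (Z t) v).
Proof. by move=> mZ; apply: cmeas_sum => j; apply: cmeasM; [exact: mZ|exact: cmeas_cst]. Qed.

Lemma conjcM (x y : C) : conjc (x * y) = conjc x * conjc y.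
Proof. exact: rmorphM. Qed.
Lemma conjcN (x : C) : conjc (- x) = - conjc x.
Proof. exact: rmorphN. Qed.

Lemma cinnerNl (z v : V) : cinner (- z) v = - cinner z v.
Proof. by rewrite -scaleN1r cinnerZl mulN1r. Qed.
Lemma cinnerNr (z v : V) : cinner v (- z) = - cinner v z.
Proof. by rewrite cinnerC cinnerNl conjcN -cinnerC. Qed.

(** The reflection in the complex hyperplane orthogonal to [v]; [v = 0] gives the identity. *)
Definition householder (v z : V) : V := z + (- ((2 / vnorm2 v)%:C%C * cinner z v)) *: v.

Lemma householder_cinner (v z w : V) : cinner (householder v z) (householder v w) = cinner z w.
Proof.
rewrite /householder; set t := (2 / vnorm2 v)%:C%C.
have tJ : conjc t = t by rewrite /t conjc_real.
have [v0|v0] := eqVneq v 0; first by rewrite v0 !scaler0 !addr0.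
have n0 : vnorm2 v != 0 by apply: contra v0 => /eqP /vnorm2_eq0 ->.
have tv : t * cinner v v = 2.
  by rewrite cinner_self /t -rmorphM /= divfK// rmorph_nat.
rewrite cinnerDl !cinnerDr !cinnerZl !cinnerZr conjcN conjcM tJ -(cinnerC v w).
move: (cinner z v) (cinner v w) (cinner v v) tv (cinner z w) => x y c tv s.
transitivity (s - t * x * y - t * x * y + (t * c) * (t * x * y)); first by ring.
by rewrite tv; ring.
Qed.

Lemma householderD (v z w : V) : householder v (z + w) = householder v z + householder v w.
Proof. by rewrite /householder cinnerDl mulrDr opprD scalerDl addrACA. Qed.

Lemma householderZ (v : V) (a : C) (z : V) : householder v (a *: z) = a *: householder v z.
Proof. by rewrite /householder cinnerZl scalerDr scalerA mulrN mulrCA. Qed.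

Lemma householderK (v : V) : involutive (householder v).
Proof.
move=> z; rewrite /householder cinnerDl cinnerZl; set t := (2 / vnorm2 v)%:C%C.
have [v0|v0] := eqVneq v 0; first by rewrite v0 !scaler0 !addr0.
have n0 : vnorm2 v != 0 by apply: contra v0 => /eqP /vnorm2_eq0 ->.
have tv : t * cinner v v = 2 by rewrite cinner_self /t -rmorphM /= divfK// rmorph_nat.
rewrite -addrA -scalerDl.
rewrite [X in X *: v](_ : _ = 0) ?scale0r ?addr0//.
move: (cinner z v) (cinner v v) tv => x y tv.
transitivity (- (2 * (t * x)) + (t * y) * (t * x)); first by ring.
by rewrite tv; ring.
Qed.

(* A Householder reflection composed with a unimodular scalar. *)
Lemma unitary_existence (zeta : V) : vnorm2 zeta = 1 -> exists M M' : V -> V,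
  [/\ (forall z w, M (z + w) = M z + M w), (forall (c : C) z, M (c *: z) = c *: M z), cancel M' M &
   (forall z, vnorm2 (M z) = vnorm2 z)] /\
  [/\ (forall d (T : measurableType d) (Z : T -> V), vmeas Z -> vmeas (fun t => M (Z t))),
      M (delta_mx ord0 ord0) = zeta & forall z, cinner (M z) zeta = z ord0 ord0].
Proof.
move=> z1; set e : V := delta_mx ord0 ord0.
have nn (z w : V) : cinner z z = cinner w w -> vnorm2 z = vnorm2 w.
  by rewrite !cinner_self => /(congr1 (@complex.Re R)).
(* [c] is the phase of the first coordinate of [zeta]. Then [conjc c *: zeta] has a real inner
   product with [e], a condition for a reflection to exchange the two. *)
have [c [r [cc [cr r0]]]] : exists c : C, exists r : R, c * conjc c = 1 /\ conjc c * zeta ord0 ord0 = r%:C%C /\ 0 <= r.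
  have [h|h] := eqVneq (zeta ord0 ord0) 0.
    by exists 1, 0; rewrite conjc1 !mul1r h.
  have nz : `|zeta ord0 ord0| != 0 by rewrite normr_eq0.
  have nJ : conjc `|zeta ord0 ord0| = `|zeta ord0 ord0| by rewrite normc_def conjc_real.
  have nM : zeta ord0 ord0 * conjc (zeta ord0 ord0) = `|zeta ord0 ord0| ^+ 2.
    rewrite normc_def -rmorphXn /= sqr_sqrtr ?addr_ge0 ?sqr_ge0//.
    case: (zeta ord0 ord0) => a b; apply/eqP; rewrite eq_complex /=.
    by apply/andP; split; apply/eqP; ring.
  have nVJ : conjc `|zeta ord0 ord0|^-1 = `|zeta ord0 ord0|^-1.
    by rewrite normc_def -fmorphV conjc_real.
  exists (zeta ord0 ord0 / `|zeta ord0 ord0|), (complex.Re `|zeta ord0 ord0|).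
  rewrite conjcM nVJ; split; [|split].
  - rewrite mulrACA -invfM -expr2 nM divff// expf_neq0//.
  - have -> : conjc (zeta ord0 ord0) * `|zeta ord0 ord0|^-1 * zeta ord0 ord0 = `|zeta ord0 ord0|.
      by rewrite mulrAC (mulrC (conjc _)) nM expr2 mulfK.
    by rewrite normc_def /=.
  - by rewrite normc_def /= sqrtr_ge0.
pose z' := conjc c *: zeta.
pose v : V := e - z'.
have ce : cinner e e = 1 by rewrite cinner_delta mxE !eqxx.
have cz : cinner zeta zeta = 1 by rewrite cinner_self z1.
have cze : cinner z' e = r%:C%C by rewrite cinnerZl cinner_delta.
have cez : cinner e z' = r%:C%C by rewrite cinnerC cze conjc_real.
have czz : cinner z' z' = 1.
  by rewrite cinnerZl cinnerZr conjcK cz mulr1 mulrC.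
have vv : cinner v v = (2 - 2 * r)%:C%C.
  rewrite /v cinnerDl !cinnerDr !cinnerNl !cinnerNr ce cez cze czz.
  by rewrite rmorphB rmorphM /= rmorph_nat; ring.
have ev : cinner e v = (1 - r)%:C%C.
  by rewrite /v cinnerDr cinnerNr cez ce rmorphB.
(* [<e, v> = 1 - r] is half of [|v|^2], so the reflection subtracts exactly [v] from [e]. *)
have He : householder v e = z'.
  rewrite /householder; have [v0|v0] := eqVneq v 0.
    by rewrite v0 scaler0 addr0; apply/eqP; rewrite -subr_eq0 -/v v0.
  have n0 : vnorm2 v != 0 by apply: contra v0 => /eqP /vnorm2_eq0 ->.
  have vE : vnorm2 v = 2 - 2 * r by move: vv; rewrite cinner_self => /(congr1 (@complex.Re R)).
  rewrite ev -rmorphM /=.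
  have -> : 2 / vnorm2 v * (1 - r) = 1.
    rewrite vE in n0 *; apply: (mulfI n0); rewrite mulr1 mulrA mulrCA mulfV// mulr1; ring.
  by rewrite scaleN1r /v opprB addrC subrK.
exists (fun z => c *: householder v z), (fun z => householder v (conjc c *: z)).
have hC z w : cinner (c *: householder v z) (c *: householder v w) = cinner z w.
  by rewrite cinnerZl cinnerZr householder_cinner mulrA cc mul1r.
have hD := householderD v; have hZ := householderZ v; have hh := householderK v.
split; split.
- by move=> z w; rewrite hD scalerDr.
- by move=> a z; rewrite hZ !scalerA mulrC.
- by move=> z; rewrite /= hh scalerA cc scale1r.
- by move=> z; apply: nn; exact: hC.
- move=> d T Z mZ j.
  have H : cmeas (fun t => (c *: householder v (Z t)) ord0 j).
    rewrite (_ : (fun _ => _) = (fun t => c * (Z t ord0 j + (- 1) * (((2 / vnorm2 v)%:C%C * cinner (Z t) v)) * v ord0 j))).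
      apply: cmeasM; first exact: cmeas_cst.
      apply: cmeasD; first exact: mZ.
      apply: cmeasM; last exact: cmeas_cst.
      apply: cmeasM; first exact: cmeas_cst.
      by apply: cmeasM; [exact: cmeas_cst|exact: vmeas_cinner].
    by apply/funext => t; rewrite !mxE mulN1r.
  exact: H.
- by rewrite He /z' scalerA cc scale1r.
- move=> z; have <- : c *: householder v e = zeta by rewrite He /z' scalerA cc scale1r.
  by rewrite hC cinner_delta.
Qed.

End Unitary.

(** * Mean value property *)

Section MeanValue.
Variable R : realType.
Local Notation C := (R[i]).

(** The modulus as a real number: the norm of [C] takes its values in [C], while the integrals and
    estimates live in [R]. *)
Definition nc (x : C) : R := Num.sqrt (cabs2 x).

Lemma ncE (x : C) : `|x| = (nc x)%:C%C.
Proof. by rewrite normc_def /nc /cabs2. Qed.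
Lemma cabs2_ge0 (x : C) : 0 <= cabs2 x.
Proof. by rewrite addr_ge0 ?sqr_ge0. Qed.
Lemma nc_ge0 (x : C) : 0 <= nc x. Proof. exact: sqrtr_ge0. Qed.
Lemma nc_sqr (x : C) : nc x ^+ 2 = cabs2 x. Proof. by rewrite sqr_sqrtr ?cabs2_ge0. Qed.
Lemma ncM (x y : C) : nc (x * y) = nc x * nc y.
Proof. by apply: complexI; rewrite rmorphM /= -!ncE normrM. Qed.
Lemma ncD (x y : C) : nc (x + y) <= nc x + nc y.
Proof. by rewrite -lecR rmorphD /= -!ncE ler_normD. Qed.
Lemma ncN (x : C) : nc (- x) = nc x.
Proof. by apply: complexI; rewrite -!ncE normrN. Qed.
Lemma ncB (x y : C) : nc (x - y) <= nc x + nc y.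
Proof. by rewrite -(ncN y) ncD. Qed.
Lemma ncV (x : C) : nc x^-1 = (nc x)^-1.
Proof. by apply: complexI; rewrite fmorphV /= -!ncE normfV. Qed.
Lemma ncX (x : C) k : nc (x ^+ k) = nc x ^+ k.
Proof. by apply: complexI; rewrite rmorphXn /= -!ncE normrX. Qed.
Lemma nc_real (r : R) : nc r%:C%C = `|r|.
Proof. by rewrite /nc /cabs2 /= expr0n addr0 sqrtr_sqr. Qed.
Lemma nc0 : nc 0 = 0. Proof. by rewrite (nc_real 0) normr0. Qed.
Lemma nc1 : nc 1 = 1. Proof. by rewrite (nc_real 1) normr1. Qed.
Lemma nc_eq0 (x : C) : (nc x == 0) = (x == 0).
Proof. by rewrite -(inj_eq (@complexI R)) -ncE normr_eq0. Qed.
Lemma Re_le_nc (x : C) : `|complex.Re x| <= nc x.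
Proof. by rewrite -sqrtr_sqr ler_wsqrtr// /cabs2 lerDl sqr_ge0. Qed.
Lemma Im_le_nc (x : C) : `|complex.Im x| <= nc x.
Proof. by rewrite -sqrtr_sqr ler_wsqrtr// /cabs2 lerDr sqr_ge0. Qed.
Lemma cabs2M (x y : C) : cabs2 (x * y) = cabs2 x * cabs2 y.
Proof. by rewrite -!nc_sqr ncM exprMn. Qed.
Lemma ncI (e : R) : nc (0 +i* e)%C = `|e|.
Proof. by rewrite /nc /cabs2 /= expr0n add0r sqrtr_sqr. Qed.

Lemma norm_diff2_le (k x1 x2 y1 y2 t : R) : `|x1 - x2 - (y1 - y2)| <= t ->
  x1 + k + (y2 + k) <= x2 + k + (y1 + k) + t /\ x2 + k + (y1 + k) <= x1 + k + (y2 + k) + t.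
Proof. by rewrite ler_norml => /andP[h1 h2]; split; lra. Qed.

(** The interval [[0, a]] costs [K a], and cutting [[a, 1]] into [n] equal pieces costs at most
    [n * K / (n^2 a)]. Choosing [a] first and then [n] makes both small. *)
Lemma const_of_quadratic (p : R -> R) (K : R) : 0 <= K ->
  (forall a b, 0 < a -> a < b -> b <= 1 -> `|p b - p a| <= K * (b - a) ^+ 2 / a) ->
  (forall a, 0 < a -> a <= 1 -> `|p a - p 0| <= K * a) -> p 1 = p 0.
Proof.
move=> K0 h1 h2; apply/eqP; rewrite -subr_eq0 -normr_le0.
apply/ler_addgt0Pl => e e0; rewrite addr0.
pose a := Num.min (1 / 2) (e / (2 * (K + 1))).
have K1 : 0 < K + 1 by rewrite ltr_wpDl.
have a0 : 0 < a by rewrite lt_min divr_gt0//= divr_gt0// mulr_gt0.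
have a1 : a < 1 by rewrite gt_min; apply/orP; left; lra.
have Ka : K * a <= e / 2.
  apply: (@le_trans _ _ (K * (e / (2 * (K + 1))))); first by rewrite ler_wpM2l// ge_min lexx orbT.
  rewrite mulrA ler_pdivrMr ?mulr_gt0//; have := mulr_ge0 K0 (ltW e0); nra.
pose n := (Num.trunc (2 * K / (a * e))).+1.
have n0 : 0 < n%:R :> R by [].
have hn : K / (n%:R * a) <= e / 2.
  have := truncnS_gt (2 * K / (a * e)); rewrite -/n ltr_pdivrMr ?mulr_gt0// => H.
  rewrite ler_pdivrMr ?mulr_gt0//; nra.
pose s (k : nat) := a + (1 - a) * (k%:R / n%:R).
have sn : s n = 1 by rewrite /s divff ?gt_eqF// mulr1; ring.
have s0 : s 0%N = a by rewrite /s mul0r mulr0 addr0.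
have sd k : s k.+1 - s k = (1 - a) / n%:R.
  by rewrite /s -(natr1 k); field; rewrite gt_eqF.
have st : p 1 - p a = \sum_(0 <= k < n) (p (s k.+1) - p (s k)).
  by rewrite telescope_sumr// sn s0.
have st2 : `|p 1 - p a| <= e / 2.
  rewrite st; apply: le_trans (ler_norm_sum _ _ _) _.
  apply: (@le_trans _ _ (\sum_(0 <= k < n) (K / (n%:R ^+ 2 * a)))).
    rewrite big_nat [leRHS]big_nat; apply: ler_sum => k /= kn.
    have ask : a <= s k by rewrite /s lerDl mulr_ge0 ?subr_ge0 ?(ltW a1)// divr_ge0.
    have sk0 : 0 < s k by apply: lt_le_trans ask.
    have skl : s k < s k.+1.
      by rewrite -subr_gt0 sd divr_gt0// subr_gt0.
    have sk1 : s k.+1 <= 1.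
      rewrite -sn /s lerD2l ler_wpM2l ?subr_ge0 ?(ltW a1)//.
      by rewrite ler_wpM2r ?invr_ge0 ?ler_nat// ltW.
    apply: le_trans (h1 _ _ sk0 skl sk1) _.
    rewrite sd -mulrA ler_wpM2l//.
    rewrite invfM; apply: ler_pM; rewrite ?invr_ge0 ?sqr_ge0 ?(ltW sk0)//.
      rewrite expr_div_n ler_pdivrMr ?exprn_gt0// mulVf ?expf_neq0 ?gt_eqF//.
      by rewrite expr_le1// ?subr_ge0 ?(ltW a1)//; lra.
    by rewrite lef_pV2 ?posrE.
  rewrite sumr_const_nat subn0 -[X in X <= _]mulr_natr.
  apply: le_trans hn; rewrite le_eqVlt; apply/orP; left; apply/eqP.
  by field; rewrite !gt_eqF.
have -> : p 1 - p 0 = (p 1 - p a) + (p a - p 0) by ring.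
apply: le_trans (ler_normD _ _) _.
rewrite [e in X in _ <= X](splitr e); apply: lerD => //.
by apply: le_trans Ka; apply: h2 => //; exact: ltW.
Qed.

(** * Real-valued integrals over the ball and the mean value property *)

Variable n : nat.
Local Notation N := n.+1.
Local Notation V := 'rV[C]_N.

Definition bint (f : V -> R) : \bar R :=
  lebint (fun z => if vnorm2 z < 1 then (f z)%:E else 0%E).

Definition rmeas (f : V -> R) : Prop := forall d (T : measurableType d) (Z : T -> V),
  vmeas Z -> measurable_fun setT (fun t => f (Z t)).

Definition bpos (B : R) (f : V -> R) : Prop :=
  rmeas f /\ forall z, vnorm2 z < 1 -> 0 <= f z <= B.

Lemma bpos_vfmeas B f : bpos B f -> vfmeas (fun z => if vnorm2 z < 1 then (f z)%:E else 0%E).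
Proof.
move=> [mf fB]; split => [z|d T Z mZ].
  by case: ifP => // /fB /andP[f0 _]; rewrite lee_fin.
apply: measurable_fun_ifT => //.
  by apply: measurable_fun_ltr => //; exact: measurable_vnorm2.
by apply: measurable_fun_EFin; exact: mf.
Qed.

Definition bvol : R := fine (lebint (@bball_ind R n)).

Lemma bvolE : lebint (@bball_ind R n) = bvol%:E.
Proof. by rewrite fineK// ge0_fin_numE ?bball_vol_lty// ltW// bball_vol_gt0. Qed.

Lemma bvol_gt0 : 0 < bvol.
Proof. by rewrite -lte_fin -bvolE bball_vol_gt0. Qed.

Global Opaque bvol.

Lemma bint_cst (c : R) : 0 <= c -> bint (fun=> c) = (c * bvol)%:E.
Proof.
move=> c0; rewrite /bint EFinM -bvolE -(@lebintZ _ _ c%:E _ _ (@vfmeas_bball R n)); last by rewrite lee_fin.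
by apply: eq_lebint => z; rewrite /bball_ind; case: ifP; rewrite ?mule1 ?mule0.
Qed.

Lemma bint_ge0 B f : bpos B f -> (0 <= bint f)%E.
Proof. by move=> h; apply: lebint_ge0; exact: (bpos_vfmeas h).1. Qed.

Lemma bint_fin B f : bpos B f -> bint f = (fine (bint f))%:E.
Proof.
move=> h; rewrite fineK// ge0_fin_numE; last exact: bint_ge0 h.
have B0 : 0 <= Num.max 0 B by rewrite le_max lexx.
apply: (@le_lt_trans _ _ (bint (fun=> Num.max 0 B))); last by rewrite bint_cst// ltry.
apply: le_lebint => z; first exact: (bpos_vfmeas h).1.
by case: ifP => // /h.2 /andP[_ fB]; rewrite lee_fin le_max fB orbT.
Qed.

Definition rint (f : V -> R) : R := fine (bint f).

Lemma bint_rint B f : bpos B f -> bint f = (rint f)%:E.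
Proof. exact: bint_fin. Qed.

Lemma le_of_lee5 (a b a' b' c : R) (A B A' B' D : \bar R) :
  A = a%:E -> B = b%:E -> A' = a'%:E -> B' = b'%:E -> D = c%:E ->
  (A + B <= A' + B' + D)%E -> a + b <= a' + b' + c.
Proof. by move=> -> -> -> -> ->; rewrite -!EFinD lee_fin. Qed.

(** Additivity of the integral is at hand for nonnegative integrands, so a comparison of differences
    is phrased with sums of two functions on each side. *)
Lemma rint_le4 B (f g f' g' : V -> R) (c : R) : 0 <= c ->
  bpos B f -> bpos B g -> bpos B f' -> bpos B g' ->
  (forall z, vnorm2 z < 1 -> f z + g z <= f' z + g' z + c) ->
  rint f + rint g <= rint f' + rint g' + c * bvol.
Proof.
move=> c0 hf hg hf' hg' H.
apply: (le_of_lee5 (bint_rint hf) (bint_rint hg) (bint_rint hf') (bint_rint hg') (bint_cst c0)).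
have hc : bpos c (fun=> c).
  by split=> [d T Z _|z _]; [exact: measurable_cst|rewrite c0 lexx].
have mf := bpos_vfmeas hf; have mg := bpos_vfmeas hg.
have mf' := bpos_vfmeas hf'; have mg' := bpos_vfmeas hg'; have mc := bpos_vfmeas hc.
rewrite /bint -(lebintD mf mg) -(lebintD mf' mg') -(lebintD (vfmeasD mf' mg') mc).
apply: le_lebint => z; first by apply: adde_ge0; [exact: mf.1|exact: mg.1].
by case: ifP => hz; [rewrite -!EFinD lee_fin; exact: H|rewrite !adde0].
Qed.

Lemma rint_eq (f g : V -> R) : (forall z, vnorm2 z < 1 -> f z = g z) -> rint f = rint g.
Proof.
move=> h; rewrite /rint /bint; congr (fine _); apply: eq_lebint => z.
by case: ifP => // /h ->.
Qed.

Lemma bpos0 B : 0 <= B -> bpos B (fun=> 0).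
Proof. by move=> B0; split=> [d T Z _|z _]; [exact: measurable_cst|rewrite lexx B0]. Qed.

Lemma rint0 : rint (fun=> 0) = 0.
Proof. by rewrite /rint bint_cst// mul0r. Qed.

Lemma vnorm2_lt1_0 : vnorm2 (0 : V) < 1.
Proof. by rewrite /vnorm2 big1// => j _; rewrite mxE /cabs2 /= expr0n addr0. Qed.

Lemma rint_dist B (f g : V -> R) (c : R) : 0 <= c -> bpos B f -> bpos B g ->
  (forall z, vnorm2 z < 1 -> `|f z - g z| <= c) -> `|rint f - rint g| <= c * bvol.
Proof.
move=> c0 hf hg H.
have B0 : 0 <= B by have /andP[h1 h2] := hf.2 0 vnorm2_lt1_0; exact: le_trans h2.
have z0 := bpos0 B0; have r0 := rint0.
have A := rint_le4 c0 hf z0 hg z0.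
have A' := rint_le4 c0 hg z0 hf z0.
move: A A' r0.
move: (rint f) (rint g) (rint (fun=> 0)) (c * bvol) => x y w t A A' r0; subst w.
have {}A : x + 0 <= y + 0 + t.
  apply: A => z /H; move: (f z) (g z) => u v.
  by clear; rewrite ler_norml => /andP[h1 h2]; lra.
have {}A' : y + 0 <= x + 0 + t.
  apply: A' => z /H; move: (f z) (g z) => u v.
  by clear; rewrite ler_norml => /andP[h1 h2]; lra.
by rewrite ler_norml; apply/andP; split; lra.
Qed.

Lemma vmeasZc d (T : measurableType d) (l : C) (Z : T -> V) : vmeas Z -> vmeas (fun t => l *: Z t).
Proof.
move=> mZ j; have H : cmeas (fun t => (l *: Z t) ord0 j); last exact: H.
rewrite (_ : (fun _ => _) = (fun t => l * Z t ord0 j)); last by apply/funext => t; rewrite mxE.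
by apply: cmeasM; [exact: cmeas_cst|exact: mZ].
Qed.

Lemma vnorm2Zc (l : C) (z : V) : vnorm2 (l *: z) = cabs2 l * vnorm2 z.
Proof. by rewrite /vnorm2 mulr_sumr; apply: eq_bigr => j _; rewrite mxE cabs2M. Qed.

Lemma rint_rotate B (f : V -> R) (u : C) : bpos B f -> nc u = 1 ->
  rint (fun z => f (u *: z)) = rint f.
Proof.
move=> hf u1; rewrite /rint /bint; congr (fine _).
have c1 : cabs2 u = 1 by rewrite -nc_sqr u1 expr1n.
have u0 : u != 0 by rewrite -nc_eq0 u1 oner_eq0.
have vn (z : V) : vnorm2 (u *: z) = vnorm2 z by have := vnorm2Zc u z; rewrite c1 mul1r.
have hK : cancel (fun z : V => u^-1 *: z) (fun z : V => u *: z).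
  by move=> z; rewrite scalerA mulfV// scale1r.
have <- := @lebint_isometry R n (fun z => u *: z) (fun z => u^-1 *: z) _ (scalerDr u) hK vn
  (fun d T Z mZ => @vmeasZc d T u Z mZ) (bpos_vfmeas hf).
by apply: eq_lebint => z; rewrite vn.
Qed.

Lemma rint_cst (c : R) : 0 <= c -> rint (fun=> c) = c * bvol.
Proof. by move=> c0; rewrite /rint bint_cst. Qed.

Global Opaque rint bint.

(* Holomorphy is used only through uniform first- and second-order expansions on the complex
   slices [l |-> F (l z)]. *)
Definition CRball (F : V -> C) (K : R) : Prop :=
  (forall d (T : measurableType d) (Z : T -> V), vmeas Z -> cmeas (fun t => F (Z t))) /\
  forall z, vnorm2 z < 1 ->
   [/\ (forall l, nc l <= 1 -> nc (F (l *: z)) <= K),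
      (forall l m, nc l <= 1 -> nc m <= 1 -> nc (F (m *: z) - F (l *: z)) <= K * nc (m - l)) &
      (forall l, nc l <= 1 -> exists q, forall m, nc m <= 1 ->
         nc (F (m *: z) - F (l *: z) - q * (m - l)) <= K * nc (m - l) ^+ 2)].

Section Mean.
Variables (F : V -> C) (K : R).
Hypothesis HF : CRball F K.

Lemma CRball_ge0 : 0 <= K.
Proof.
have [h _ _] := HF.2 0 vnorm2_lt1_0.
by apply: le_trans (h 0 _); [exact: nc_ge0|rewrite nc0 ler01].
Qed.

(** Adding [K], a bound for the modulus, makes the integrand nonnegative. *)
Lemma CRball_bposRe (l : C) : nc l <= 1 -> bpos (K + K) (fun z => complex.Re (F (l *: z)) + K).
Proof.
move=> l1; split=> [d T Z mZ|z z1].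
  by apply: measurable_funD => //; apply: (HF.1 _ _ _ (vmeasZc l mZ)).1.
have [h _ _] := HF.2 z z1; have := le_trans (Re_le_nc _) (h l l1).
by rewrite ler_norml => /andP[h1 h2]; apply/andP; split; lra.
Qed.

Lemma CRball_bposIm (l : C) : nc l <= 1 -> bpos (K + K) (fun z => complex.Im (F (l *: z)) + K).
Proof.
move=> l1; split=> [d T Z mZ|z z1].
  by apply: measurable_funD => //; apply: (HF.1 _ _ _ (vmeasZc l mZ)).2.
have [h _ _] := HF.2 z z1; have := le_trans (Im_le_nc _) (h l l1).
by rewrite ler_norml => /andP[h1 h2]; apply/andP; split; lra.
Qed.

Let p (a : R) := rint (fun z => complex.Re (F (a%:C%C *: z)) + K).
Let q (l : C) := rint (fun z => complex.Im (F (l *: z)) + K).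

(** [l = u |l|] with [|u| = 1], and multiplication by [u] preserves the ball and its measure. *)
Lemma CRball_q_rotate (l : C) : nc l <= 1 -> q l = q (nc l)%:C%C.
Proof.
move=> l1; have [l0|l0] := eqVneq l 0; first by rewrite l0 nc0.
have nl0 : nc l != 0 by rewrite nc_eq0.
have nl1 : nc ((nc l)%:C%C) <= 1 by rewrite nc_real ger0_norm ?nc_ge0.
have u1 : nc (l / (nc l)%:C%C) = 1 by rewrite ncM ncV nc_real ger0_norm ?nc_ge0// divff.
rewrite /q -[RHS](rint_rotate (CRball_bposIm nl1) u1).
apply: rint_eq => z _; rewrite scalerA (mulrC (nc l)%:C%C) divfK//.
by apply: contra nl0 => /eqP/complexI ->.
Qed.

Lemma CRball_q_lip (a b : R) : 0 <= a -> a <= b -> b <= 1 -> `|q b%:C%C - q a%:C%C| <= K * (b - a) * bvol.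
Proof.
move=> a0 ab b1.
have na : nc a%:C%C <= 1 by rewrite nc_real ger0_norm//; lra.
have nb : nc b%:C%C <= 1 by rewrite nc_real ger0_norm//; lra.
have K0 := CRball_ge0.
have c0 : 0 <= K * (b - a) by rewrite mulr_ge0// subr_ge0.
have key z : vnorm2 z < 1 -> `|complex.Im (F (b%:C%C *: z)) - complex.Im (F (a%:C%C *: z))| <= K * (b - a).
  move=> z1; have [_ h _] := HF.2 z z1.
  have -> : complex.Im (F (b%:C%C *: z)) - complex.Im (F (a%:C%C *: z)) = complex.Im (F (b%:C%C *: z) - F (a%:C%C *: z)).
    by case: (F _) => ? ?; case: (F _).
  apply: le_trans (Im_le_nc _) _; apply: le_trans (h _ _ na nb) _.
  by rewrite -rmorphB /= nc_real ger0_norm// subr_ge0.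
apply: rint_dist c0 (CRball_bposIm nb) (CRball_bposIm na) _ => z z1.
by rewrite opprD addrACA subrr addr0; exact: key.
Qed.

Lemma CRball_p_lip0 (a : R) : 0 < a -> a <= 1 -> `|p a - p 0| <= K * bvol * a.
Proof.
move=> a0 a1.
have na : nc a%:C%C <= 1 by rewrite nc_real ger0_norm//; lra.
have nb : nc (0 : R)%:C%C <= 1 by rewrite nc_real normr0.
have K0 := CRball_ge0.
have c0 : 0 <= K * a by rewrite mulr_ge0// ltW.
have key z : vnorm2 z < 1 -> `|complex.Re (F (a%:C%C *: z)) - complex.Re (F ((0 : R)%:C%C *: z))| <= K * a.
  move=> z1; have [_ h _] := HF.2 z z1.
  have -> (x y : C) : complex.Re x - complex.Re y = complex.Re (x - y) by case: x => ? ?; case: y.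
  apply: le_trans (Re_le_nc _) _; apply: le_trans (h _ _ nb na) _.
  by rewrite -rmorphB /= nc_real subr0 ger0_norm// ltW.
rewrite mulrAC.
apply: rint_dist c0 (CRball_bposRe na) (CRball_bposRe nb) _ => z z1.
by rewrite opprD addrACA subrr addr0; exact: key.
Qed.

(* The Cauchy-Riemann relation transfers a radial increment of the real part to a
   tangential increment of the imaginary part, which integrates to almost zero. *)
Lemma CRball_p_quad (a b : R) : 0 < a -> a < b -> b <= 1 ->
  `|p b - p a| <= 3 * K * bvol * (b - a) ^+ 2 / a.
Proof.
move=> a0 ab b1; set e := b - a.
have e0 : 0 < e by rewrite subr_gt0.
have K0 := CRball_ge0; have v0 := bvol_gt0.
pose l : C := (a +i* e)%C.
have l2 : cabs2 l = a ^+ 2 + e ^+ 2 by [].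
have lb : nc l <= b.
  rewrite -(@ler_sqr _ (nc l)) ?nnegrE ?nc_ge0//; last lra.
  by rewrite nc_sqr l2 /e; nra.
have l1 : nc l <= 1 by exact: le_trans b1.
have al : a <= nc l.
  by rewrite -(@ler_sqr _ a) ?nnegrE ?nc_ge0 ?(ltW a0)// nc_sqr l2 lerDl sqr_ge0.
have na : nc a%:C%C <= 1 by rewrite nc_real ger0_norm//; lra.
have nb : nc b%:C%C <= 1 by rewrite nc_real ger0_norm//; lra.
have c0 : 0 <= 2 * K * e ^+ 2 by apply: mulr_ge0; [exact: mulr_ge0|exact: sqr_ge0].
(* With [s] the derivative at [a], the step [e] to [b] changes the real part by [Re s * e], and the
   step [i e] to [l] changes the imaginary part by [Im (i e s) = Re s * e]: the two agree up to
   second order. *)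
have key z : vnorm2 z < 1 -> `|complex.Re (F (b%:C%C *: z)) - complex.Re (F (a%:C%C *: z))
    - (complex.Im (F (l *: z)) - complex.Im (F (a%:C%C *: z)))| <= 2 * K * e ^+ 2.
  move=> z1; have [_ _ h] := HF.2 z z1; have [s hs] := h _ na.
  have h1 := hs _ nb; have h2 := hs _ l1.
  have eb : b%:C%C - a%:C%C = e%:C%C :> C by rewrite -rmorphB.
  have el : l - a%:C%C = (0 +i* e)%C.
    by apply/eqP; rewrite eq_complex /= subrr subr0 !eqxx.
  rewrite eb nc_real ger0_norm ?(ltW e0)// in h1.
  rewrite el ncI ger0_norm ?(ltW e0)// in h2.
  have h1' := le_trans (Re_le_nc _) h1; have h2' := le_trans (Im_le_nc _) h2.
  move: h1' h2'; case: (F (b%:C%C *: z)) => x1 y1; case: (F (a%:C%C *: z)) => x2 y2.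
  case: (F (l *: z)) => x3 y3; case: (s) => s1 s2 /=.
  rewrite !mulr0 subr0 addr0 => h1' h2'.
  have -> : x1 - x2 - (y3 - y2) = (x1 - x2 - s1 * e) - (y3 - y2 - s1 * e) by ring.
  by apply: le_trans (ler_normB _ _) _; lra.
have A := rint_le4 c0 (CRball_bposRe nb) (CRball_bposIm na) (CRball_bposRe na) (CRball_bposIm l1).
have B := rint_le4 c0 (CRball_bposRe na) (CRball_bposIm l1) (CRball_bposRe nb) (CRball_bposIm na).
have {A}A : p b + q a%:C%C <= p a + q l + 2 * K * e ^+ 2 * bvol.
  by apply: A => z z1; exact: (norm_diff2_le K (key z z1)).1.
have {B}B : p a + q l <= p b + q a%:C%C + 2 * K * e ^+ 2 * bvol.
  by apply: B => z z1; exact: (norm_diff2_le K (key z z1)).2.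
(* [q l = q |l|] by rotation, and [|l| - a <= e^2 / a] since [|l|^2 = a^2 + e^2]; the Lipschitz
   bound then makes the change of [q] quadratic in [e]. *)
clear key; have Q := CRball_q_lip (ltW a0) al l1; rewrite -CRball_q_rotate// in Q.
have dl : nc l - a <= e ^+ 2 / a.
  rewrite ler_pdivlMr// mulrBl lerBlDr.
  by rewrite -expr2 addrC -l2 -nc_sqr expr2 ler_wpM2l ?nc_ge0.
have dQ : K * (nc l - a) * bvol <= K * bvol * (e ^+ 2 / a).
  by rewrite mulrAC; apply: ler_wpM2l => //; rewrite mulr_ge0// ltW.
have d2 : 2 * K * e ^+ 2 * bvol <= 2 * (K * bvol * (e ^+ 2 / a)).
  have -> : 2 * K * e ^+ 2 * bvol = 2 * (K * bvol * e ^+ 2) by ring.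
  rewrite ler_wpM2l// ler_wpM2l ?mulr_ge0 ?(ltW v0)//.
  by rewrite ler_pdivlMr// ler_piMr ?sqr_ge0// (le_trans (ltW ab) b1).
have -> : 3 * K * bvol * e ^+ 2 / a = 3 * (K * bvol * (e ^+ 2 / a)) by ring.
move: A B Q dQ d2; clear; move: (p b) (p a) (q _) (q _) => x1 x2 y1 y2.
move: (K * bvol * _) (_ * bvol) (_ * bvol) => r s t; rewrite !ler_norml => A B /andP[Q1 Q2] h1 h2.
by apply/andP; split; lra.
Qed.

(** The radial means [p] have quadratic increments, hence [p 1 = p 0], and at radius 0 the integrand
    is constant. *)
Lemma CRball_mean : rint (fun z => complex.Re (F z) + K) = (complex.Re (F 0) + K) * bvol.
Proof.
have K0 := CRball_ge0; have v0 := bvol_gt0.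
have E : p 1 = p 0.
  apply: (@const_of_quadratic p (3 * K * bvol)); first by rewrite !mulr_ge0// ltW.
    exact: CRball_p_quad.
  move=> a a0 a1; apply: le_trans (CRball_p_lip0 a0 a1) _.
  by rewrite ler_wpM2r ?(ltW a0)// ler_wpM2r ?(ltW v0)//; lra.
have -> : rint (fun z => complex.Re (F z) + K) = p 1.
  by apply: rint_eq => z _; rewrite scale1r.
rewrite E; have -> : p 0 = rint (fun=> complex.Re (F 0) + K).
  by apply: rint_eq => z _; rewrite scale0r.
have n0 : nc (0 : C) <= 1 by rewrite nc0.
have [h _ _] := HF.2 0 vnorm2_lt1_0.
have := le_trans (Re_le_nc _) (h 0 n0); rewrite scale0r ler_norml => /andP[h1 h2].
by apply: rint_cst; rewrite -lerBlDr sub0r.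
Qed.

End Mean.

Lemma CRballZ (F : V -> C) (K : R) (w : C) : CRball F K -> CRball (fun z => w * F z) (nc w * K).
Proof.
move=> [mF HF]; split=> [d T Z mZ|z z1].
  by apply: cmeasM; [exact: cmeas_cst|exact: mF].
have [h1 h2 h3] := HF z z1; split.
- by move=> l l1; rewrite ncM ler_wpM2l ?nc_ge0//; exact: h1.
- by move=> l m l1 m1; rewrite -mulrBr ncM -mulrA ler_wpM2l ?nc_ge0//; exact: h2.
- move=> l l1; have [q hq] := h3 l l1; exists (w * q) => m m1.
  have -> : w * F (m *: z) - w * F (l *: z) - w * q * (m - l) = w * (F (m *: z) - F (l *: z) - q * (m - l)) by ring.
  by rewrite ncM -mulrA ler_wpM2l ?nc_ge0//; exact: hq.
Qed.

(** The mean value property is applied to [conjc (F 0) * F], whose real part has mean [|F 0|^2] and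
    is at most half of [|F|^2 + |F 0|^2]. *)
Lemma submean_ball (F : V -> C) (K : R) : CRball F K ->
  ((cabs2 (F 0) * bvol)%:E <= bint (fun z => cabs2 (F z)))%E.
Proof.
move=> HF; set w := conjc (F 0).
have HG := CRballZ w HF; have K0 := CRball_ge0 HF; have K1 := CRball_ge0 HG.
have M := CRball_mean HG.
set K' := nc w * K in K1 M HG.
have n1 : nc (1 : C) <= 1 by rewrite nc1.
have bF : bpos (K ^+ 2) (fun z => cabs2 (F z)).
  split=> [d T Z mZ|z z1]; first by have [m1 m2] := HF.1 _ _ _ mZ; exact: measurable_cabs2.
  have [h _ _] := HF.2 z z1; have := h 1 n1; rewrite scale1r => hK.
  by rewrite cabs2_ge0 -nc_sqr ler_sqr ?nnegrE ?nc_ge0.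
have bG : bpos (K' + K') (fun z => complex.Re (w * F z) + K').
  have [m b] := CRball_bposRe HG n1; split=> [d T Z mZ|z z1].
    by have [m1 m2] := HG.1 _ _ _ mZ; apply: measurable_funD.
  by have := b z z1; rewrite scale1r.
pose B := Num.max (K ^+ 2) (K' + K').
have bB f b : bpos b f -> b <= B -> bpos B f.
  by move=> [mf hf] bB; split=> // z /hf /andP[-> h]; exact: le_trans bB.
have bF' := bB _ _ bF _; have bG' := bB _ _ bG _.
have {}bF' : bpos B (fun z => cabs2 (F z)) by apply: bF'; rewrite le_max lexx.
have {}bG' : bpos B (fun z => complex.Re (w * F z) + K') by apply: bG'; rewrite le_max lexx orbT.
have b0 : bpos B (fun=> 0) by apply: bpos0; rewrite le_max sqr_ge0.
have c0 : 0 <= cabs2 (F 0) + (K' + K') by rewrite addr_ge0 ?cabs2_ge0// addr_ge0.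
have H := rint_le4 c0 bG' bG' bF' b0.
have w0 : complex.Re (w * F 0) = cabs2 (F 0).
  by rewrite /w; case: (F 0) => a b; rewrite /cabs2 /=; ring.
rewrite (bint_rint bF) lee_fin.
move: H; rewrite M w0 rint0 => H.
rewrite [X in _ <= X + _]addr0 in H.
have {}H : (cabs2 (F 0) + K') * bvol + (cabs2 (F 0) + K') * bvol <=
   rint (fun z => cabs2 (F z)) + (cabs2 (F 0) + (K' + K')) * bvol.
  apply: H => z z1; rewrite addr0 /w; case: (F 0) => a b; case: (F z) => x y; rewrite /cabs2 /=.
  have h1 := sqr_ge0 (a - x); have h2 := sqr_ge0 (b - y).
  by rewrite !sqrrB in h1 h2; lra.
move: H; rewrite !mulrDl.
move: (rint _) (_ * bvol) (K' * bvol) => x y w1; lra.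
Qed.

End MeanValue.

(** * Norms of the test functions *)

Section KernelBound.
Variable R : realType.
Variable n : nat.
Local Notation C := (R[i]).
Local Notation N := n.+1.
Local Notation V := 'rV[C]_N.
Local Notation leb := (@lebesgue_measure R).

(** For [s >= 1/2] the factor [s] in [s b] costs at most 4; for [s < 1/2] the term
    [(1 - s)^2 >= 1/4] absorbs [y^2 <= 1]. *)
Lemma kernel_im_bound (s a b y : R) : 0 <= s -> s < 1 -> a ^+ 2 + b ^+ 2 <= 1 -> y ^+ 2 <= b ^+ 2 ->
  (1 - s) ^+ 2 + y ^+ 2 <= 8 * ((1 - s * a) ^+ 2 + (s * b) ^+ 2).
Proof.
move=> s0 s1 ab yb.
have a1 : a <= 1 by have := sqr_ge0 b; have := sqr_ge0 (a - 1); rewrite sqrrB; nra.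
have u : (1 - s) ^+ 2 <= (1 - s * a) ^+ 2 by rewrite ler_sqr ?nnegrE; nra.
have b1 : b ^+ 2 <= 1 by have := sqr_ge0 a; lra.
have [s2|s2] := leP (1 / 2) s.
  have : b ^+ 2 <= 4 * (s * b) ^+ 2.
    by rewrite exprMn mulrA ler_peMl ?sqr_ge0//; nra.
  have := sqr_ge0 (1 - s); have := sqr_ge0 y; lra.
have : 1 <= 4 * (1 - s) ^+ 2 by nra.
have := sqr_ge0 (s * b); lra.
Qed.

(** [1 - a^2 <= 2 (1 - s a)] and [1 - s <= 1 - s a], so each factor on the left is at most
    [3 (1 - s a)]. *)
Lemma kernel_re_bound (s a b x y : R) : 0 <= s -> s < 1 -> a ^+ 2 + b ^+ 2 <= 1 ->
  x ^+ 2 + y ^+ 2 <= 1 - a ^+ 2 ->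
  ((1 - s) + x ^+ 2) * ((1 - s) + y ^+ 2) <= 9 * ((1 - s * a) ^+ 2 + (s * b) ^+ 2).
Proof.
move=> s0 s1 ab xy.
have a1 : a <= 1 by have := sqr_ge0 b; have := sqr_ge0 (a - 1); rewrite sqrrB; nra.
have u : 1 - s <= 1 - s * a by nra.
have u2 : 1 - a ^+ 2 <= 2 * (1 - s * a).
  have [a0|a0] := leP 0 a; last by have := sqr_ge0 a; nra.
  by have := sqr_ge0 (a - 1); nra.
have x0 := sqr_ge0 x; have y0 := sqr_ge0 y.
apply: (@le_trans _ _ (9 * (1 - s * a) ^+ 2)); last by have := sqr_ge0 (s * b); lra.
have -> : 9 * (1 - s * a) ^+ 2 = (3 * (1 - s * a)) * (3 * (1 - s * a)) by ring.
by apply: ler_pM; lra.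
Qed.

(** Up to its constant factor, the squared modulus of a test function on a sphere, once [zeta] has
    been rotated to the first basis vector. *)
Definition kern (s : R) (p : nat) (z : V) : R :=
  (cabs2 (1 - s%:C%C * ((vnorm z)^-1%:C%C * z ord0 ord0))) ^- p.

(** [a] and [b] belong to [z / |z|], whereas the integration variables are the coordinates of [z].
    Dividing by [|z| < 1] only enlarges, so the latter can stand in for the former in lower bounds
    of the kernel's denominator. *)
Lemma kern_facts (z : V) : vnorm2 z < 1 ->
  let i := (vnorm z)^-1 in let a := i * complex.Re (z ord0 ord0) in let b := i * complex.Im (z ord0 ord0) in
  [/\ a ^+ 2 + b ^+ 2 <= 1, complex.Im (z ord0 ord0) ^+ 2 <= b ^+ 2,
     -1 <= complex.Re (z ord0 ord0) <= 1 &
     forall j : 'I_n, complex.Re (z ord0 (lift ord0 j)) ^+ 2 + complex.Im (z ord0 (lift ord0 j)) ^+ 2 <= 1 - a ^+ 2].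
Proof.
move=> z1 i a b; set x := complex.Re _; set y := complex.Im _.
have v0 := vnorm_ge0 z; have v1 : vnorm z < 1 by rewrite vnorm_lt1.
have E : vnorm z ^+ 2 = x ^+ 2 + y ^+ 2 + \sum_(j < n) cabs2 (z ord0 (lift ord0 j)).
  by rewrite vnorm_sqr /vnorm2 big_ord_recl.
have S0 : 0 <= \sum_(j < n) cabs2 (z ord0 (lift ord0 j)) by apply: sumr_ge0 => j _; exact: cabs2_ge0.
have x0 := sqr_ge0 x; have y0 := sqr_ge0 y.
have jS j : cabs2 (z ord0 (lift ord0 j)) <= \sum_(j < n) cabs2 (z ord0 (lift ord0 j)).
  by rewrite (bigD1 j)//= lerDl sumr_ge0// => ? _; exact: cabs2_ge0.
have xr : -1 <= x <= 1.
  by rewrite -ler_norml -(@ler_sqr _ `|x|) ?nnegrE// expr1n real_normK ?num_real//; nra.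
(* At the origin the reciprocal norm is 0, so [a = b = 0], and all coordinates vanish as well. *)
have [vz|vz] := eqVneq (vnorm z) 0.
  have i0 : i = 0 by rewrite /i vz invr0.
  have x00 : x ^+ 2 = 0 by apply/eqP; rewrite eq_le x0 andbT; move: E; rewrite vz expr0n /=; lra.
  have y00 : y ^+ 2 = 0 by apply/eqP; rewrite eq_le y0 andbT; move: E; rewrite vz expr0n /=; lra.
  split => //; rewrite /a /b i0 !mul0r ?expr0n /= ?addr0 ?y00//.
  move=> j; have := jS j; rewrite /cabs2 => h; rewrite subr0.
  by apply: le_trans h _; move: E; rewrite vz expr0n /=; lra.
have vp : 0 < vnorm z by rewrite lt_neqAle eq_sym vz.
have i1 : 1 <= i ^+ 2 by rewrite expr_ge1 ?invr_ge0// invf_ge1// ltW.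
have iv : i ^+ 2 * vnorm z ^+ 2 = 1 by rewrite -exprMn mulVf// expr1n.
rewrite E in iv.
have -> : a ^+ 2 = i ^+ 2 * x ^+ 2 by rewrite exprMn.
have -> : b ^+ 2 = i ^+ 2 * y ^+ 2 by rewrite exprMn.
split => //.
- by rewrite -iv mulrDr mulrDr lerDl mulr_ge0 ?sqr_ge0.
- by rewrite ler_peMl.
- move=> j; rewrite -iv; apply: le_trans (jS j) _.
  have -> (u v w : R) : i ^+ 2 * (u + v + w) - i ^+ 2 * u = i ^+ 2 * (v + w) by ring.
  by apply: le_trans (ler_peMl S0 i1) _; rewrite ler_wpM2l ?sqr_ge0// lerDr.
Qed.

(** [Im z_0] enters at scale [d], the coordinates other than [z_0] at scale [sqrt d]. No decay is
    drawn from [Re z_0], only the bound [|Re z_0| <= 1]. *)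
Definition kern_re (d : R) (j : nat) (x : R) : R := if j is 0 then \1_(`[(- 1)%R, 1%R]%classic : set R) x else (d + x ^+ 2)^-1.
Definition kern_im (d : R) (j : nat) (x : R) : R := if j is 0 then (d ^+ 2 + x ^+ 2)^-1 else (d + x ^+ 2)^-1.

(* The modulus squared of [1 - s z_0/|z|] dominates, up to constants, each of [(1-s)^2],
   [(1-s)^2 + y_0^2] and [(1-s + x_j^2)(1-s + y_j^2)] for [j <> 0]; distributing its powers
   among them gives a product of one-variable functions. *)
Lemma kern_pointwise (s : R) (p : nat) (z : V) : 0 <= s -> s < 1 -> (N <= p)%N -> vnorm2 z < 1 ->
  kern s p z <= 8 * 9 ^+ n * (1 - s) ^- (p - N).*2 *
    \prod_(j < N) (kern_re (1 - s) j (complex.Re (z ord0 j)) * kern_im (1 - s) j (complex.Im (z ord0 j))).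
Proof.
move=> s0 s1 Np z1; have [h1 h2 h3 h4] := kern_facts z1.
set i := (vnorm z)^-1 in h1 h2 h4; set a := i * _ in h1 h4; set b := i * _ in h1 h2.
have Ex : cabs2 (1 - s%:C%C * ((vnorm z)^-1%:C%C * z ord0 ord0)) = (1 - s * a) ^+ 2 + (s * b) ^+ 2.
  rewrite /a /b -/i; case: (z ord0 ord0) => u w; rewrite /cabs2 /=; ring.
rewrite /kern Ex; set X := (X in X ^- _).
have d0 : 0 < 1 - s by lra.
have a1 : a <= 1 by have := sqr_ge0 b; have := sqr_ge0 (a - 1); rewrite sqrrB; nra.
have Xd : (1 - s) ^+ 2 <= X.
  apply: (@le_trans _ _ ((1 - s * a) ^+ 2)); last by rewrite /X lerDl sqr_ge0.
  by rewrite ler_sqr ?nnegrE; nra.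
have X0 : 0 < X by apply: lt_le_trans Xd; rewrite exprn_gt0.
rewrite big_ord_recl /= indicE mem_set ?mul1r; last by rewrite /= in_itv.
(* [p = (p - N) + 1 + n]: the first [p - N] powers give [(1 - s)^-2] each, one is spent on [Im z_0],
   and one on each of the other [n] coordinates. *)
have -> : X ^- p = X ^- (p - N) * X^-1 * X ^- n.
  by rewrite -!invfM -mulrA -exprS -exprD subnK.
have -> (u v w t q : R) : u * v * w * (t * q) = (w * (u * t)) * (v * q) by move=> *; ring.
have H1 : X ^- (p - N) <= (1 - s) ^- (p - N).*2.
  by rewrite -mul2n exprM lef_pV2 ?posrE ?exprn_gt0// lerXn2r ?nnegrE ?sqr_ge0 ?(ltW X0).
have H2 : X^-1 <= 8 * ((1 - s) ^+ 2 + (complex.Im (z ord0 ord0)) ^+ 2)^-1.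
  have h := kernel_im_bound s0 s1 h1 h2.
  rewrite -[8]invrK -invfM lef_pV2 ?posrE//; last first.
    by rewrite mulr_gt0 ?invr_gt0// ltr_pwDl ?exprn_gt0 ?sqr_ge0.
  by rewrite ler_pdivrMl.
have H3 : X ^- n <= 9 ^+ n * \prod_(j < n) ((1 - s + complex.Re (z ord0 (lift ord0 j)) ^+ 2)^-1
      * (1 - s + complex.Im (z ord0 (lift ord0 j)) ^+ 2)^-1).
  have -> : X ^- n = \prod_(j < n) X^-1 by rewrite prodr_const card_ord exprVn.
  have -> : (9 : R) ^+ n = \prod_(j < n) 9 by rewrite prodr_const card_ord.
  rewrite -big_split; apply: ler_prod => j _; rewrite invr_ge0 (ltW X0) /=.
  have h := kernel_re_bound s0 s1 h1 (h4 j).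
  rewrite -invfM -[9]invrK -invfM lef_pV2 ?posrE//; last first.
    by rewrite mulr_gt0 ?invr_gt0// mulr_gt0// ltr_pwDl ?sqr_ge0.
  by rewrite ler_pdivrMl.
rewrite ler_pM ?mulr_ge0 ?invr_ge0 ?exprn_ge0 ?(ltW X0)//.
by rewrite ler_pM ?invr_ge0 ?exprn_ge0 ?(ltW X0).
Qed.

(** Exponents of [1 - s]: [-2 (p - N)] from the prefactor, [-1] from [Im z_0], and [-1] from each of
    the other [n] coordinates, through two factors [pi / sqrt (1 - s)]. They add up to
    [-(2p - N)]. *)
Lemma kern_integral (p : nat) : (N <= p)%N -> exists K : R, 0 < K /\
  forall s : R, 0 <= s -> s < 1 ->
  (lebint (fun z : V => if (vnorm2 z < 1)%R then (kern s p z)%:E else 0) <= (K * (1 - s) ^- (p.*2 - N))%:E)%E.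
Proof.
move=> Np; exists ((8 * 9 ^+ n) * ((2 * 1 * pi) * (pi * pi) ^+ n)); split.
  by rewrite !(mulr_gt0, exprn_gt0)// ?pi_gt0.
move=> s s0 s1; set d := 1 - s; have d0 : 0 < d by rewrite subr_gt0.
pose A (j : nat) : R := if j is 0 then 2 * 1 else pi / Num.sqrt d.
pose B (j : nat) : R := if j is 0 then pi / Num.sqrt (d ^+ 2) else pi / Num.sqrt d.
have r0 i x : 0 <= kern_re d i x.
  by case: i => [|i]; rewrite /kern_re ?indicE// invr_ge0 addr_ge0 ?sqr_ge0 ?(ltW d0).
have i0 i x : 0 <= kern_im d i x.
  by case: i => [|i]; rewrite /kern_im invr_ge0 addr_ge0 ?sqr_ge0 ?(ltW d0).
have mr i : measurable_fun setT (kern_re d i).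
  by case: i => [|i]; [exact: measurable_indic|exact: measurable_inv_sqr].
have mi i : measurable_fun setT (kern_im d i).
  by case: i => [|i]; apply: measurable_inv_sqr; rewrite ?exprn_gt0.
have Ir i : (\int[leb]_x (kern_re d i x)%:E = (A i)%:E)%E.
  by case: i => [|i]; [exact: integral_indic_sym|exact: integral_cauchy].
have Ii i : (\int[leb]_x (kern_im d i x)%:E = (B i)%:E)%E.
  by case: i => [|i]; apply: integral_cauchy; rewrite ?exprn_gt0.
have P := @cint_prod R N _ _ A B r0 i0 mr mi Ir Ii.
pose Q (z : V) : R := \prod_(j < N) (kern_re d j (complex.Re (z ord0 j)) * kern_im d j (complex.Im (z ord0 j))).
have Q0 z : 0 <= Q z by apply: prodr_ge0 => j _; rewrite mulr_ge0.
have mQ : vfmeas (fun z => (Q z)%:E).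
  split => [z|e T Z mZ]; first by rewrite lee_fin.
  apply: measurable_fun_EFin; apply: measurable_prod => j _; apply: measurable_funM.
    exact: (measurableT_comp (mr j) (mZ j).1).
  exact: (measurableT_comp (mi j) (mZ j).2).
have IQ : lebint (fun z => (Q z)%:E) = (\prod_(i < N) (A i * B i))%R%:E.
  by rewrite -P; apply: eq_cint => t _; congr (_%:E); apply: eq_bigr => j _; rewrite mxE.
pose c : R := 8 * 9 ^+ n * d ^- (p - N).*2.
have c0 : 0 <= c by rewrite !mulr_ge0 ?invr_ge0 ?exprn_ge0 ?(ltW d0).
apply: (@le_trans _ _ (lebint (fun z => (c%:E * (Q z)%:E)%E))).
  apply: le_lebint => z.
    by case: ifP => // _; rewrite lee_fin invr_ge0 exprn_ge0// cabs2_ge0.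
  case: ifP => z1; rewrite -EFinM lee_fin; last by rewrite mulr_ge0.
  exact: kern_pointwise.
rewrite lebintZ ?lee_fin//; move: IQ => ->.
rewrite -EFinM lee_fin big_ord_recl /= sqrtr_sqr (ger0_norm (ltW d0)).
rewrite prodr_const card_ord /= mulf_div -expr2 -expr2 sqr_sqrtr ?(ltW d0)// expr_div_n -/d.
rewrite /c le_eqVlt; apply/orP; left; apply/eqP.
have -> : (p.*2 - N = (p - N).*2 + n.+1)%N.
  by move: Np; rewrite -!muln2; lia.
rewrite (exprD d (p - N).*2 n.+1) (exprS d n).
have e1 : d ^+ (p - N).*2 != 0 by rewrite expf_neq0 ?gt_eqF.
have e2 : d ^+ n != 0 by rewrite expf_neq0 ?gt_eqF.
have e3 : d != 0 by rewrite gt_eqF.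
move: (d ^+ (p - N).*2) (d ^+ n) ((pi ^+ 2) ^+ n) (9 ^+ n) e1 e2 e3 => u v w t e1 e2 e3.
by field; apply/and3P.
Qed.

End KernelBound.

(** * Norm estimates in the Hardy and Bergman spaces *)

Section TestNorm.
Variable R : realType.
Variable n : nat.
Local Notation C := (R[i]).
Local Notation N := n.+1.
Local Notation V := 'rV[C]_N.
Local Notation leb := (@lebesgue_measure R).

(** For [k = 1] and [p = N] this is the Szego kernel of the ball; the test functions use a large
    [p]. *)
Definition szego (p : nat) (k : C) (a : V) (z : V) : C := k / (1 - cinner z a) ^+ p.

Lemma cabs2_szego p k a (z : V) : cabs2 (szego p k a z) = cabs2 k * (cabs2 (1 - cinner z a)) ^- p.
Proof. by rewrite /szego cabs2M -2!nc_sqr ncV ncX exprVn -!nc_sqr -!exprM mulnC. Qed.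

Lemma measurable_cabs2V d (T : measurableType d) (f : T -> C) : cmeas f ->
  measurable_fun setT (fun t => (cabs2 (f t))^-1).
Proof.
move=> [m1 m2]; rewrite (_ : (fun _ => _) = (fun t => cabs2 (f t) `^ (- 1))).
  by apply: (measurableT_comp (@measurable_powR R (- 1)%R)); exact: measurable_cabs2.
by apply/funext => t; rewrite powRN powRr1 ?cabs2_ge0.
Qed.

Lemma vfmeas_szego p k (a : V) : vfmeas (fun z : V => (cabs2 (szego p k a z))%:E).
Proof.
split => [z|d T Z mZ]; first by rewrite lee_fin cabs2_ge0.
apply: measurable_fun_EFin; under eq_fun do rewrite cabs2_szego -exprVn.
apply: measurable_funM => //; apply: measurable_funX; apply: measurable_cabs2V.
under eq_fun do rewrite -cinnerNr.
by apply: cmeasD; [exact: cmeas_cst|exact: vmeas_cinner].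
Qed.

(** A unitary map taking the first basis vector to [zeta] turns the integrand into a multiple of
    [kern (r * t)]. *)
Lemma sphere_avg_szego (p : nat) : (N <= p)%N -> exists K : R, 0 < K /\
  forall (t r : R) (k : C) (zeta : V), vnorm2 zeta = 1 -> 0 <= t -> t < 1 -> 0 <= r -> r <= 1 ->
  (sphere_avg (fun z => (cabs2 (szego p k (t%:C%C *: zeta) z))%:E) r
     <= (cabs2 k * (K * (1 - r * t) ^- (p.*2 - N)))%:E)%E.
Proof.
move=> Np; have [K [K0 HK]] := @kern_integral R n p Np; exists K; split=> // t r k zeta z1 t0 t1 r0 r1.
have [M [M' [[MD MZ MK Mn] [mM _ Mz]]]] := unitary_existence z1.
set G := (fun z => _); have mG : vfmeas G by exact: vfmeas_szego.
rewrite /sphere_avg; have <- := lebint_isometry MD MK Mn mM (vfmeas_sphere r mG).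
have s0 : 0 <= r * t by rewrite mulr_ge0.
have s1 : r * t < 1 by apply: le_lt_trans t1; rewrite ler_piMl.
apply: (@le_trans _ _ (lebint (fun z => ((cabs2 k)%:E * (if (vnorm2 z < 1)%R then (kern (r * t) p z)%:E else 0))%E))).
  apply: le_lebint => z; rewrite Mn; first by case: ifP => // _; exact: mG.1.
  case: ifP => zl; last by rewrite mule0.
  rewrite /G cabs2_szego -EFinM lee_fin /vnorm Mn -/(vnorm z) cinnerZr conjc_real !cinnerZl Mz.
  by rewrite /kern rmorphM /= !mulrA [t%:C%C * _]mulrC.
rewrite lebintZ; first by rewrite EFinM; apply: lee_wpmul2l; rewrite ?lee_fin ?cabs2_ge0//; exact: HK.
- by rewrite lee_fin cabs2_ge0.
- apply: vfmeas_ball; split => [z|d T Z mZ]; first by rewrite lee_fin invr_ge0 exprn_ge0 ?cabs2_ge0.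
  apply: measurable_fun_EFin; rewrite /kern; under eq_fun do rewrite -exprVn.
  apply: measurable_funX; apply: measurable_cabs2V; under eq_fun do rewrite -mulN1r.
  apply: cmeasD; first exact: cmeas_cst.
  apply: cmeasM; first exact: cmeas_cst.
  apply: cmeasM; first exact: cmeas_cst.
  apply: cmeasM; last exact: mZ.
  by split => /=; [exact: measurable_vnormV|exact: measurable_cst].
Qed.

(** [radial_weight] is cut off at radius 0, so the polar comparison misses the origin, which has to
    be shown to be null. *)
Definition point0 (z : V) : \bar R := if (vnorm2 z <= 0)%R then 1%E else 0%E.

Lemma vfmeas_point0 : vfmeas point0.
Proof.
split => [z|d T Z mZ]; first by rewrite /point0; case: ifP.
by apply: measurable_fun_ifT => //; apply: measurable_fun_ler => //; exact: measurable_vnorm2.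
Qed.

(* By scaling, the measure [m] of the origin satisfies [m = 4^-N m]. *)
Lemma lebint_point0 : lebint point0 = 0%E.
Proof.
have m0 := vfmeas_point0.
have p0 : (0 <= lebint point0)%E by apply: lebint_ge0; exact: m0.1.
have pl : (lebint point0 < +oo)%E.
  apply: le_lt_trans (@bball_vol_lty R n); apply: le_lebint; first exact: m0.1.
  by move=> z; rewrite /point0 /bball_ind; case: ifP => [h|_]; [rewrite (le_lt_trans h ltr01)|case: ifP].
have := @lebint_scale R n 2 point0 _ m0; rewrite ltr0n => /(_ isT) E.
have {}E : lebint point0 = ((2 ^- N.*2)%R%:E * lebint point0)%E.
  rewrite -E; apply: eq_lebint => z; rewrite /point0 vnorm2Z.
  by rewrite pmulr_rle0// exprn_gt0.
move: p0 pl E; case: (lebint point0) => [x| |]//= p0 _; rewrite -EFinM => -[E]; congr (_%:E).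
have h : (2 ^- N.*2 : R) < 1 by rewrite invf_lt1 ?exprn_gt0// exprn_egt1 ?ltr1n.
have e0 : (1 - 2 ^- N.*2 : R) != 0 by rewrite gt_eqF// subr_gt0.
by apply: (mulfI e0); rewrite mulr0 mulrBl mul1r -E subrr.
Qed.

(** The growth exponent [beta]: on the unit ball of the space, values at [z] are at most of size
    [(1 - |z|)^(-beta/2)]. *)
Definition hexp (sp : fspace R) : R := if sp is Bergman a then N%:R + 1 + a else N%:R.

Lemma ball_volume_gt0 : 0 < ball_volume R n.
Proof. exact: bvol_gt0. Qed.

Definition radial_weight (a r : R) : \bar R := if (0 < r)%R && (r < 1)%R then ((1 - r ^+ 2) `^ a)%:E else 0%E.

Lemma measurable_radial_weight a : measurable_fun setT (radial_weight a).
Proof.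
apply: measurable_fun_ifT => //.
  by apply: measurable_and; exact: measurable_fun_ltr.
apply: measurable_fun_EFin; apply: (measurableT_comp (@measurable_powR R a)).
by apply: measurable_funB => //; exact: measurable_funX.
Qed.

Lemma radial_weight_ge0 a r : (0 <= radial_weight a r)%E.
Proof. by rewrite /radial_weight; case: ifP => // _; rewrite lee_fin powR_ge0. Qed.

Definition bergman_cst (a : R) : R := Gamma (N%:R + a + 1) / (Gamma (N%:R + 1) * Gamma (a + 1)).

Lemma bergman_cst_gt0 a : -1 < a -> 0 < bergman_cst a.
Proof.
have n0 : 1 <= N%:R :> R by rewrite ler1n.
by move=> a1; rewrite divr_gt0 ?mulr_gt0 ?Gamma_gt0//; lra.
Qed.

Lemma powRBn (d b : R) (p : nat) : 0 < d -> d `^ (b - p%:R) = d `^ b * d ^- p.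
Proof.
by move=> d0; rewrite powRD ?powRN ?powR_mulrn ?(ltW d0)//; apply/implyP => _; rewrite gt_eqF.
Qed.

(** Away from the origin this is [polar_le]; the value at the origin is carried by a multiple of
    [point0], whose integral is 0. *)
Lemma bergman_radial_le (a : R) (f : V -> C) : vfmeas (fun z => (cabs2 (f z))%:E) ->
  (lebint (fun z => if (vnorm2 z < 1)%R then (cabs2 (f z) * (1 - vnorm2 z) `^ a)%:E else 0)
   <= (2 ^+ N.*2.+1)%:E * \int[leb]_r (radial_weight a r * sphere_avg (fun z => (cabs2 (f z))%:E) r))%E.
Proof.
move=> mG; have supp r : ~~ ((0 < r)%R && (r < 1)%R) -> radial_weight a r = 0%E.
  by move=> /negbTE h; rewrite /radial_weight h.
have P := polar_le (measurable_radial_weight a) (radial_weight_ge0 a) supp mG.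
apply: le_trans P.
have mW : vfmeas (fun z : V => (radial_weight a (vnorm z) * (cabs2 (f z))%:E)%E).
  apply: vfmeasM => //; split => [z|d T Z mZ]; first exact: radial_weight_ge0.
  by apply: (measurableT_comp (measurable_radial_weight a)); exact: measurable_vnorm.
have m0 := vfmeas_point0.
set c := cabs2 (f 0); have c0 : (0 <= c%:E)%E by rewrite lee_fin cabs2_ge0.
have mc : vfmeas (fun z => c%:E * point0 z)%E by apply: vfmeasM => //; exact: vfmeas_cst.
apply: (@le_trans _ _ (lebint (fun z => (radial_weight a (vnorm z) * (cabs2 (f z))%:E + c%:E * point0 z)%E))).
  apply: le_lebint => z.
    by case: ifP => // _; rewrite lee_fin mulr_ge0 ?cabs2_ge0 ?powR_ge0.
  case: ifP => z1; last by rewrite adde_ge0//; [exact: mW.1|exact: mc.1].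
  have [v0|v0] := ltP 0 (vnorm2 z).
    rewrite /radial_weight /point0 vnorm_lt1 z1 andbT vnorm_sqr sqrtr_gt0 v0 (leNgt (vnorm2 z)) v0 /= mule0 adde0.
    by rewrite -EFinM mulrC.
  have vz : vnorm2 z = 0 by apply/eqP; rewrite eq_le v0 vnorm2_ge0.
  have zz := vnorm2_eq0 vz.
  rewrite /point0 v0 mule1 vz subr0 powR1 mulr1 zz -/c.
  by rewrite leeDr// mule_ge0 ?radial_weight_ge0.
by rewrite (lebintD mW mc) (lebintZ c0 m0) lebint_point0 mule0 adde0.
Qed.

Lemma vfmeas_bergman (a : R) (f : V -> C) : vfmeas (fun z => if (vnorm2 z < 1)%R then (cabs2 (f z))%:E else 0%E) ->
  vfmeas (fun z => if (vnorm2 z < 1)%R then (cabs2 (f z) * (1 - vnorm2 z) `^ a)%:E else 0%E).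
Proof.
move=> mf; have mw : vfmeas (fun z : V => ((1 - vnorm2 z) `^ a)%:E).
  split => [z|d T Z mZ]; first by rewrite lee_fin powR_ge0.
  apply: measurable_fun_EFin; apply: (measurableT_comp (@measurable_powR R a)).
  by apply: measurable_funB => //; exact: measurable_vnorm2.
have := vfmeasM mf mw; rewrite (_ : (fun z => _) = (fun z => if (vnorm2 z < 1)%R then (cabs2 (f z) * (1 - vnorm2 z) `^ a)%:E else 0%E))//.
by apply/funext => z; case: ifP; rewrite ?mul0e// -EFinM.
Qed.

Lemma Hnorm2_bergman (a : R) (f : V -> C) : -1 < a ->
  vfmeas (fun z => if (vnorm2 z < 1)%R then (cabs2 (f z))%:E else 0%E) ->
  Hnorm2 (Bergman a) f = ((bergman_cst a / ball_volume R n)%:E *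
   lebint (fun z => if (vnorm2 z < 1)%R then (cabs2 (f z) * (1 - vnorm2 z) `^ a)%:E else 0%E))%E.
Proof.
move=> a1 mf; have k0 := bergman_cst_gt0 a1.
rewrite /= /nu_int; set Y := lebint (fun z => if _ then (cabs2 _ * _ `^ _)%:E else _).
have -> : lebint (fun z : V => if (vnorm2 z < 1)%R then (Gamma (N%:R + a + 1) / (Gamma (N%:R + 1) * Gamma (a + 1)) * cabs2 (f z) *
      (1 - vnorm2 z) `^ a)%:E else 0%E) = ((bergman_cst a)%:E * Y)%E.
  rewrite -(lebintZ _ (vfmeas_bergman a mf)) ?lee_fin ?(ltW k0)//.
  by apply: eq_lebint => z; case: ifP; rewrite ?mule0// -EFinM mulrA.
by move: Y => Y; rewrite muleAC -EFinM.
Qed.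

(** Sphere means are at most a multiple of [(1 - r (1 - d))^-(2p - N)]. In the Hardy case the base
    is at least [d]. In the Bergman case they are integrated against the radial weight by
    [radial_weight_integral], which asks for [a + 2 <= 2p - N]. *)
Lemma Hnorm2_szego (sp : fspace R) (p : nat) :
  (forall a, sp = Bergman a -> -1 < a /\ a + 2 <= (p.*2 - N)%:R) -> (N <= p)%N ->
  exists K : R, 0 < K /\ forall (d : R) (k : C) (zeta : V), vnorm2 zeta = 1 -> 0 < d -> d <= 1 ->
  (Hnorm2 sp (szego p k ((1 - d)%:C%C *: zeta)) <= (K * (cabs2 k * d `^ (hexp sp - p.*2%:R)))%:E)%E.
Proof.
move=> hsp Np; have [K [K0 HK]] := sphere_avg_szego Np.
have v0 := ball_volume_gt0.
have p2 : ((p.*2 - N)%:R = p.*2%:R - N%:R :> R) by rewrite natrB// (leq_trans Np)// -addnn leq_addr.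
(* [1 - r (1 - d)] is at least [d] and at least [1 - r]; the maximum is the form met in the radial
   integral. *)
have key (d r : R) : 0 < d -> d <= 1 -> 0 <= r -> r <= 1 -> (1 - r * (1 - d)) ^- (p.*2 - N) <= (Num.max d (1 - r)) ^- (p.*2 - N).
  move=> d0 d1 r0 r1.
  have m0 : 0 < Num.max d (1 - r) by rewrite lt_max d0.
  have m1 : Num.max d (1 - r) <= 1 - r * (1 - d) by rewrite ge_max; apply/andP; split; nra.
  by rewrite lef_pV2 ?posrE ?exprn_gt0 ?(lt_le_trans m0)// lerXn2r ?nnegrE ?(ltW m0) ?(le_trans (ltW m0)).
case: sp hsp => [|a] hsp.
- exists (K / ball_volume R n); split; first by rewrite divr_gt0.
  move=> d k zeta z1 d0 d1; apply: ge_ereal_sup => x [r + <-]; rewrite /= in_itv /= => /andP[r0 r1].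
  rewrite /sigma_int /nu_int.
  have -> : (K / ball_volume R n * (cabs2 k * d `^ (N%:R - p.*2%:R)))%:E =
    ((cabs2 k * (K * d `^ (N%:R - p.*2%:R)))%:E * ((ball_volume R n)^-1)%:E)%E.
    by rewrite -EFinM; congr (_%:E); ring.
  apply: lee_wpmul2r; first by rewrite lee_fin invr_ge0 ltW.
  have d0' : 0 <= 1 - d by lra.
  have d1' : 1 - d < 1 by lra.
  apply: le_trans (HK _ r k zeta z1 d0' d1' (ltW r0) (ltW r1)) _.
  rewrite lee_fin; apply: ler_wpM2l; first exact: cabs2_ge0.
  apply: ler_wpM2l; first exact: ltW.
  apply: le_trans (key _ _ d0 d1 (ltW r0) (ltW r1)) _.
  have -> : N%:R - p.*2%:R = 0 - (p.*2 - N)%:R :> R by rewrite p2; ring.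
  rewrite powRBn// powRr0 mul1r lef_pV2 ?posrE ?exprn_gt0 ?lt_max ?d0//.
  by rewrite lerXn2r ?nnegrE ?(ltW d0) ?le_max ?(ltW d0) ?lexx.
- have [a1 aq] := hsp a erefl; have k0 := bergman_cst_gt0 a1.
  pose L := (1 + 2 `^ a) * ((a + 1)^-1 + 2 * pi).
  have L0 : 0 < L.
    by rewrite mulr_gt0// ?addr_gt0 ?powR_gt0 ?invr_gt0 ?mulr_gt0 ?pi_gt0//; lra.
  exists (bergman_cst a / ball_volume R n * (2 ^+ N.*2.+1 * (K * L))); split.
    by apply: mulr_gt0; [exact: divr_gt0|apply: mulr_gt0; [exact: exprn_gt0|exact: mulr_gt0]].
  move=> d k zeta z1 d0 d1; set f := szego _ _ _.
  have mG : vfmeas (fun z => (cabs2 (f z))%:E) by exact: vfmeas_szego.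
  rewrite (Hnorm2_bergman a1 (vfmeas_ball mG)).
  have : 0 <= bergman_cst a / ball_volume R n by exact: divr_ge0 (ltW k0) (ltW v0).
  move: (bergman_cst a / ball_volume R n) => c c0; rewrite -mulrA EFinM.
  apply: lee_wpmul2l; first by rewrite lee_fin.
  apply: le_trans (bergman_radial_le a mG) _.
  rewrite -mulrA [X in (_ <= X)%E]EFinM; apply: lee_wpmul2l; first by rewrite lee_fin exprn_ge0.
  have d0' : 0 <= 1 - d by lra.
  have d1' : 1 - d < 1 by lra.
  set ck := cabs2 k; have ck0 : 0 <= ck by exact: cabs2_ge0.
  pose w (r : R) : \bar R := (if (0 < r)%R && (r < 1)%R then
      ((1 - r ^+ 2) `^ a * (Num.max d (1 - r)) ^- (p.*2 - N))%R%:E else 0)%E.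
  have w0 r : (0 <= w r)%E.
    rewrite /w; case: ifP => // _; rewrite lee_fin mulr_ge0 ?powR_ge0// invr_ge0 exprn_ge0//.
    by rewrite le_max (ltW d0).
  have mw : measurable_fun setT w.
    apply: measurable_fun_ifT => //; first by apply: measurable_and; exact: measurable_fun_ltr.
    apply: measurable_fun_EFin; apply: measurable_funM.
      apply: (measurableT_comp (@measurable_powR R a)).
      by apply: measurable_funB => //; exact: measurable_funX.
    under eq_fun do rewrite -powR_invn ?le_max ?(ltW d0)//.
    apply: (measurableT_comp (@measurable_powR R _)).
    by apply: measurable_maxr => //; apply: measurable_funB.
  apply: (@le_trans _ _ (\int[leb]_r ((ck * K)%:E * w r))%E).
    apply: le_integral_ge0 => r.
      rewrite mule_ge0 ?radial_weight_ge0//; apply: lebint_ge0 => z; case: ifP => // _; exact: mG.1.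
    rewrite /radial_weight /w; case: ifP => [/andP[r0 r1]|]; last by rewrite mul0e mule0.
    rewrite -EFinM mulrCA EFinM; apply: lee_wpmul2l; first by rewrite lee_fin powR_ge0.
    apply: le_trans (HK _ r k zeta z1 d0' d1' (ltW r0) (ltW r1)) _.
    rewrite lee_fin mulrA; apply: ler_wpM2l; first by rewrite mulr_ge0// ltW.
    by apply: key => //; exact: ltW.
  rewrite integralZl_leb//; last by rewrite lee_fin mulr_ge0// ltW.
  have -> : K * L * (ck * d `^ (hexp (Bergman a) - p.*2%:R)) = (ck * K) * (L * d `^ (a + 1 - (p.*2 - N)%:R)).
    have -> : hexp (Bergman a) - p.*2%:R = a + 1 - (p.*2 - N)%:R by rewrite p2 /hexp; ring.
    by ring.
  rewrite [X in (_ <= X)%E]EFinM; apply: lee_wpmul2l; first by rewrite lee_fin mulr_ge0// ltW.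
  exact: radial_weight_integral.
Qed.

End TestNorm.

(** * Point evaluation *)

Section Slices.
Variable R : realType.
Local Notation C := (R[i]).

(** The bounds of [CRball] for a function of one variable. The operations below return explicit
    constants, so that these are uniform over all discs considered. *)
Definition QDisc (f : C -> C) (K : R) : Prop :=
  [/\ (forall l, nc l <= 1 -> nc (f l) <= K),
      (forall l m, nc l <= 1 -> nc m <= 1 -> nc (f m - f l) <= K * nc (m - l)) &
      (forall l, nc l <= 1 -> exists q, forall m, nc m <= 1 ->
         nc (f m - f l - q * (m - l)) <= K * nc (m - l) ^+ 2)].

Lemma QDisc_ge0 f K : QDisc f K -> 0 <= K.
Proof. by move=> [h _ _]; apply: le_trans (h 0 _); rewrite ?nc_ge0// nc0 ler01. Qed.

Lemma QDisc_le f K L : QDisc f K -> K <= L -> QDisc f L.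
Proof.
move=> [h1 h2 h3] KL; split.
- by move=> l /h1 h; exact: le_trans KL.
- by move=> l m l1 m1; apply: le_trans (h2 l m l1 m1) _; rewrite ler_wpM2r ?nc_ge0.
- move=> l l1; have [q hq] := h3 l l1; exists q => m m1.
  by apply: le_trans (hq m m1) _; rewrite ler_wpM2r ?exprn_ge0 ?nc_ge0.
Qed.

Lemma QDisc_affine (a b : C) K L : nc a <= K -> nc b <= L -> QDisc (fun l => a + l * b) (K + L).
Proof.
move=> aK bL; have K0 := le_trans (nc_ge0 a) aK; have L0 := le_trans (nc_ge0 b) bL; split.
- move=> l l1; apply: le_trans (ncD _ _) _; apply: lerD => //; rewrite ncM.
  by rewrite -[leRHS]mul1r ler_pM ?nc_ge0.
- move=> l m _ _; have -> : a + m * b - (a + l * b) = (m - l) * b by ring.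
  rewrite ncM mulrC ler_wpM2r ?nc_ge0//; lra.
- move=> l _; exists b => m _; have -> : a + m * b - (a + l * b) - b * (m - l) = 0 by ring.
  by rewrite nc0 mulr_ge0 ?exprn_ge0 ?nc_ge0// addr_ge0.
Qed.

Lemma QDiscB f g K L : QDisc f K -> QDisc g L -> QDisc (fun l => f l - g l) (K + L).
Proof.
move=> [f1 f2 f3] [g1 g2 g3]; split.
- by move=> l l1; apply: le_trans (ncB _ _) _; rewrite lerD ?f1 ?g1.
- move=> l m l1 m1; have -> : f m - g m - (f l - g l) = (f m - f l) - (g m - g l) by ring.
  by apply: le_trans (ncB _ _) _; rewrite mulrDl lerD ?f2 ?g2.
- move=> l l1; have [q hq] := f3 l l1; have [r hr] := g3 l l1; exists (q - r) => m m1.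
  have -> : f m - g m - (f l - g l) - (q - r) * (m - l) = (f m - f l - q * (m - l)) - (g m - g l - r * (m - l)) by ring.
  by apply: le_trans (ncB _ _) _; rewrite mulrDl lerD ?hq ?hr.
Qed.

Lemma QDiscM f g K L : QDisc f K -> QDisc g L -> QDisc (fun l => f l * g l) (3 * (K * L)).
Proof.
move=> hf hg; have K0 := QDisc_ge0 hf; have L0 := QDisc_ge0 hg; have KL0 := mulr_ge0 K0 L0.
case: hf hg => [f1 f2 f3] [g1 g2 g3]; split.
- move=> l l1; apply: (@le_trans _ _ (K * L)); last by lra.
  by rewrite ncM ler_pM ?nc_ge0 ?f1 ?g1.
- move=> l m l1 m1; have -> : f m * g m - f l * g l = f m * (g m - g l) + (f m - f l) * g l by ring.
  have n0 := nc_ge0 (m - l).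
  have h1 : nc (f m * (g m - g l)) <= K * (L * nc (m - l)) by rewrite ncM ler_pM ?nc_ge0 ?f1 ?g2.
  have h2 : nc ((f m - f l) * g l) <= (K * nc (m - l)) * L by rewrite ncM ler_pM ?nc_ge0 ?f2 ?g1.
  apply: le_trans (ncD _ _) _; apply: le_trans (lerD h1 h2) _.
  have := mulr_ge0 KL0 n0; lra.
- move=> l l1; have [q hq] := f3 l l1; have [r hr] := g3 l l1; exists (f l * r + g l * q) => m m1.
  have -> : f m * g m - f l * g l - (f l * r + g l * q) * (m - l) =
    (f l * (g m - g l - r * (m - l)) + g l * (f m - f l - q * (m - l))) + (f m - f l) * (g m - g l) by ring.
  have n0 := sqr_ge0 (nc (m - l)).
  have h1 : nc (f l * (g m - g l - r * (m - l))) <= K * (L * nc (m - l) ^+ 2).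
    by rewrite ncM ler_pM ?nc_ge0 ?f1 ?hr.
  have h2 : nc (g l * (f m - f l - q * (m - l))) <= L * (K * nc (m - l) ^+ 2).
    by rewrite ncM ler_pM ?nc_ge0 ?g1 ?hq.
  have h3 : nc ((f m - f l) * (g m - g l)) <= (K * nc (m - l)) * (L * nc (m - l)).
    by rewrite ncM ler_pM ?nc_ge0 ?f2 ?g2.
  apply: le_trans (ncD _ _) _; apply: le_trans (lerD (ncD _ _) (lexx _)) _.
  apply: le_trans (lerD (lerD h1 h2) h3) _; move: (nc (m - l)) => t.
  by rewrite le_eqVlt; apply/orP; left; apply/eqP; ring.
Qed.

Lemma QDisc_cst (k : C) : QDisc (fun=> k) (nc k).
Proof.
have n0 := nc_ge0 k; split=> [l _|l m _ _|l _].
- exact: lexx.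
- by rewrite subrr nc0 mulr_ge0 ?nc_ge0.
- by exists 0 => m _; rewrite subrr mul0r subrr nc0 mulr_ge0 ?exprn_ge0 ?nc_ge0.
Qed.

Lemma QDiscX f K p : QDisc f K -> QDisc (fun l => f l ^+ p) ((3 * K) ^+ p).
Proof.
move=> hf; elim: p => [|p IH].
  rewrite expr0 (_ : (fun l => f l ^+ 0) = fun=> 1); last by apply/funext => l; rewrite expr0.
  by rewrite -nc1; exact: QDisc_cst.
apply: (@QDisc_le _ (3 * (K * (3 * K) ^+ p))); last by rewrite exprS mulrA.
by have := QDiscM hf IH; under eq_fun do rewrite -exprS.
Qed.

(** The first-order coefficient of the reciprocal is [- q / f(l)^2]; the constant involves only [K]
    and the lower bound [e]. *)
Lemma QDiscV f K (e : R) : 0 < e -> (forall l, nc l <= 1 -> e <= nc (f l)) -> QDisc f K ->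
  QDisc (fun l => (f l)^-1) (e^-1 + K * e ^- 2 + K ^+ 2 * e ^- 3).
Proof.
move=> e0 he hf; have K0 := QDisc_ge0 hf; case: hf => f1 f2 f3.
have ei0 : 0 <= e^-1 by rewrite invr_ge0 ltW.
have t1 : 0 <= K * e ^- 2 by rewrite mulr_ge0 ?invr_ge0 ?exprn_ge0 ?(ltW e0).
have t2 : 0 <= K ^+ 2 * e ^- 3 by rewrite mulr_ge0 ?exprn_ge0 ?invr_ge0 ?exprn_ge0 ?(ltW e0).
have fn l : nc l <= 1 -> f l != 0 by move=> /he h; rewrite -nc_eq0 gt_eqF// (lt_le_trans e0).
have iv l : nc l <= 1 -> nc (f l)^-1 <= e^-1.
  by move=> /he h; rewrite ncV lef_pV2 ?posrE// (lt_le_trans e0).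
split.
- by move=> l /iv h; lra.
- move=> l m l1 m1; have -> : (f m)^-1 - (f l)^-1 = - (f m - f l) * (f m)^-1 * (f l)^-1.
    by field; rewrite !fn.
  rewrite !ncM ncN; apply: (@le_trans _ _ (K * nc (m - l) * e^-1 * e^-1)).
    by rewrite !ler_pM ?mulr_ge0 ?nc_ge0 ?f2 ?iv.
  have -> : K * nc (m - l) * e^-1 * e^-1 = K * e ^- 2 * nc (m - l).
    by rewrite expr2 invfM; ring.
  by rewrite ler_wpM2r ?nc_ge0//; lra.
- move=> l l1; have [q hq] := f3 l l1; exists (- q * (f l)^-1 ^+ 2) => m m1.
  have -> : (f m)^-1 - (f l)^-1 - - q * (f l)^-1 ^+ 2 * (m - l) =
    (f m - f l) * (f m - f l) * ((f m)^-1 * ((f l)^-1 * (f l)^-1)) -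
    (f m - f l - q * (m - l)) * ((f l)^-1 * (f l)^-1) by field; rewrite !fn.
  have h1 : nc ((f m - f l) * (f m - f l) * ((f m)^-1 * ((f l)^-1 * (f l)^-1))) <=
    (K * nc (m - l)) * (K * nc (m - l)) * (e^-1 * (e^-1 * e^-1)).
    by rewrite !ncM !ler_pM ?mulr_ge0 ?nc_ge0 ?f2 ?iv.
  have h2 : nc ((f m - f l - q * (m - l)) * ((f l)^-1 * (f l)^-1)) <= (K * nc (m - l) ^+ 2) * (e^-1 * e^-1).
    by rewrite !ncM !ler_pM ?mulr_ge0 ?nc_ge0 ?hq ?iv.
  apply: le_trans (ncB _ _) _; apply: le_trans (lerD h1 h2) _.
  have -> : (K * nc (m - l)) * (K * nc (m - l)) * (e^-1 * (e^-1 * e^-1)) + (K * nc (m - l) ^+ 2) * (e^-1 * e^-1)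
    = (K * e ^- 2 + K ^+ 2 * e ^- 3) * nc (m - l) ^+ 2.
    by rewrite !exprS !invfM; move: (e^-1) (nc _) => u w; rewrite expr0 invr1; ring.
  by rewrite ler_wpM2r ?exprn_ge0 ?nc_ge0//; lra.
Qed.

(** * Slices of the ball and linear-fractional maps *)

Variable n : nat.
Local Notation N := n.+1.
Local Notation V := 'rV[C]_N.

(** After rotating [w / |w|] to a basis vector the inner product is a coordinate, which the norm
    bounds. *)
Lemma cauchy_schwarz (z w : V) : nc (cinner z w) <= vnorm z * vnorm w.
Proof.
have [w0|w0] := eqVneq (vnorm w) 0.
  have -> : w = 0 by apply: vnorm2_eq0; rewrite -vnorm_sqr w0 expr0n.
  rewrite /cinner big1 => [|j _]; last by rewrite mxE conjc0 mulr0.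
  by rewrite nc0 mulr_ge0 ?vnorm_ge0.
have wp : 0 < vnorm w by rewrite lt_neqAle eq_sym w0 vnorm_ge0.
pose e : V := (vnorm w)^-1%:C%C *: w.
have e1 : vnorm2 e = 1 by rewrite vnorm2Z -vnorm_sqr -exprMn mulVf// expr1n.
have wE : w = (vnorm w)%:C%C *: e by rewrite scalerA -rmorphM /= mulfV// scale1r.
have [M [M' [[_ _ MK Mn] [_ _ Mz]]]] := unitary_existence e1.
rewrite [in cinner z w]wE cinnerZr conjc_real ncM nc_real ger0_norm ?vnorm_ge0// mulrC.
apply: ler_wpM2r; first exact: vnorm_ge0.
rewrite -(MK z) Mz /nc /vnorm Mn; apply: ler_wsqrtr.
by rewrite /vnorm2 (bigD1 ord0)//= lerDl sumr_ge0// => j _; rewrite cabs2_ge0.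
Qed.

Lemma vnormZc (l : C) (z : V) : vnorm (l *: z) = nc l * vnorm z.
Proof. by rewrite /vnorm vnorm2Zc sqrtrM ?cabs2_ge0. Qed.

(** The discs need not be centred at the origin: those of the ellipsoid are centred at [w_k]. The
    constant depends on [rho], not on the disc. *)
Definition slice_regular (h : V -> C) : Prop :=
  (forall d (T : measurableType d) (Z : T -> V), vmeas Z -> cmeas (fun t => h (Z t))) /\
  forall rho : R, rho < 1 -> exists K, forall c y : V, vnorm c <= 1 -> vnorm y <= 1 ->
    (forall l, nc l <= 1 -> vnorm (c + l *: y) <= rho) -> QDisc (fun l => h (c + l *: y)) K.

Lemma slice_regularB (g h : V -> C) : slice_regular g -> slice_regular h ->
  slice_regular (fun z => g z - h z).
Proof.
move=> [mg hg] [mh hh]; split=> [d T Z mZ|rho r1].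
  under eq_fun do rewrite -mulN1r.
  by apply: cmeasD; [exact: mg|apply: cmeasM; [exact: cmeas_cst|exact: mh]].
have [K hK] := hg rho r1; have [L hL] := hh rho r1; exists (K + L) => c y c1 y1 cy.
by apply: QDiscB; [exact: hK|exact: hL].
Qed.

Lemma cmeasV d (T : measurableType d) (f : T -> C) : cmeas f -> cmeas (fun t => (f t)^-1).
Proof.
move=> mf; have mi := measurable_cabs2V mf; have [m1 m2] := mf.
have E (x : C) : x^-1 = (((cabs2 x)^-1 * complex.Re x)%R +i* ((cabs2 x)^-1 * (- complex.Im x))%R)%C.
  by case: x => a b; apply/eqP; rewrite eq_complex /cabs2 /= -mulNr ![(_ + _)^-1 * _]mulrC !eqxx.
split; under eq_fun do rewrite E /=.
  exact: measurable_funM.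
by apply: measurable_funM => //; exact: measurableT_comp.
Qed.

Lemma cmeasX d (T : measurableType d) (f : T -> C) p : cmeas f -> cmeas (fun t => f t ^+ p).
Proof.
move=> mf; elim: p => [|p IH]; first by under eq_fun do rewrite expr0; exact: cmeas_cst.
by under eq_fun do rewrite exprS; exact: cmeasM.
Qed.

(** [a'] is the adjoint of [A] applied to [a]; with it the numerator of a slice is visibly
    affine. *)
Lemma cinner_mulmx (A : 'M[C]_N) (a : V) : exists a' : V, forall z, cinner (z *m A^T) a = cinner z a'.
Proof.
exists (\row_j conjc (\sum_i A i j * conjc (a ord0 i))) => z.
rewrite /cinner; under eq_bigr do rewrite mxE mulr_suml.
rewrite exchange_big /=; apply: eq_bigr => j _; rewrite mxE conjcK mulr_sumr.
by apply: eq_bigr => i _; rewrite mxE mulrA.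
Qed.

Section LinFrac.
Variables (A : 'M[C]_N) (B Cv : V) (d : C).
Hypothesis Hphi : lf_selfmap A B Cv d.

Lemma linfrac_const_neq0 : d != 0.
Proof.
have := Hphi.1 0; rewrite /Bball /= (vnorm2_lt1_0 R n) => /(_ isT).
by rewrite /cinner big1 ?add0r// => j _; rewrite mxE mul0r.
Qed.

(* Otherwise the denominator vanishes at [- d C / |C|^2], which lies in the ball. *)
Lemma linfrac_coef_le : vnorm Cv <= nc d.
Proof.
rewrite leNgt; apply/negP => h.
have c0 : 0 < vnorm Cv by apply: le_lt_trans h; exact: nc_ge0.
have c0' : vnorm Cv != 0 by rewrite gt_eqF.
pose z : V := (- d * ((vnorm Cv) ^- 2)%:C%C) *: Cv.
have z1 : vnorm z < 1.
  rewrite vnormZc ncM ncN nc_real ger0_norm ?invr_ge0 ?exprn_ge0 ?vnorm_ge0//.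
  by rewrite expr2 invfM mulrA mulfVK// ltr_pdivrMr// mul1r.
have := Hphi.1 z; rewrite /Bball /= -vnorm_lt1 z1 => /(_ isT) /eqP; apply.
rewrite cinnerZl cinner_self -mulrA -rmorphM /= -vnorm_sqr mulVf ?expf_neq0//.
by rewrite mulr1 addNr.
Qed.

(** From [|<z, Cv>| <= |z| |Cv| <= |z| |d|]. *)
Lemma linfrac_den_ge (z : V) : nc d * (1 - vnorm z) <= nc (cinner z Cv + d).
Proof.
have h : nc d <= nc (cinner z Cv + d) + nc (cinner z Cv).
  by have := ncB (cinner z Cv + d) (cinner z Cv); rewrite addrAC subrr add0r.
have := cauchy_schwarz z Cv.
have := ler_wpM2l (vnorm_ge0 z) linfrac_coef_le; lra.
Qed.

Lemma linfrac_vnorm (z : V) : vnorm z < 1 -> vnorm (linfrac A B Cv d z) < 1.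
Proof. by rewrite !vnorm_lt1; exact: Hphi.2. Qed.

Lemma one_sub_cinner_ge (a z : V) : vnorm z < 1 -> 1 - vnorm a <= nc (1 - cinner (linfrac A B Cv d z) a).
Proof.
move=> /linfrac_vnorm h; set w := linfrac _ _ _ _ _ in h *.
have := cauchy_schwarz w a; have := ler_wpM2r (vnorm_ge0 a) (ltW h); rewrite mul1r.
have := ncD (1 - cinner w a) (cinner w a); rewrite addrNK nc1; lra.
Qed.

(** On a disc, numerator and denominator of the map are affine in [l]; the two inversions are
    controlled by the lower bounds [|d| (1 - rho)] and [(1 - |a|)^p]. *)
Lemma slice_regular_szego p k (a : V) : vnorm a < 1 ->
  slice_regular (fun z => szego p k a (linfrac A B Cv d z)).
Proof.
move=> a1; have [a' ha'] := cinner_mulmx A a.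
have E z : szego p k a (linfrac A B Cv d z) =
  k * ((1 - (cinner z a' + cinner B a) * (cinner z Cv + d)^-1) ^+ p)^-1.
  by rewrite /szego /linfrac cinnerZl cinnerDl ha' [_^-1 * _]mulrC.
split=> [e T Z mZ|rho r1].
  under eq_fun do rewrite E.
  apply: cmeasM; first exact: cmeas_cst.
  apply: cmeasV; apply: cmeasX; under eq_fun do rewrite -mulN1r.
  apply: cmeasD; first exact: cmeas_cst.
  apply: cmeasM; first exact: cmeas_cst.
  apply: cmeasM; first by apply: cmeasD; [exact: vmeas_cinner|exact: cmeas_cst].
  by apply: cmeasV; apply: cmeasD; [exact: vmeas_cinner|exact: cmeas_cst].
have d0 : 0 < nc d by rewrite lt_neqAle eq_sym nc_eq0 linfrac_const_neq0 nc_ge0.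
pose e1 := nc d * (1 - rho); have e10 : 0 < e1 by rewrite mulr_gt0// subr_gt0.
pose e2 := 1 - vnorm a; have e20 : 0 < e2 by rewrite subr_gt0.
eexists => c y c1 y1 cy.
have den_ge l : nc l <= 1 -> e1 <= nc (cinner c Cv + d + l * cinner y Cv).
  move=> /cy h; have := linfrac_den_ge (c + l *: y); rewrite cinnerDl cinnerZl addrAC.
  by apply: le_trans; rewrite ler_wpM2l ?nc_ge0//; lra.
have aff (b : V) (x : C) : QDisc (fun l => cinner c b + x + l * cinner y b) (vnorm b + nc x + vnorm b).
  apply: QDisc_affine.
    apply: le_trans (ncD _ _) _; rewrite lerD2r; apply: le_trans (cauchy_schwarz _ _) _.
    by rewrite ler_piMl ?vnorm_ge0.
  by apply: le_trans (cauchy_schwarz _ _) _; rewrite ler_piMl ?vnorm_ge0.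
have H1 := QDiscM (aff a' (cinner B a)) (QDiscV e10 den_ge (aff Cv d)).
have H2 := QDiscB (QDisc_cst 1) H1.
have H3 := QDiscX p H2.
have e2p : 0 < e2 ^+ p by rewrite exprn_gt0.
have low l : nc l <= 1 -> e2 ^+ p <= nc ((1 - (cinner c a' + cinner B a + l * cinner y a') * (cinner c Cv + d + l * cinner y Cv)^-1) ^+ p).
  move=> l1; have z1 := le_lt_trans (cy l l1) r1.
  rewrite ncX lerXn2r ?nnegrE ?nc_ge0 ?(ltW e20)//.
  have := one_sub_cinner_ge a z1; rewrite /linfrac cinnerZl (cinnerDl (_ *m _)) ha' !cinnerDl !cinnerZl.
  by rewrite [_^-1 * _]mulrC (addrAC (cinner c a')) (addrAC (cinner c Cv)).
have EE l : k * ((1 - (cinner c a' + cinner B a + l * cinner y a') * (cinner c Cv + d + l * cinner y Cv)^-1) ^+ p)^-1 =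
    szego p k a (linfrac A B Cv d (c + l *: y)).
  by rewrite E !cinnerDl !cinnerZl (addrAC (cinner c a') (cinner B a)) (addrAC (cinner c Cv) d).
have := QDiscM (QDisc_cst k) (QDiscV e2p low H3).
under eq_fun do rewrite EE.
exact.
Qed.

End LinFrac.
End Slices.

(** * Point evaluation through an ellipsoid *)

Section PointEval.
Variable R : realType.
Variable n : nat.
Local Notation C := (R[i]).
Local Notation N := n.+1.
Local Notation V := 'rV[C]_N.
Local Notation leb := (@lebesgue_measure R).

(** The first coordinate has real part between [1 - 5d/4] and [1 - 3d/4], and everything else
    contributes at most [d / 16] to the squared norm. *)
Lemma ellipsoid_bounds (d a b S : R) : 0 < d -> d <= 1 / 2 -> 0 <= S -> a ^+ 2 + b ^+ 2 + S <= 1 ->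
  d / 2 <= 1 - ((1 - d + d / 4 * a) ^+ 2 + (d / 4 * b) ^+ 2 + d / 16 * S) /\
  1 - ((1 - d + d / 4 * a) ^+ 2 + (d / 4 * b) ^+ 2 + d / 16 * S) <= 4 * d /\
  0 < (1 - d + d / 4 * a) ^+ 2 + (d / 4 * b) ^+ 2 + d / 16 * S.
Proof.
move=> d0 d1 S0 abS; have b0 := sqr_ge0 b.
have [a1 a2] : - 1 <= a /\ a <= 1 by split; nra.
have u : 1 - 5 / 4 * d <= 1 - d + d / 4 * a by nra.
have u' : 1 - d + d / 4 * a <= 1 - 3 / 4 * d by nra.
have u0 : 0 < 1 - 5 / 4 * d by lra.
have w0 := sqr_ge0 (d / 4 * b).
have s0 : 0 <= d / 16 * S by rewrite mulr_ge0// divr_ge0// ltW.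
have hu : (1 - 5 / 4 * d) ^+ 2 <= (1 - d + d / 4 * a) ^+ 2 by rewrite ler_sqr ?nnegrE; lra.
have hu' : (1 - d + d / 4 * a) ^+ 2 <= (1 - 3 / 4 * d) ^+ 2 by rewrite ler_sqr ?nnegrE; lra.
have hb : (d / 4 * b) ^+ 2 + d / 16 * S <= d / 16.
  have : (d / 4 * b) ^+ 2 <= d / 16 * b ^+ 2.
    by rewrite exprMn ler_wpM2r// expr_div_n; nra.
  have : d / 16 * (b ^+ 2 + S) <= d / 16 by rewrite ler_piMr ?divr_ge0 ?(ltW d0)//; have := sqr_ge0 a; lra.
  by rewrite mulrDr; lra.
have e1 : (1 - 3 / 4 * d) ^+ 2 + d / 16 <= 1 - d / 2 by nra.
have e2 : 1 - 4 * d <= (1 - 5 / 4 * d) ^+ 2 by nra.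
have e3 : 0 < (1 - 5 / 4 * d) ^+ 2 by rewrite exprn_gt0.
split; [lra|split; lra].
Qed.

Definition ell_scale (d : R) (j : 'I_N) : R := if j == ord0 then d / 4 else Num.sqrt d / 4.
Definition ell_map (d : R) (z : V) : V := \row_j ((ell_scale d j)%:C%C * z ord0 j).
Definition unit_e0 : V := delta_mx ord0 ord0.

Lemma vnorm2_ell (d : R) (z : V) : 0 <= d ->
  vnorm2 (ell_map d z + (1 - d)%:C%C *: unit_e0) =
  (1 - d + d / 4 * complex.Re (z ord0 ord0)) ^+ 2 + (d / 4 * complex.Im (z ord0 ord0)) ^+ 2 +
  d / 16 * \sum_(j < n) cabs2 (z ord0 (lift ord0 j)).
Proof.
move=> d0; rewrite /vnorm2 big_ord_recl; congr (_ + _).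
  rewrite !mxE /ell_scale !eqxx mulr1; case: (z ord0 ord0) => a b.
  by rewrite /cabs2 /=; ring.
rewrite mulr_sumr; apply: eq_bigr => j _; rewrite !mxE /ell_scale eqxx /=.
rewrite mulr0 addr0 cabs2Z expr_div_n sqr_sqrtr//; congr (_ * _); by field.
Qed.

Lemma ell_in_shell (d : R) (z : V) : 0 < d -> d <= 1 / 2 -> vnorm2 z <= 1 ->
  let x := vnorm2 (ell_map d z + (1 - d)%:C%C *: unit_e0) in
  [/\ 0 < x, d / 2 <= 1 - x & 1 - x <= 4 * d].
Proof.
move=> d0 d1 z1 x; rewrite /x vnorm2_ell ?(ltW d0)//.
have S0 : 0 <= \sum_(j < n) cabs2 (z ord0 (lift ord0 j)) by apply: sumr_ge0 => j _; exact: cabs2_ge0.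
have := @ellipsoid_bounds d (complex.Re (z ord0 ord0)) (complex.Im (z ord0 ord0)) _ d0 d1 S0.
by move: z1; rewrite /vnorm2 big_ord_recl => h /(_ h) [h1 [h2 h3]].
Qed.

Definition shell (d r : R) : \bar R :=
  if [&& 0 < r, r < 1, d / 2 <= 1 - r ^+ 2 & 1 - r ^+ 2 <= 4 * d] then 1%E else 0%E.

Lemma shell_ge0 d r : (0 <= shell d r)%E. Proof. by rewrite /shell; case: ifP. Qed.

Lemma measurable_shell d : measurable_fun setT (shell d).
Proof.
apply: measurable_fun_ifT => //.
have m2 : measurable_fun setT (fun r : R => 1 - r ^+ 2) by apply: measurable_funB => //; exact: measurable_funX.
by repeat (apply: measurable_and; first by [exact: measurable_fun_ltr|exact: measurable_fun_ler]); exact: measurable_fun_ler.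
Qed.

(** On the shell, [r >= r^2 >= 1 - 4 d]. *)
Lemma integral_shell d : 0 < d -> (\int[leb]_r shell d r <= (4 * d)%:E)%E.
Proof.
move=> d0; apply: (@le_trans _ _ (\int[leb]_r (\1_(`[1 - 4 * d, 1]%classic : set R) r)%:E)%E).
  apply: le_integral_ge0; first exact: shell_ge0.
  move=> r; rewrite /shell; case: ifP => [/and4P[r0 r1 _ h]|_]; last by rewrite lee_fin indicE.
  by rewrite indicE mem_set// /= in_itv /=; apply/andP; split; nra.
rewrite (_ : (\int[leb]_r _)%E = leb `[1 - 4 * d, 1]%classic); last by rewrite integral_indic// setIT.
rewrite lebesgue_measure_itv /= lte_fin.
by case: ifP => _; rewrite ?lee_fin -?EFinB ?lee_fin; lra.
Qed.

(** A slice [l z] goes to a disc centred at [(1 - d) M e_0], and the shell bound keeps it in the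
    ball of radius [sqrt (1 - d/2)], where the constant of [slice_regular] is uniform. *)
Lemma slice_regular_ell (h : V -> C) (M : V -> V) (d : R) :
  (forall z w, M (z + w) = M z + M w) -> (forall (c : C) z, M (c *: z) = c *: M z) ->
  (forall z, vnorm2 (M z) = vnorm2 z) ->
  (forall e (T : measurableType e) (Z : T -> V), vmeas Z -> vmeas (fun t => M (Z t))) ->
  0 < d -> d <= 1 / 2 -> slice_regular h ->
  exists K, CRball (fun z => h (M (ell_map d z + (1 - d)%:C%C *: unit_e0))) K.
Proof.
move=> MD MZ Mn mM d0 d1 [mh hh].
have r1 : Num.sqrt (1 - d / 2) < 1 by rewrite -[ltRHS]sqrtr1 ltr_sqrt//; lra.
have [K hK] := hh _ r1; exists K; split=> [e T Z mZ|z z1].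
  apply: mh; apply: mM; apply: vmeasD; last exact: vmeas_cst.
  move=> j; have H : cmeas (fun t => ell_map d (Z t) ord0 j); last exact: H.
  by under eq_fun do rewrite mxE; apply: cmeasM; [exact: cmeas_cst|exact: mZ].
have E l : M (ell_map d (l *: z) + (1 - d)%:C%C *: unit_e0) = (1 - d)%:C%C *: M unit_e0 + l *: M (ell_map d z).
  rewrite MD addrC (MZ (1 - d)%:C%C) -(MZ l); congr (_ + _); congr (M _).
  by apply/rowP => j; rewrite !mxE mulrCA.
have Me : vnorm (M unit_e0) = 1.
  rewrite /vnorm Mn /vnorm2 (bigD1 ord0)//= big1 ?addr0.
    by rewrite mxE !eqxx /cabs2 /= expr0n addr0 expr1n sqrtr1.
  by move=> j j0; rewrite mxE (negbTE j0) andbF /cabs2 /= expr0n addr0.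
have c1 : vnorm ((1 - d)%:C%C *: M unit_e0) <= 1 by rewrite vnormZ ?Me; lra.
have vl l : nc l <= 1 -> vnorm2 (l *: z) <= 1.
  move=> l1; rewrite vnorm2Zc -nc_sqr.
  by rewrite mulr_ile1 ?sqr_ge0 ?vnorm2_ge0 ?expr_le1 ?nc_ge0// ltW.
have y1 : vnorm (M (ell_map d z)) <= 1.
  rewrite /vnorm Mn -[leRHS]sqrtr1; apply: ler_wsqrtr.
  apply: le_trans (ltW z1); apply: ler_sum => j _; rewrite mxE cabs2Z ler_piMl ?cabs2_ge0//.
  have s1 : Num.sqrt d <= 1 by rewrite -[leRHS]sqrtr1 ler_wsqrtr; lra.
  have s0 := sqrtr_ge0 d; rewrite /ell_scale; case: ifP => _; rewrite expr_le1//; lra.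
have cy l : nc l <= 1 -> vnorm ((1 - d)%:C%C *: M unit_e0 + l *: M (ell_map d z)) <= Num.sqrt (1 - d / 2).
  move=> l1; rewrite -E /vnorm Mn; apply: ler_wsqrtr.
  by have [_ le2 _] := ell_in_shell d0 d1 (vl l l1); lra.
have := hK _ _ c1 y1 cy; rewrite /QDisc.
have E' l : h ((1 - d)%:C%C *: M unit_e0 + l *: M (ell_map d z)) = h (M (ell_map d (l *: z) + (1 - d)%:C%C *: unit_e0)).
  by rewrite E.
move=> [q1 q2 q3]; split.
- by move=> l l1; rewrite -E'; exact: q1.
- by move=> l m l1 m1; rewrite -!E'; exact: q2.
- by move=> l l1; have [q hq] := q3 l l1; exists q => m m1; rewrite -!E'; exact: hq.
Qed.

(** This is [submean_ball] for [h] composed with the affine map of the unit ball onto the ellipsoid;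
    the change of variables brings in the reciprocal Jacobian, and the ellipsoid lies in the
    shell. *)
Lemma point_eval_shell (h : V -> C) (d : R) (zeta : V) : vnorm2 zeta = 1 ->
  0 < d -> d <= 1 / 2 -> slice_regular h ->
  vfmeas (fun z => if (vnorm2 z < 1)%R then (cabs2 (h z))%:E else 0%E) ->
  ((cabs2 (h ((1 - d)%:C%C *: zeta)) * bvol R n)%:E <= (16 ^+ N * d ^- n.+2)%:E *
    lebint (fun z => shell d (vnorm z) * (if (vnorm2 z < 1)%R then (cabs2 (h z))%:E else 0)))%E.
Proof.
move=> z1 d0 d1 hh mH.
have [M [M' [[MD MZ MK Mn] [mM Me _]]]] := unitary_existence z1.
have [K HK] := slice_regular_ell MD MZ Mn mM d0 d1 hh.
have := submean_ball HK.
have -> : M (ell_map d 0 + (1 - d)%:C%C *: unit_e0) = (1 - d)%:C%C *: zeta.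
  rewrite (_ : ell_map d 0 = 0) ?add0r ?MZ ?Me//.
  by apply/rowP => j; rewrite !mxE mulr0.
move=> H; apply: le_trans H _.
set H := (fun z : V => if _ then _ else _) in mH *.
pose g (x : V) : \bar R := (shell d (vnorm x) * H (M x))%E.
have mS : vfmeas (fun z : V => shell d (vnorm z)).
  split=> [z|e T Z mZ]; first exact: shell_ge0.
  by apply: (measurableT_comp (measurable_shell d)); exact: measurable_vnorm.
have mg : vfmeas g by apply: vfmeasM => //; exact: vfmeas_comp mH mM.
have sc j : 0 < ell_scale d j by rewrite /ell_scale; case: ifP => _; rewrite divr_gt0 ?sqrtr_gt0.
(* One radial scale [d / 4] and [n] tangential scales [sqrt d / 4], each squared:
   [(16 / d^2) (16 / d)^n]. *)
have P : \prod_(i < N) (ell_scale d i ^- 2) = 16 ^+ N * d ^- n.+2.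
  rewrite big_ord_recl /ell_scale eqxx /=; under eq_bigr do rewrite /=.
  rewrite prodr_const card_ord expr_div_n expr_div_n sqr_sqrtr ?(ltW d0)//.
  have -> : d ^+ n.+2 = d ^+ 2 * d ^+ n by rewrite -exprD.
  have -> : (4 : R) ^+ 2 = 16 by ring.
  rewrite !invf_div expr_div_n (exprS 16 n).
  have : d ^+ n != 0 by rewrite expf_neq0 ?gt_eqF.
  move: (d ^+ n) (16 ^+ n) => u w u0; field.
  by rewrite u0 gt_eqF.
have LA := @lebint_affine R n (ell_scale d) ((1 - d)%:C%C *: unit_e0) g sc mg.
have LI : lebint g = lebint (fun z => (shell d (vnorm z) * H z)%E).
  have mSH : vfmeas (fun z : V => (shell d (vnorm z) * H z)%E) by exact: vfmeasM.
  rewrite -(lebint_isometry MD MK Mn mM mSH); apply: eq_lebint => z.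
  by rewrite /g /vnorm Mn.
rewrite -LI -P -LA.
have bE (F : V -> R) : bint F = lebint (fun z => if (vnorm2 z < 1)%R then (F z)%:E else 0%E) by [].
rewrite bE; apply: le_lebint => z.
  by case: ifP => _; [rewrite lee_fin cabs2_ge0|exact: lexx].
case: ifP => [zl|_]; last exact: mg.1.
have -> : (\row_j ((ell_scale d j)%:C%C * z ord0 j + ((1 - d)%:C%C *: unit_e0) ord0 j) : V) = ell_map d z + (1 - d)%:C%C *: unit_e0.
  by apply/rowP => j; rewrite !mxE.
have [s1 s2 s3] := ell_in_shell d0 d1 (ltW zl).
rewrite /g /H Mn; set x := ell_map d z + _ in s1 s2 s3 *.
have x1 : vnorm2 x < 1 by lra.
by rewrite /shell x1 vnorm_lt1 x1 vnorm_sqr s2 s3 sqrtr_gt0 s1 /= mul1e.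
Qed.

(** The lower end of the range serves [a >= 0], the upper end [a < 0]; [4^(-|a|)] covers both. *)
Lemma powR_shell (a d t : R) : 0 < d -> d / 2 <= t -> t <= 4 * d ->
  4 `^ (- `|a|) * d `^ a <= t `^ a.
Proof.
move=> d0 t1 t2; have t0 : 0 < t by apply: lt_le_trans t1; rewrite divr_gt0.
have [a0|a0] := leP 0 a.
  rewrite ger0_norm//.
  apply: (@le_trans _ _ ((d / 2) `^ a)); last first.
    by apply: ge0_ler_powR => //; rewrite nnegrE ?divr_ge0// ltW.
  rewrite powRM ?invr_ge0 ?(ltW d0)// mulrC ler_wpM2l ?powR_ge0//.
  rewrite -[2^-1]powR_inv1// -powRrM mulN1r powRN powRN lef_pV2 ?posrE ?powR_gt0//.
  by apply: ge0_ler_powR; rewrite ?nnegrE//; lra.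
rewrite ltr0_norm// opprK -powRM ?(ltW d0)//.
have E (x : R) : 0 < x -> x `^ a = (x `^ (- a))^-1 by move=> x0; rewrite powRN invrK.
rewrite (E t t0) (E (4 * d)) ?mulr_gt0// lef_pV2 ?posrE ?powR_gt0 ?mulr_gt0//.
apply: ge0_ler_powR => //; rewrite ?nnegrE ?mulr_ge0 ?(ltW t0) ?(ltW d0)//; lra.
Qed.

(** Hardy: each sphere mean is bounded by the squared norm and the shell has radial length [O(d)],
    which turns [d^-(N+1)] into [d^-N]. Bergman: on the shell the weight is at least a multiple of
    [d^a], so inserting it costs [d^-a]. *)
Lemma point_eval (sp : fspace R) : (forall a, sp = Bergman a -> -1 < a) ->
  exists K : R, 0 < K /\ forall (h : V -> C) (d : R) (zeta : V), vnorm2 zeta = 1 ->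
  0 < d -> d <= 1 / 2 -> slice_regular h ->
  vfmeas (fun z => if (vnorm2 z < 1)%R then (cabs2 (h z))%:E else 0%E) ->
  ((cabs2 (h ((1 - d)%:C%C *: zeta)) * d `^ (hexp n sp))%:E <= K%:E * Hnorm2 sp h)%E.
Proof.
move=> hsp; have v0 := bvol_gt0 R n.
have EV : ball_volume R n = bvol R n by [].
(* [w] bounds the mass of [|h|^2] on the shell in terms of [X]; [c] is what remains once the powers
   of [d] are collected. *)
have key (h : V -> C) (d : R) (zeta : V) (w c : R) (X : \bar R) : vnorm2 zeta = 1 ->
  0 < d -> d <= 1 / 2 -> slice_regular h -> 0 <= w -> w * d ^- n.+2 * d `^ (hexp n sp) = c ->
  vfmeas (fun z => if (vnorm2 z < 1)%R then (cabs2 (h z))%:E else 0%E) ->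
  (lebint (fun z => shell d (vnorm z) * (if (vnorm2 z < 1)%R then (cabs2 (h z))%:E else 0)) <= w%:E * X)%E ->
  ((cabs2 (h ((1 - d)%:C%C *: zeta)) * d `^ (hexp n sp))%:E <= (16 ^+ N * c / bvol R n)%:E * X)%E.
  move=> z1 d0 d1 hh w0 <- mH L; have := point_eval_shell z1 d0 d1 hh mH.
  set Y := cabs2 _ => H.
  have p0 : 0 <= d `^ hexp n sp by exact: powR_ge0.
  have c0 : 0 <= 16 ^+ N * d ^- n.+2 by rewrite mulr_ge0 ?invr_ge0 ?exprn_ge0 ?(ltW d0).
  have {}H := le_trans H (lee_wpmul2l (_ : (0 <= (16 ^+ N * d ^- n.+2)%:E)%E) L).
  have {}H := H c0.
  have p1 : 0 <= d `^ hexp n sp / bvol R n by rewrite divr_ge0 ?(ltW v0).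
  have {}H := lee_wpmul2l (_ : (0 <= (d `^ hexp n sp / bvol R n)%:E)%E) H.
  have {}H := H p1.
  rewrite -EFinM !muleA -!EFinM in H.
  have -> : Y * d `^ hexp n sp = d `^ hexp n sp / bvol R n * (Y * bvol R n).
    by field; rewrite gt_eqF.
  have -> : 16 ^+ N * (w / d ^+ n.+2 * d `^ hexp n sp) / bvol R n = d `^ hexp n sp / bvol R n * (16 ^+ N / d ^+ n.+2) * w by ring.
  exact: H.
case: sp hsp key => [|a] hsp key.
- exists (16 ^+ N * (2 ^+ N.*2.+1 * 4 * bvol R n) / bvol R n); split.
    by rewrite divr_gt0// mulr_gt0 ?exprn_gt0// mulr_gt0// mulr_gt0 ?exprn_gt0.
  move=> h d zeta z1 d0 d1 hh mH.
  (* The factors are the constant of [polar_le], the length [4 d] of the shell and the missing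
     normalisation of [sphere_avg]. *)
  apply: (key _ _ _ (2 ^+ N.*2.+1 * 4 * bvol R n * d)) => //.
  + apply: mulr_ge0 (ltW d0); apply: mulr_ge0 (ltW v0); apply: mulr_ge0 => //; exact: exprn_ge0.
  + rewrite /hexp powR_mulrn ?(ltW d0)// [d ^+ n.+2]exprS; field.
    by rewrite !gt_eqF ?exprn_gt0.
  set H := (fun z : V => if _ then _ else _) in mH *.
  have supp r : ~~ ((0 < r)%R && (r < 1)%R) -> shell d r = 0%E.
    by rewrite /shell; case: ifP => // /and4P[-> ->].
  apply: le_trans (polar_le (measurable_shell d) (shell_ge0 d) supp mH) _.
  have H0 : (0 <= Hnorm2 Hardy h)%E.
    apply: ereal_sup_ge; exists (sigma_int (fun zeta => (cabs2 (h ((1 / 2)%:C%C *: zeta)))%:E)).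
      by exists (1 / 2) => //=; rewrite in_itv /=; apply/andP; split; lra.
    rewrite /sigma_int /nu_int mule_ge0// ?lee_fin ?invr_ge0 ?(ltW v0)//.
    by apply: lebint_ge0 => z; case: ifP => // _; rewrite lee_fin cabs2_ge0.
  set X := Hnorm2 Hardy h in H0 *.
  have sl r : 0 < r -> r < 1 -> (sphere_avg H r <= (bvol R n)%:E * X)%E.
    move=> r0 r1.
    have : (sigma_int (fun zeta => (cabs2 (h (r%:C%C *: zeta)))%:E) <= X)%E.
      by apply: ereal_sup_ubound; exists r => //=; rewrite in_itv /= r0.
    rewrite /sigma_int /nu_int EV => L.
    have {}L := lee_wpmul2l (_ : (0 <= (bvol R n)%:E)%E) L.
    have {}L := L (ltW v0).
    apply: le_trans L; rewrite muleCA -EFinM mulfV ?gt_eqF// mule1.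
    apply: le_lebint => z.
      by case: ifP => // _; exact: mH.1.
    case: ifP => // zl; rewrite /H; case: ifP => // _.
    by rewrite lee_fin cabs2_ge0.
  apply: (@le_trans _ _ ((2 ^+ N.*2.+1)%:E * \int[leb]_r ((bvol R n)%:E * X * shell d r))%E).
    apply: lee_wpmul2l; first by rewrite lee_fin exprn_ge0.
    apply: le_integral_ge0 => r.
      rewrite mule_ge0 ?shell_ge0//; apply: lebint_ge0 => z; case: ifP => // _; exact: mH.1.
    have [/andP[r0 r1]|hr] := boolP ((0 < r) && (r < 1)); last by rewrite supp// mul0e mule0.
    by rewrite muleC; apply: lee_wpmul2r; [exact: shell_ge0|exact: sl].
  rewrite integralZl_leb; first last.
  + exact: shell_ge0.
  + exact: measurable_shell.
  + by rewrite mule_ge0// lee_fin ltW.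
  have -> : (2 ^+ N.*2.+1 * 4 * bvol R n * d) = 2 ^+ N.*2.+1 * (bvol R n * (4 * d)) by ring.
  rewrite (EFinM (2 ^+ N.*2.+1)) -[X in (_ <= X)%E]muleA; apply: lee_wpmul2l; first by rewrite lee_fin exprn_ge0.
  rewrite (EFinM (bvol R n)) -muleA -[X in (_ <= X)%E]muleA; apply: lee_wpmul2l; first by rewrite lee_fin ltW.
  rewrite muleC; apply: lee_wpmul2r => //; exact: integral_shell.
- have a1 := hsp a erefl; have k0 := bergman_cst_gt0 n a1.
  pose c := 4 `^ (- `|a|) : R; have c0 : 0 < c by rewrite powR_gt0.
  exists (16 ^+ N * (c^-1 * (bvol R n / bergman_cst n a)) / bvol R n); split.
    by rewrite divr_gt0// mulr_gt0 ?exprn_gt0// mulr_gt0 ?invr_gt0// divr_gt0.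
  move=> h d zeta z1 d0 d1 hh mH; have da : 0 < d `^ a by rewrite powR_gt0.
  apply: (key _ _ _ (c^-1 * (d `^ a)^-1 * (bvol R n / bergman_cst n a))) => //.
  + by rewrite !mulr_ge0 ?invr_ge0 ?(ltW v0) ?(ltW c0) ?(ltW da) ?(ltW k0).
  + have -> : hexp n (Bergman a) = a - - (n.+2)%:R by rewrite /hexp -(natr1 n.+1); ring.
    rewrite powRD; last by rewrite (gt_eqF d0) implybT.
    rewrite opprK powR_mulrn ?(ltW d0)//; field.
    by rewrite !gt_eqF ?exprn_gt0.
  rewrite (Hnorm2_bergman a1 mH) muleA -EFinM EV.
  have -> : c^-1 * (d `^ a)^-1 * (bvol R n / bergman_cst n a) * (bergman_cst n a / bvol R n) = (c * d `^ a)^-1.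
    have gen (x y u v : R) : u != 0 -> v != 0 -> x^-1 / y * (u / v) * (v / u) = (x * y)^-1.
      by move=> u0 v0'; rewrite -[_ * (u / v) * _]mulrA mulf_div (mulrC v) divff ?mulf_neq0// mulr1 invfM.
    by apply: gen; rewrite gt_eqF.
  have mB := vfmeas_bergman a mH.
  have i0 : (0 <= ((c * d `^ a)^-1)%:E)%E by rewrite lee_fin invr_ge0; apply: mulr_ge0; exact: ltW.
  rewrite -(lebintZ i0 mB).
  apply: le_lebint => z; case: ifP => zl; rewrite ?mule0 ?mule_ge0 ?shell_ge0 ?lee_fin ?cabs2_ge0//.
  rewrite /shell; case: ifP => [/and4P[_ _]|_]; last first.
    by rewrite mul0e lee_fin mulr_ge0 ?invr_ge0 ?mulr_ge0 ?cabs2_ge0 ?powR_ge0.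
  rewrite vnorm_sqr => h1 h2; rewrite mul1e lee_fin ler_pdivlMl ?mulr_gt0// mulrC.
  by rewrite ler_wpM2l ?cabs2_ge0//; exact: powR_shell.
Qed.

End PointEval.

(** * Boundary behaviour *)

Section Differentiability.
Variable R : realType.
Variable n : nat.
Local Notation C := (R[i]).
Local Notation N := n.+1.
Local Notation V := 'rV[C]_N.
Local Notation VT := (V : normedModType C).

Lemma differentiable_cinner (a : V) (z : VT) : differentiable ((fun w => cinner w a) : VT -> C^o) z.
Proof.
have -> : ((fun w => cinner w a) : VT -> C^o) = \sum_(j < N) ((fun w : VT => w ord0 j : C^o) * cst (conjc (a ord0 j) : C^o)).
  by apply/funext => w; rewrite fct_sumE /cinner.
apply: differentiable_sum => j; apply: differentiableM; last exact: differentiable_cst.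
exact: differentiable_coord.
Qed.

Lemma differentiable_affine_cinner (a : V) (x : C) (z : VT) : differentiable ((fun w => cinner w a + x) : VT -> C^o) z.
Proof. exact: differentiableD (differentiable_cinner a z) (differentiable_cst _ _). Qed.

Lemma differentiable_szego p k (a : V) (z : VT) : 1 - cinner z a != 0 ->
  differentiable (szego p k a : VT -> C^o) z.
Proof.
move=> nz.
have d1 : differentiable ((fun w => 1 - cinner w a) : VT -> C^o) z.
  exact: differentiableB (differentiable_cst _ _) (differentiable_cinner a z).
have d2 : differentiable ((fun w => (1 - cinner w a) ^+ p) : VT -> C^o) z.
  case: p => [|p].
    rewrite (_ : (fun _ => _) = cst (1 : C^o)); first exact: differentiable_cst.
    by apply/funext => w; rewrite expr0.
  have := @differentiableX _ _ _ p _ d1.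
  by rewrite (_ : _ ^+ p.+1 = (fun w => (1 - cinner w a) ^+ p.+1))//; apply/funext => w; rewrite fctE.
have d3 : differentiable ((fun w => ((1 - cinner w a) ^+ p)^-1) : VT -> C^o) z.
  by apply: (differentiableV d2); rewrite expf_neq0.
exact: (differentiableM (differentiable_cst (k : C^o) z) d3).
Qed.

Lemma differentiable_linfrac (A : 'M[C]_N) (B Cv : V) (d : C) (z : VT) : cinner z Cv + d != 0 ->
  differentiable (linfrac A B Cv d : VT -> VT) z.
Proof.
move=> nz.
have d1 : differentiable ((fun w => (cinner w Cv + d)^-1) : VT -> C^o) z.
  by apply: (differentiableV (differentiable_affine_cinner Cv d z)).
pose g (j : 'I_N) : VT -> C^o := fun w => (cinner w Cv + d)^-1 * (cinner w (map_mx conjc (row j A)) + B ord0 j).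
have dg j : differentiable (g j) z.
  exact: (differentiableM d1 (differentiable_affine_cinner (map_mx conjc (row j A)) (B ord0 j) z)).
have -> : (linfrac A B Cv d : VT -> VT) = \sum_(j < N) (fun w : VT => g j w *: (delta_mx ord0 j : VT)).
  apply/funext => w; rewrite fct_sumE; apply/rowP => j.
  rewrite summxE (bigD1 j)//= big1 => [|i ij]; last by rewrite !mxE (eq_sym j) (negbTE ij) andbF mulr0.
  rewrite addr0 !mxE !eqxx mulr1 /g; congr (_ * (_ + _)).
  by apply: eq_bigr => i _; rewrite !mxE conjcK.
by apply: differentiable_sum => j; apply: differentiableZl.
Qed.

Lemma cvg_realC (u : nat -> R) (l : R) : u @ \oo --> l -> ((fun k => (u k)%:C%C : C^o) @ \oo --> (l%:C%C : C^o)).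
Proof.
move=> /cvgrPdist_lt h; apply/cvgrPdist_lt => e /gtc0_real [r r0 ->].
near=> k; rewrite -rmorphB /= ncE nc_real ltcR.
near: k; exact: h.
Unshelve. all: by end_near. Qed.

Lemma cvgcD (u v : nat -> C^o) (l m : C) : u @ \oo --> (l : C^o) -> v @ \oo --> (m : C^o) ->
  (fun k => u k + v k : C^o) @ \oo --> (l + m : C^o).
Proof. by move=> ul vm; exact: (cvgD ul vm). Qed.

Lemma cvgcB (u v : nat -> C^o) (l m : C) : u @ \oo --> (l : C^o) -> v @ \oo --> (m : C^o) ->
  (fun k => u k - v k : C^o) @ \oo --> (l - m : C^o).
Proof. by move=> ul vm; exact: (cvgB ul vm). Qed.

Lemma cvgcM (u v : nat -> C^o) (l m : C) : u @ \oo --> (l : C^o) -> v @ \oo --> (m : C^o) ->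
  (fun k => u k * v k : C^o) @ \oo --> (l * m : C^o).
Proof. by move=> ul vm; exact: (@cvgM C nat \oo _ u v l m ul vm). Qed.

Lemma cvgcV (u : nat -> C^o) (l : C) : l != 0 -> u @ \oo --> (l : C^o) ->
  (fun k => (u k)^-1 : C^o) @ \oo --> (l^-1 : C^o).
Proof. by move=> l0 ul; exact: (@cvgV C nat \oo _ u l l0 ul). Qed.

Lemma cvgcX (u : nat -> C^o) (l : C) p : u @ \oo --> (l : C^o) ->
  (fun k => u k ^+ p : C^o) @ \oo --> (l ^+ p : C^o).
Proof.
move=> ul; elim: p => [|p IH]; first by under eq_fun do rewrite expr0; exact: cvg_cst.
by under eq_fun do rewrite exprS; rewrite exprS; exact: cvgcM.
Qed.

Lemma cabs2_ratio (t : R) (u v : C) p : 0 <= t ->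
  cabs2 ((t%:C%C / u) ^+ p - (t%:C%C / v) ^+ p) = t ^+ p.*2 * cabs2 (u ^- p - v ^- p).
Proof.
move=> t0; rewrite !expr_div_n -mulrBr cabs2M; congr (_ * _).
by rewrite -nc_sqr ncX nc_real ger0_norm// -exprM muln2.
Qed.

Lemma nc_coord_le (z : V) j : nc (z ord0 j) <= vnorm z.
Proof.
apply: ler_wsqrtr; rewrite /vnorm2 (bigD1 j)//= lerDl.
by apply: sumr_ge0 => i _; exact: cabs2_ge0.
Qed.

(** * Radial limits at the boundary point *)

Section Limits.
Variables (d : nat -> R) (zeta : V).
Hypotheses (d0 : forall k, 0 < d k) (dlim : d @ \oo --> (0 : R)) (z1 : vnorm2 zeta = 1).

Let dC : (fun k => (d k)%:C%C : C^o) @ \oo --> (0 : C^o).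
Proof. exact: cvg_realC dlim. Qed.

Let wk k : V := (1 - d k)%:C%C *: zeta.

Lemma cvg_radial : (fun k => wk k : VT) @ \oo --> (zeta : VT).
Proof.
have : (fun k => (1 - d k)%:C%C *: (zeta : VT)) @ \oo --> (1 : C) *: (zeta : VT).
  apply: cvgZr_tmp; have -> : (1 : C) = (1 - 0 : R)%:C%C by rewrite subr0.
  by apply: cvg_realC; apply: cvgB => //; exact: cvg_cst.
by rewrite scale1r.
Qed.

Lemma cvg_cinner_radial (f : VT -> VT) (a : V) : differentiable f (zeta : VT) ->
  (fun k => cinner (f (wk k)) a : C^o) @ \oo --> (cinner (f zeta) a : C^o).
Proof.
move=> df; have h := cvg_continuous_at (differentiable_continuous df) cvg_radial.
exact: (@cvg_continuous_at VT (C^o) (fun w => cinner w a) _ _ (differentiable_continuous (differentiable_cinner a (f zeta))) h).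
Qed.

(** The quotient equals [1 + <(f(w_k) - zeta) / (- d_k), zeta> (1 - d_k)], which contains the
    difference quotient of [f] along [zeta] with step [- d_k]. *)
Lemma cvg_boundary_quotient (f : VT -> VT) : differentiable f (zeta : VT) -> f zeta = zeta ->
  (fun k => (1 - cinner (f (wk k)) (wk k)) / (d k)%:C%C : C^o) @ \oo --> (1 + Dcomp f zeta zeta zeta : C^o).
Proof.
move=> df fz.
have dne k : (d k)%:C%C != 0 :> C.
  by apply/eqP => /complexI h; have := d0 k; rewrite h ltxx.
(* The derivative is a limit along punctured neighbourhoods of 0, so the steps must be nonzero. *)
have sN : (fun k => - (d k)%:C%C : C^o) @ \oo --> (0 : C^o)^'.
  move=> P HP; have /= sc : (fun k => - (d k)%:C%C : C^o) @ \oo --> (0 : C^o).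
    by rewrite -[X in _ --> X]oppr0; exact: cvgN.
  have h : \forall k \near \oo, - (d k)%:C%C != 0 :> C -> P (- (d k)%:C%C) := sc _ HP.
  suff : \forall k \near \oo, P (- (d k)%:C%C) by [].
  by apply: filterS h => k; apply; rewrite oppr_eq0.
have D : (fun k => (- (d k)%:C%C : C)^-1 *: (f (- (d k)%:C%C *: (zeta : VT) + zeta) - f zeta)) @ \oo --> ('d f (zeta : VT) zeta : VT).
  rewrite -(@deriveE _ _ _ f (zeta : VT) (zeta : VT) df); have H : derivable f (zeta : VT) (zeta : VT) := diff_derivable df.
  exact: (cvg_comp _ _ sN H).
have E : (fun k => cinner ((- (d k)%:C%C : C)^-1 *: (f (- (d k)%:C%C *: (zeta : VT) + zeta) - f zeta)) zeta : C^o) @ \oo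
   --> (Dcomp f zeta zeta zeta : C^o).
  exact: (@cvg_continuous_at VT (C^o) (fun w => cinner w zeta) _ _ (differentiable_continuous (differentiable_cinner zeta _)) D).
set s := Dcomp _ _ _ _ in E *.
have F : (fun k => 1 + cinner ((- (d k)%:C%C : C)^-1 *: (f (- (d k)%:C%C *: (zeta : VT) + zeta) - f zeta)) zeta * (1 - (d k)%:C%C) : C^o) @ \oo
   --> (1 + s * (1 - 0) : C^o).
  by apply: cvgcD; [exact: cvg_cst|apply: cvgcM; [exact: E|apply: cvgcB; [exact: cvg_cst|exact: dC]]].
rewrite subr0 mulr1 in F; apply: cvg_trans F; apply: near_eq_cvg; apply: nearW => k /=.
have -> : - (d k)%:C%C *: zeta + zeta = wk k.
  by rewrite /wk -[X in _ + X]scale1r -scalerDl rmorphB /= addrC.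
rewrite cinnerZl cinnerDl cinnerNl fz cinner_self z1 /wk cinnerZr conjc_real rmorphB /=.
by move: (cinner _ _) (dne k) => x y0; field.
Qed.

Hypothesis d1 : forall k, d k <= 1.

Lemma vnorm_radial k : vnorm (wk k) = 1 - d k.
Proof. by rewrite vnormZ ?subr_ge0// /vnorm z1 sqrtr1 mulr1. Qed.

Lemma vnorm_radial_lt1 k : vnorm (wk k) < 1.
Proof. by rewrite vnorm_radial ltrBlDr ltrDl. Qed.

Section SelfMap.
Variables (A : 'M[C]_N) (B Cv : V) (c : C).
Hypothesis Hphi : lf_selfmap A B Cv c.
Local Notation phi := (linfrac A B Cv c).

Lemma radial_gap k : d k <= nc (1 - cinner (phi (wk k)) (wk k)).
Proof.
by have := one_sub_cinner_ge Hphi (wk k) (vnorm_radial_lt1 k); rewrite vnorm_radial opprB addrC subrK.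
Qed.

Lemma linfrac_den_fixed : phi zeta = zeta -> cinner zeta Cv + c != 0.
Proof.
move=> fz; apply/eqP => q0; have : zeta = 0 by rewrite -fz /linfrac q0 invr0 scale0r.
by move=> h; have := vnorm2_lt1_0 R n; rewrite -h z1 ltxx.
Qed.

(** By [radial_gap] the quotients all have modulus at least 1, so their limit is not 0. *)
Lemma one_Dcomp_neq0 : phi zeta = zeta -> 1 + Dcomp phi zeta zeta zeta != 0.
Proof.
move=> fz; apply/eqP => s0.
have := cvg_boundary_quotient (differentiable_linfrac A B (linfrac_den_fixed fz)) fz.
rewrite s0 => /cvg_cabs2/cvgrPdist_lt/(_ _ ltr01) h.
have [k] := filter_ex h; rewrite {1}/cabs2 /= expr0n addr0 sub0r normrN ger0_norm ?cabs2_ge0//.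
rewrite ltNge => /negP; apply; rewrite cabs2M -!nc_sqr -exprMn ncV nc_real ger0_norm ?(ltW (d0 k))//.
by rewrite expr_ge1 ?divr_ge0 ?nc_ge0 ?(ltW (d0 k))// ler_pdivlMr// mul1r radial_gap.
Qed.

Lemma cvg_ratio_fixed : phi zeta = zeta ->
  (fun k => (d k)%:C%C / (1 - cinner (phi (wk k)) (wk k)) : C^o) @ \oo --> ((1 + Dcomp phi zeta zeta zeta)^-1 : C^o).
Proof.
move=> fz; have h := cvg_boundary_quotient (differentiable_linfrac A B (linfrac_den_fixed fz)) fz.
rewrite (_ : (fun k => _) = (fun k => ((1 - cinner (phi (wk k)) (wk k)) / (d k)%:C%C)^-1 : C^o)).
  by apply: (cvgV _ h); exact: one_Dcomp_neq0.
by apply/funext => k; rewrite invf_div.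
Qed.

(** The equality case of Cauchy-Schwarz: [|w - zeta|^2 = |w|^2 - 1 <= 0]. *)
Lemma cinner_eq1 (w : V) : vnorm2 w <= 1 -> cinner w zeta = 1 -> w = zeta.
Proof.
move=> w1 wz; apply/eqP; rewrite -subr_eq0; apply/eqP/vnorm2_eq0/eqP; rewrite eq_le vnorm2_ge0 andbT.
rewrite -lecR -cinner_self cinnerDl !cinnerDr !cinnerNl !cinnerNr.
rewrite (cinnerC zeta w) wz conjc1 !cinner_self z1 opprK addNr addr0.
by rewrite -rmorphB /= lecR subr_le0.
Qed.

(* A zero of the denominator at [zeta] forces the map to be constant along the radius. *)
Lemma linfrac_den0 : cinner zeta Cv + c = 0 -> exists2 w : V, vnorm w < 1 & forall k, phi (wk k) = w.
Proof.
move=> q0; set q := cinner zeta Cv in q0.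
have cE : c = - q by apply/eqP; rewrite -addr_eq0 addrC q0.
have qn0 : q != 0 by have := linfrac_const_neq0 Hphi; rewrite cE oppr_eq0.
have den r : cinner (r%:C%C *: zeta) Cv + c = (r - 1)%:C%C * q.
  by rewrite cinnerZl cE rmorphB /= mulrBl mul1r.
(* On the radius the numerator is smaller than the denominator's modulus [(1 - r) |q|], since the
   image stays in the ball; as [r] tends to 1 this leaves [A zeta + B = 0]. *)
have num0 : zeta *m A^T + B = 0.
  apply/rowP => j; set u := (zeta *m A^T) ord0 j; rewrite [RHS]mxE [LHS]mxE.
  apply/eqP; rewrite -nc_eq0 eq_le nc_ge0 andbT; apply/ler_addgt0Pr => e e0; rewrite add0r.
  have [r [r0 r1 re]] : exists r : R, [/\ 0 <= r, r < 1 & (1 - r) * (nc q + nc u) <= e].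
    pose t := nc q + nc u; have t0 : 0 <= t by rewrite addr_ge0 ?nc_ge0.
    exists (1 - (Num.min 1 (e / (t + 1)))).
    have m0 : 0 < Num.min 1 (e / (t + 1)) by rewrite lt_min ltr01 divr_gt0//; lra.
    have m1 : Num.min 1 (e / (t + 1)) <= 1 by rewrite ge_min lexx.
    have m2 : Num.min 1 (e / (t + 1)) <= e / (t + 1) by rewrite ge_min lexx orbT.
    split; [lra|lra|]; rewrite opprB addrC subrK -/t.
    apply: le_trans (ler_wpM2r t0 m2) _; rewrite mulrAC ler_pdivrMr; last lra.
    by rewrite ler_pM2l//; lra.
  have zb : Bball (r%:C%C *: zeta).
    by rewrite /Bball /= vnorm2Z z1 mulr1 expr_lt1.
  have := Hphi.2 _ zb; rewrite /Bball /= -vnorm_lt1 /linfrac den vnormZc ncV ncM nc_real.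
  have r1' : 0 < 1 - r by rewrite subr_gt0.
  have qp : 0 < nc q by rewrite lt_neqAle eq_sym nc_eq0 qn0 nc_ge0.
  rewrite distrC ger0_norm ?(ltW r1')// ltr_pdivrMl ?mulr_gt0// mulr1 => L.
  have H := le_trans (nc_coord_le _ j) (ltW L); rewrite -scalemxAl !mxE in H.
  have -> : u + B ord0 j = (r%:C%C * u + B ord0 j) + (1 - r)%:C%C * u by rewrite rmorphB /=; ring.
  apply: le_trans (ncD _ _) _; apply: le_trans re; rewrite mulrDr lerD//.
    by rewrite /u mxE.
  by rewrite ncM nc_real ger0_norm// ltW.
(* Now [B = - A zeta], and the factor [- d_k] cancels between numerator and denominator. *)
have E k : phi (wk k) = q^-1 *: (zeta *m A^T).
  rewrite /linfrac /wk den -scalemxAl.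
  have -> : B = - (zeta *m A^T) by apply/eqP; rewrite -addr_eq0 addrC num0.
  have dne : (d k)%:C%C != 0 :> C by apply/eqP => /complexI h; have := d0 k; rewrite h ltxx.
  rewrite -[- (zeta *m A^T)]scaleN1r -scalerDl scalerA; congr (_ *: _).
  by rewrite !rmorphB /=; field; rewrite qn0 addrAC subrr add0r oppr_eq0 dne.
exists (q^-1 *: (zeta *m A^T)) => //.
by rewrite -(E 0%N); apply: (linfrac_vnorm Hphi); exact: vnorm_radial_lt1.
Qed.

(** It is enough that [<phi w_k, zeta>] has a limit other than 1. If the denominator vanishes at
    [zeta], the value [phi zeta] is 0 by convention and unrelated to the radial limit, so
    [linfrac_den0] is used; otherwise [phi] is continuous at [zeta]. *)
Lemma cvg_ratio_away : phi zeta != zeta ->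
  (fun k => (d k)%:C%C / (1 - cinner (phi (wk k)) (wk k)) : C^o) @ \oo --> (0 : C^o).
Proof.
move=> fz.
suff [Y Y0 cY] : exists2 Y : C, Y != 0 & (fun k => cinner (phi (wk k)) zeta : C^o) @ \oo --> (1 - Y : C^o).
  have H : (fun k => (d k)%:C%C * (1 - (1 - (d k)%:C%C) * cinner (phi (wk k)) zeta)^-1 : C^o) @ \oo
      --> (0 * (1 - (1 - 0) * (1 - Y))^-1 : C^o).
    apply: cvgcM; first exact: dC.
    apply: cvgcV; first by rewrite subr0 mul1r opprB addrC subrK.
    apply: cvgcB; first exact: cvg_cst.
    by apply: cvgcM; [apply: cvgcB; [exact: cvg_cst|exact: dC]|exact: cY].
  rewrite mul0r in H; rewrite (_ : (fun k => _) = (fun k => (d k)%:C%C * (1 - (1 - (d k)%:C%C) * cinner (phi (wk k)) zeta)^-1 : C^o))//.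
  by apply/funext => k; rewrite {2}/wk cinnerZr conjc_real rmorphB.
have [q0|q0] := eqVneq (cinner zeta Cv + c) 0.
  have [w w1 hw] := linfrac_den0 q0; exists (1 - cinner w zeta).
    rewrite subr_eq0; apply/eqP => h; have := cauchy_schwarz w zeta.
    by rewrite -h nc1 [vnorm zeta]/vnorm z1 sqrtr1 mulr1 leNgt w1.
  by under eq_fun do rewrite hw; rewrite opprB addrC subrK; exact: cvg_cst.
exists (1 - cinner (phi zeta) zeta); last first.
  rewrite opprB addrC subrK; apply: cvg_cinner_radial; exact: differentiable_linfrac.
rewrite subr_eq0 eq_sym; apply: contra fz => /eqP h; apply/eqP/cinner_eq1 => //.
(* In squared form, the limit of [|<phi w_k, phi zeta>| <= |phi zeta|] gives [v^2 <= v], hence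
   [v <= 1]. *)
have := cvg_cabs2 (@cvg_cinner_radial phi (phi zeta) (differentiable_linfrac A B q0)).
set v := vnorm (phi zeta) => L.
have : cabs2 (cinner (phi zeta) (phi zeta)) <= v ^+ 2.
  apply: (cvgr_to_le L); apply: nearW => k; rewrite -nc_sqr lerXn2r ?nnegrE ?nc_ge0 ?vnorm_ge0//.
  apply: le_trans (cauchy_schwarz _ _) _; rewrite ler_piMl ?vnorm_ge0//.
  by apply: ltW; apply: (linfrac_vnorm Hphi); exact: vnorm_radial_lt1.
rewrite cinner_self -nc_sqr nc_real ger0_norm ?vnorm2_ge0// -vnorm_sqr -/v.
have v0 : 0 <= v by exact: vnorm_ge0.
rewrite leNgt => vv; rewrite leNgt; apply/negP => v1; move/negP: vv; apply.
by rewrite expr2 ltr_pMr// (lt_trans ltr01).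
Qed.


End SelfMap.

(** [p0] is left free because the norm estimates ask for large exponents. *)
Lemma boundary_gap (A1 A2 : 'M[C]_N) (B1 B2 C1 C2 : V) (c1 c2 : C) :
  lf_selfmap A1 B1 C1 c1 -> lf_selfmap A2 B2 C2 c2 ->
  let phi := linfrac A1 B1 C1 c1 in let psi := linfrac A2 B2 C2 c2 in
  phi zeta = zeta ->
  (psi zeta != zeta \/ (psi zeta = zeta /\ Dcomp phi zeta zeta zeta != Dcomp psi zeta zeta zeta)) ->
  forall p0, exists p, (p0 <= p)%N /\ exists eta : R, 0 < eta /\ \forall k \near \oo,
    eta <= d k ^+ p.*2 * cabs2 ((1 - cinner (phi (wk k)) (wk k)) ^- p - (1 - cinner (psi (wk k)) (wk k)) ^- p).
Proof.
move=> H1 H2 phi psi fz h p0.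
pose x k : C := (d k)%:C%C / (1 - cinner (phi (wk k)) (wk k)).
pose y k : C := (d k)%:C%C / (1 - cinner (psi (wk k)) (wk k)).
have [a [b [a0 ab cx cy]]] : exists a b : C, [/\ a != 0, a != b,
    (x : nat -> C^o) @ \oo --> (a : C^o) & (y : nat -> C^o) @ \oo --> (b : C^o)].
  have s0 := one_Dcomp_neq0 H1 fz; have cx := cvg_ratio_fixed H1 fz.
  case: h => [pz|[pz st]].
    exists (1 + Dcomp phi zeta zeta zeta)^-1, 0; split.
    - by rewrite invr_eq0; exact: s0.
    - by rewrite invr_eq0; exact: s0.
    - exact: cx.
    - exact: cvg_ratio_away H2 pz.
  exists (1 + Dcomp phi zeta zeta zeta)^-1, (1 + Dcomp psi zeta zeta zeta)^-1; split.
  - by rewrite invr_eq0; exact: s0.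
  - by rewrite (inj_eq invr_inj) (inj_eq (addrI _)); exact: st.
  - exact: cx.
  - exact: cvg_ratio_fixed H2 pz.
(* If the powers agreed for both [p0] and [p0 + 1], cancelling [a^p0 <> 0] would give [a = b]. *)
have [p [pp ne]] : exists p, (p0 <= p)%N /\ a ^+ p != b ^+ p.
  have [E|ne] := eqVneq (a ^+ p0) (b ^+ p0); last by exists p0.
  exists p0.+1; split=> //; rewrite !exprS -E; apply: contra ab => /eqP/mulIf -> //.
  by rewrite expf_neq0.
exists p; split=> //.
pose L := cabs2 (a ^+ p - b ^+ p).
have L0 : 0 < L.
  by rewrite /L -nc_sqr exprn_gt0// lt_neqAle eq_sym nc_eq0 subr_eq0 ne nc_ge0.
exists (L / 2); split; first by rewrite divr_gt0.
have cL := cvg_cabs2 (cvgcB (@cvgcX x a p cx) (@cvgcX y b p cy)).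
have L2 : L / 2 < L by rewrite ltr_pdivrMr// ltr_pMr// ltr1n.
have near_gt : \forall k \near \oo, L / 2 < cabs2 (x k ^+ p - y k ^+ p).
  by apply: (cvgr_gt L cL).
apply: filterS near_gt => k /= hk; apply: ltW; apply: lt_le_trans hk _.
by rewrite /x /y (cabs2_ratio _ _ p (ltW (d0 k))).
Qed.

End Limits.
End Differentiability.

(** * A quasi-triangle inequality for the squared norms *)

Section Triangle.
Variable R : realType.
Variable n : nat.
Local Notation C := (R[i]).
Local Notation N := n.+1.
Local Notation V := 'rV[C]_N.
Local Notation VT := (V : normedModType C).

Lemma analytic_vfmeas (f : V -> C^o) : analytic_on_ball f ->
  vfmeas (fun z => if (vnorm2 z < 1)%R then (cabs2 (f z))%:E else 0%E).
Proof.
by move=> af; apply: vfmeas_cabs2_ball => z /af; exact: differentiable_continuous.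
Qed.

Lemma fct_subB (F G H : V -> C^o) :
  (fun z => (F - H) z - (G - H) z) = (fun z => F z - G z).
Proof. by apply/funext => z; rewrite !fctE opprB addrA subrK. Qed.

Lemma cabs2B_le (x y : C) : cabs2 (x - y) <= 2 * (cabs2 x + cabs2 y).
Proof.
case: x => a b; case: y => c d; rewrite /cabs2 /=.
have := sqr_ge0 (a + c); have := sqr_ge0 (b + d); nra.
Qed.

Lemma lebint_cabs2B_le (F G : V -> C) (w : V -> R) : (forall z, 0 <= w z) ->
  vfmeas (fun z => if (vnorm2 z < 1)%R then (cabs2 (F z) * w z)%:E else 0%E) ->
  vfmeas (fun z => if (vnorm2 z < 1)%R then (cabs2 (G z) * w z)%:E else 0%E) ->
  (lebint (fun z : V => if (vnorm2 z < 1)%R then (cabs2 (F z - G z) * w z)%:E else 0) <=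
   2%:E * (lebint (fun z => if (vnorm2 z < 1)%R then (cabs2 (F z) * w z)%:E else 0) +
           lebint (fun z => if (vnorm2 z < 1)%R then (cabs2 (G z) * w z)%:E else 0)))%E.
Proof.
move=> w0 mF mG; rewrite -(lebintD mF mG) -lebintZ; [|by rewrite lee_fin|exact: vfmeasD].
apply: le_lebint => z; case: ifP => _.
- by rewrite lee_fin mulr_ge0 ?cabs2_ge0.
- exact: lexx.
- by rewrite -EFinD -EFinM lee_fin -mulrDl mulrA ler_wpM2r// cabs2B_le.
- by rewrite adde0 mule0.
Qed.

Lemma sigma_int_sphere_avg (G : V -> \bar R) (r : R) :
  sigma_int (fun z => G (r%:C%C *: z)) = (sphere_avg G r * ((ball_volume R n)^-1)%:E)%E.
Proof. reflexivity. Qed.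

Lemma le_fine_bound (x K : R) (X Y Z : \bar R) : 0 <= K -> (x%:E <= K%:E * X)%E ->
  (X <= 2%:E * (Y + Z))%E -> Y \is a fin_num -> Z \is a fin_num -> x <= K * (2 * (fine Y + fine Z)).
Proof.
move=> K0 xX XYZ /fineK fY /fineK fZ; rewrite -lee_fin; apply: le_trans xX _.
by rewrite (EFinM K) (EFinM 2) (EFinD (fine Y)) fY fZ; apply: lee_wpmul2l; rewrite ?lee_fin.
Qed.

Lemma sigma_int_le_Hardy (f : V -> C^o) (r : R) : 0 < r -> r < 1 ->
  (sigma_int (fun zeta => (cabs2 (f (r%:C%C *: zeta)))%:E) <= Hnorm2 Hardy f)%E.
Proof. by move=> r0 r1; apply: ereal_sup_ubound; exists r => //=; rewrite in_itv /= r0. Qed.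

Lemma sphere_in_ball (r : R) (z : V) : 0 < r -> r < 1 ->
  vnorm2 (r%:C%C *: ((vnorm z)^-1%:C%C *: z)) < 1.
Proof.
move=> r0 r1; rewrite !vnorm2Z -(vnorm_sqr z) -exprMn.
have [->|v0] := eqVneq (vnorm z) 0; first by rewrite mulr0 expr0n mulr0 ltr01.
by rewrite mulVf// expr1n mulr1 expr_lt1// ltW.
Qed.

(** Measurability of [F] and [G] is known inside the ball, where the sphere of radius [r < 1]
    lies. *)
Lemma sigma_int_cabs2B_le (F G : V -> C) (r : R) : 0 < r -> r < 1 ->
  vfmeas (fun z => if (vnorm2 z < 1)%R then (cabs2 (F z))%:E else 0%E) ->
  vfmeas (fun z => if (vnorm2 z < 1)%R then (cabs2 (G z))%:E else 0%E) ->
  (sigma_int (fun zeta : V => (cabs2 (F (r%:C%C *: zeta) - G (r%:C%C *: zeta)))%:E) <=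
   2%:E * (sigma_int (fun zeta => (cabs2 (F (r%:C%C *: zeta)))%:E) +
           sigma_int (fun zeta => (cabs2 (G (r%:C%C *: zeta)))%:E)))%E.
Proof.
move=> r0 r1 mF mG.
have v0 : 0 <= (ball_volume R n)^-1 by rewrite invr_ge0 ltW// ball_volume_gt0.
pose I (f : V -> C) := lebint (fun z => if (vnorm2 z < 1)%R then
   (cabs2 (f (r%:C%C *: ((vnorm z)^-1%:C%C *: z))) * 1)%:E else 0%E).
have E (f : V -> C) : sigma_int (fun zeta => (cabs2 (f (r%:C%C *: zeta)))%:E) = (I f * (ball_volume R n)^-1%:E)%E.
  have S : sphere_avg (fun z => (cabs2 (f z))%:E) r = I f.
    by apply: eq_lebint => z; rewrite mulr1.
  by rewrite -S; exact: (sigma_int_sphere_avg (fun z => (cabs2 (f z))%:E)).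
have m (f : V -> C) : vfmeas (fun z => if (vnorm2 z < 1)%R then (cabs2 (f z))%:E else 0%E) ->
  vfmeas (fun z => if (vnorm2 z < 1)%R then (cabs2 (f (r%:C%C *: ((vnorm z)^-1%:C%C *: z))) * 1)%:E else 0%E).
  move=> mf; have := vfmeas_sphere r mf.
  rewrite (_ : (fun z => _) = (fun z => if (vnorm2 z < 1)%R then (cabs2 (f (r%:C%C *: ((vnorm z)^-1%:C%C *: z))) * 1)%:E else 0%E))//.
  by apply/funext => z; rewrite sphere_in_ball// mulr1.
have L : (I (fun z => (F z - G z)%R) <= 2%:E * (I F + I G))%E := lebint_cabs2B_le (fun=> ler01) (m _ mF) (m _ mG).
have P (f : V -> C) : (0 <= I f)%E.
  by apply: lebint_ge0 => z; case: ifP => _; [rewrite lee_fin mulr1 cabs2_ge0|exact: lexx].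
rewrite (E F) (E G) (E (fun z => F z - G z)).
move: L (P F) (P G); move: (I _) (I F) (I G) => x y z L y0 z0.
rewrite -ge0_muleDl// muleA; apply: lee_wpmul2r => //.
Qed.

(** From the pointwise [|x - y|^2 <= 2 (|x|^2 + |y|^2)]; the constant 2 is harmless and spares
    Minkowski's inequality. *)
Lemma Hnorm2B_le (sp : fspace R) (F G : V -> C^o) : (forall a, sp = Bergman a -> -1 < a) ->
  analytic_on_ball F -> analytic_on_ball G ->
  (Hnorm2 sp (fun z => F z - G z)%R <= 2%:E * (Hnorm2 sp F + Hnorm2 sp G))%E.
Proof.
move=> hsp aF aG.
have aFG : analytic_on_ball (fun z => F z - G z).
  by move=> z z1; exact: (differentiableB (aF z z1) (aG z z1)).
have mF := analytic_vfmeas aF; have mG := analytic_vfmeas aG; have mFG := analytic_vfmeas aFG.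
have v0 : 0 <= (ball_volume R n)^-1 by rewrite invr_ge0 ltW// ball_volume_gt0.
case: sp hsp => [|a] hsp.
  apply: ge_ereal_sup => x [r rI <-].
  have /andP[r0 r1] : 0 < r < 1 by move: rI; rewrite /= in_itv /=.
  apply: le_trans (sigma_int_cabs2B_le r0 r1 mF mG) _.
  apply: lee_wpmul2l; first by rewrite lee_fin.
  exact: leeD (sigma_int_le_Hardy F r0 r1) (sigma_int_le_Hardy G r0 r1).
have a1 := hsp a erefl.
rewrite !(Hnorm2_bergman a1)//.
have c0 : 0 <= bergman_cst n a / ball_volume R n.
  by apply: mulr_ge0 => //; apply: ltW; exact: bergman_cst_gt0.
move: (bergman_cst n a / ball_volume R n) c0 => c c0.
have P (f : V -> C) : (0 <= lebint (fun z : V => if (vnorm2 z < 1)%R then (cabs2 (f z) * (1 - vnorm2 z) `^ a)%:E else 0))%E.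
  by apply: lebint_ge0 => z; case: ifP => _; [rewrite lee_fin mulr_ge0 ?cabs2_ge0 ?powR_ge0|exact: lexx].
have w0 (z : V) : 0 <= (1 - vnorm2 z) `^ a by exact: powR_ge0.
have L := lebint_cabs2B_le w0 (vfmeas_bergman a mF) (vfmeas_bergman a mG).
apply: le_trans (lee_wpmul2l _ L) _; first by rewrite lee_fin.
by rewrite muleCA ge0_muleDr.
Qed.

End Triangle.

(** * The test functions against compactness *)

Section Main.
Variable R : realType.
Variable n : nat.
Local Notation C := (R[i]).
Local Notation N := n.+1.
Local Notation V := 'rV[C]_N.
Local Notation VT := (V : normedModType C).

Lemma one_sub_cinner_ge1 (z a : V) : vnorm a <= 1 -> 1 - vnorm z <= nc (1 - cinner z a).
Proof.
move=> a1; have := cauchy_schwarz z a; have := ler_wpM2l (vnorm_ge0 z) a1; rewrite mulr1.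
have := ncD (1 - cinner z a) (cinner z a); rewrite addrNK nc1; lra.
Qed.

Lemma cabs2_szego_le p k (z a : V) : vnorm a <= 1 -> vnorm z < 1 ->
  cabs2 (szego p k a z) <= cabs2 k * (1 - vnorm z) ^- p.*2.
Proof.
move=> a1 z1; rewrite cabs2_szego ler_wpM2l ?cabs2_ge0//.
have z0 : 0 < 1 - vnorm z by rewrite subr_gt0.
have h := one_sub_cinner_ge1 z a1; have h0 := lt_le_trans z0 h.
rewrite -nc_sqr -exprM mul2n lef_pV2 ?posrE ?exprn_gt0// lerXn2r ?nnegrE ?nc_ge0 ?(ltW z0)//.
Qed.

Lemma analytic_szego p k (a : V) : vnorm a <= 1 -> analytic_on_ball (szego p k a : V -> C^o).
Proof.
move=> a1 z; rewrite /Bball /= -vnorm_lt1 => z1; apply: differentiable_szego.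
rewrite -nc_eq0 gt_eqF//; apply: lt_le_trans (one_sub_cinner_ge1 z a1).
by rewrite subr_gt0.
Qed.

(** [x] and [y] will be the images of two test functions at the point [w] of the first, and [q] the
    factor [d^beta] there. The constants give [e <= 2 (e/8 + e/8)], which is absurd. *)
Lemma gap_contradiction (x y : C) (q e K a b c : R) : 0 < e -> 0 < K -> 0 <= q ->
  e <= cabs2 x * q -> cabs2 (x - y) * q <= K * (2 * (a + b)) ->
  a < e / (32 * K) -> b < e / (32 * K) -> cabs2 y <= c -> c * q < e / 8 -> False.
Proof.
move=> e0 K0 q0 xe xy ae be yc cq.
have X : cabs2 x <= 2 * (cabs2 (x - y) + cabs2 y).
  by have := cabs2B_le (x - y) (- y); rewrite opprK subrK -(mulN1r y) cabs2M -[cabs2 (-1)]nc_sqr ncN nc1 expr1n mul1r.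
have {}X := ler_wpM2r q0 X.
have {}yc := ler_wpM2r q0 yc.
have M2 : K * (2 * (a + b)) <= e / 8.
  have -> : e / 8 = K * (2 * (e / (32 * K) + e / (32 * K))) by field; rewrite gt_eqF.
  by rewrite ler_wpM2l ?(ltW K0)// ler_wpM2l// lerD// ltW.
have {xy M2}xy := le_trans xy M2.
move: X yc xe xy cq e0; rewrite -mulrA (mulrDl (cabs2 (x - y))); clear.
by move: (cabs2 x * q) (c * q) (cabs2 (x - y) * q) (cabs2 y * q) => *; lra.
Qed.

(** The shift by 2 keeps the values at most [1/2], as the ellipsoid requires. *)
Definition dseq (k : nat) : R := k.+2%:R^-1.

Lemma dseq_gt0 k : 0 < dseq k. Proof. by rewrite invr_gt0. Qed.

Lemma dseq_half k : dseq k <= 1 / 2.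
Proof. by rewrite /dseq div1r lef_pV2 ?posrE// ler_nat. Qed.

Lemma cvg_dseq : dseq @ \oo --> (0 : R).
Proof. by have := @cvg_harmonic R; rewrite -(cvg_shiftS (@harmonic R : nat -> R)). Qed.

Lemma not_compact_Cdiff (sp : fspace R)
    (A1 : 'M[C]_N) (B1 C1 : V) (c1 : C) (A2 : 'M[C]_N) (B2 C2 : V) (c2 : C) (zeta : V) :
  (forall alpha, sp = Bergman alpha -> -1 < alpha) ->
  lf_selfmap A1 B1 C1 c1 -> lf_selfmap A2 B2 C2 c2 -> Bsphere zeta ->
  linfrac A1 B1 C1 c1 zeta = zeta ->
  (linfrac A2 B2 C2 c2 zeta != zeta \/
   (linfrac A2 B2 C2 c2 zeta = zeta /\
    Dcomp (linfrac A1 B1 C1 c1) zeta zeta zeta != Dcomp (linfrac A2 B2 C2 c2) zeta zeta zeta)) ->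
  ~ compact_on sp (Cdiff (linfrac A1 B1 C1 c1) (linfrac A2 B2 C2 c2)).
Proof.
move=> hsp H1 H2 z1 fz hz [TH Tc].
set phi := linfrac A1 B1 C1 c1 in fz hz TH Tc; set psi := linfrac A2 B2 C2 c2 in hz TH Tc.
pose d := dseq; have d0 := dseq_gt0; have dh := dseq_half.
have d1 k : d k <= 1 by apply: le_trans (dh k) _; rewrite ler_pdivrMr// mul1r ler1n.
pose w k : V := (1 - d k)%:C%C *: zeta.
have w1 k : vnorm (w k) < 1 by exact: vnorm_radial_lt1.
(* [b] is the weight exponent, read as 0 in the Hardy case. Since [t + 1 > |b|], the choice
   [p >= N + t + 3] gives both [a + 2 <= 2p - N] and [beta + 1 <= 2p]. *)
pose b : R := if sp is Bergman a then a else 0.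
pose t := Num.trunc `|b|; have tb : `|b| < t%:R + 1 by rewrite natr1; exact: truncnS_gt.
have bb : b <= `|b| by exact: ler_norm.
have [p [pp [eta [eta0 gap]]]] := boundary_gap d0 cvg_dseq z1 d1 H1 H2 fz hz (N + t + 3).
have Np : (N <= p)%N by apply: leq_trans pp; rewrite -addnA leq_addr.
have p2 : (p.*2 - N)%:R = p.*2%:R - N%:R :> R by rewrite natrB// (leq_trans Np)// -addnn leq_addr.
have pR : N%:R + t%:R + 3 <= p%:R :> R by rewrite -!natrD ler_nat.
have p2R : p.*2%:R = p%:R + p%:R :> R by rewrite -addnn natrD.
have N0 : 1 <= N%:R :> R by rewrite ler1n.
have t0 : 0 <= t%:R :> R by [].
have hszego a : sp = Bergman a -> -1 < a /\ a + 2 <= (p.*2 - N)%:R.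
  move=> E; split; first exact: hsp.
  by rewrite p2 p2R; have : b = a by [rewrite /b E]; lra.
have hx : hexp n sp + 1 <= p.*2%:R.
  by move: bb tb; rewrite /hexp /b p2R; case: (sp) => [|a] bb tb; lra.
have [K1 [K10 HK1]] := Hnorm2_szego hszego Np.
have [K2 [K20 HK2]] := @point_eval R n sp hsp.
pose be := hexp n sp.
(* Chosen to cancel the constant and the power of [d k] in [Hnorm2_szego]. *)
pose kap k : C := (Num.sqrt (K1^-1 * d k `^ (p.*2%:R - be)))%:C%C.
have kapE k : cabs2 (kap k) = K1^-1 * d k `^ (p.*2%:R - be).
  by rewrite -nc_sqr nc_real ger0_norm ?sqrtr_ge0// sqr_sqrtr// mulr_ge0 ?powR_ge0// invr_ge0 ltW.
pose u k : V -> C^o := szego p (kap k) (w k).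
have au k : analytic_on_ball (u k) by apply: analytic_szego; exact: ltW.
have nu k : (Hnorm2 sp (u k) <= 1)%E.
  apply: le_trans (HK1 _ _ _ z1 (d0 k) (d1 k)) _.
  rewrite kapE -mulrA mulrA mulfV ?gt_eqF// mul1r -powRD; last by rewrite (gt_eqF (d0 k)) implybT.
  by rewrite addrA subrK subrr powRr0.
have hu k : inH sp (u k) /\ (Hnorm2 sp (u k) <= 1)%E.
  by split => //; split => //; apply: le_lt_trans (nu k) _; rewrite ltry.
have [sub [g [hsub [[ag _] cH]]]] := Tc u hu.
have sub_ge k : (k <= sub k)%N.
  by elim: k => // k IH; apply: leq_ltn_trans IH _; exact: hsub.
pose T := Cdiff phi psi.
have aT k : analytic_on_ball (T (u k)) by exact: (TH _ (hu k).1).1.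
have rT k : slice_regular (T (u k)).
  by apply: slice_regularB; apply: slice_regular_szego => //; exact: w1.
pose H k := Hnorm2 sp (T (u (sub k)) - g).
have [/= finH cfH] := (fine_cvgP _ _).1 cH.
(* Both images are compared with [g] in norm, but only their difference, which is slice-regular, is
   evaluated at [w (sub k)]. *)
have main k l : (H k \is a fin_num) -> (H l \is a fin_num) ->
  cabs2 (T (u (sub k)) (w (sub k)) - T (u (sub l)) (w (sub k))) * d (sub k) `^ be <= K2 * (2 * (fine (H k) + fine (H l))).
  move=> fk fl.
  have aB j : analytic_on_ball (T (u (sub j)) - g).
    by move=> z zb; exact: (differentiableB (aT _ z zb) (ag z zb)).
  have L := Hnorm2B_le hsp (aB k) (aB l).
  have aD : analytic_on_ball (fun z => T (u (sub k)) z - T (u (sub l)) z).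
    by move=> z zb; exact: (differentiableB (aT _ z zb) (aT _ z zb)).
  have P := HK2 _ _ _ z1 (d0 (sub k)) (dh (sub k)) (slice_regularB (rT (sub k)) (rT (sub l))) (analytic_vfmeas aD).
  have E : (fun z => (T (u (sub k)) - g) z - (T (u (sub l)) - g) z) = (fun z => T (u (sub k)) z - T (u (sub l)) z).
    exact: fct_subB.
  by rewrite E in L; exact: le_fine_bound (ltW K20) P L fk fl.
(* [|1 - <x, w_l>| >= 1 - |x|] bounds the denominators independently of [l], and
   [|kap l|^2 <= K1^-1 d_l] supplies the decay. *)
have dom (z : V) : vnorm z < 1 -> exists K, forall l, cabs2 (T (u l) z) <= K * d l.
  move=> zz; have f1 := linfrac_vnorm H1 zz; have f2 := linfrac_vnorm H2 zz.
  exists (2 * (K1^-1 * (1 - vnorm (phi z)) ^- p.*2 + K1^-1 * (1 - vnorm (psi z)) ^- p.*2)) => l.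
  apply: le_trans (cabs2B_le _ _) _; rewrite -mulrA ler_wpM2l// mulrDl.
  have kd : cabs2 (kap l) <= K1^-1 * d l.
    rewrite kapE ler_wpM2l ?invr_ge0 ?(ltW K10)//.
    rewrite -[leRHS]powRr1 ?(ltW (d0 l))//; apply: ger_powR; first by rewrite d0 d1.
    by rewrite lerBrDr addrC.
  have kd' (x : R) : 0 <= x -> cabs2 (kap l) * x <= K1^-1 * x * d l.
    by move=> x0; rewrite mulrAC ler_wpM2r.
  have q x : vnorm x < 1 -> cabs2 (u l x) <= K1^-1 * (1 - vnorm x) ^- p.*2 * d l.
    move=> x1; apply: le_trans (cabs2_szego_le p (kap l) (ltW (w1 l)) x1) _.
    by apply: kd'; rewrite invr_ge0 exprn_ge0// subr_ge0 ltW.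
  exact: lerD (q _ f1) (q _ f2).
pose e := K1^-1 * eta; have e0 : 0 < e by rewrite mulr_gt0 ?invr_gt0.
(* The power of [d k] in [|kap k|^2] times [d_k^beta] is [d_k^(2p)], the factor in
   [boundary_gap]. *)
have low : \forall k \near \oo, e <= cabs2 (T (u k) (w k)) * d k `^ be.
  apply: filterS gap => k gk.
  have -> : T (u k) (w k) = kap k * ((1 - cinner (phi (w k)) (w k)) ^- p - (1 - cinner (psi (w k)) (w k)) ^- p).
    by rewrite /T /Cdiff /u /szego mulrBr.
  rewrite cabs2M kapE -!mulrA ler_wpM2l ?invr_ge0 ?(ltW K10)//.
  suff -> : forall c, d k `^ (p.*2%:R - be) * (c * d k `^ be) = d k ^+ p.*2 * c by exact: gk.
  move=> c; rewrite mulrCA mulrC -powRD; last by rewrite (gt_eqF (d0 k)) implybT.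
  by rewrite subrK powR_mulrn ?(ltW (d0 k)).
have [k0 _ hk0] := low.
have small : \forall k \near \oo, fine (H k) < e / (32 * K2).
  have e1 : 0 < e / (32 * K2) by rewrite divr_gt0// mulr_gt0.
  by apply: (cvgr_lt _ cfH).
(* [k] is fixed first; the point [w (sub k)] then decides how large [l] has to be. *)
have [k [[fk sk] kk]] := filter_ex (filterI (filterI finH small) (nbhs_infty_ge k0)).
have [K HK] := dom _ (w1 (sub k)).
have K0 : 0 <= K.
  have := le_trans (cabs2_ge0 _) (HK 0%N); rewrite pmulr_lge0//.
pose be' := d (sub k) `^ be; have b0 : 0 <= be' by exact: powR_ge0.
have tail : \forall l \near \oo, K * d l * be' < e / 8.
  have c0 : (fun l => K * d l * be') @ \oo --> (0 : R).
    by rewrite -(mul0r be') -(mulr0 K); apply: cvgMr_tmp; apply: cvgMl_tmp; exact: cvg_dseq.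
  have e8 : 0 < e / 8 by rewrite divr_gt0.
  by apply: (cvgr_lt _ c0).
have [l0 _ hl0] := tail.
have [l [[fl sl] ll]] := filter_ex (filterI (filterI finH small) (nbhs_infty_ge l0)).
have A := hk0 _ (leq_trans kk (sub_ge k)).
have B := hl0 _ (leq_trans ll (sub_ge l)).
have M := main k l fk fl.
have D := HK (sub l).
exact: (gap_contradiction e0 K20 b0 A M sk sl D B).
Qed.

End Main.

Unset Implicit Arguments.

(* Dimension N = m.+2 (so N > 1); the space is H^2(B_N) (sp = Hardy) or
   A^2_alpha(B_N) with alpha > -1 (sp = Bergman alpha). *)
Theorem theorem6 (R : realType) (m : nat) (sp : fspace R)
    (A1 : 'M[R[i]]_m.+2) (B1 C1 : 'rV[R[i]]_m.+2) (d1 : R[i])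
    (A2 : 'M[R[i]]_m.+2) (B2 C2 : 'rV[R[i]]_m.+2) (d2 : R[i])
    (zeta : 'rV[R[i]]_m.+2) :
  (forall alpha, sp = Bergman alpha -> -1 < alpha) ->
  lf_selfmap A1 B1 C1 d1 ->
  lf_selfmap A2 B2 C2 d2 ->
  Bsphere zeta ->
  linfrac A1 B1 C1 d1 zeta = zeta ->
  (linfrac A2 B2 C2 d2 zeta != zeta \/
   (linfrac A2 B2 C2 d2 zeta = zeta /\
    Dcomp (linfrac A1 B1 C1 d1) zeta zeta zeta
      != Dcomp (linfrac A2 B2 C2 d2) zeta zeta zeta)) ->
  ~ compact_on sp (Cdiff (linfrac A1 B1 C1 d1) (linfrac A2 B2 C2 d2)).
Proof. exact: not_compact_Cdiff. Qed.
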